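(* Let $d\ge1$, $T \in (0,\infty)$, $\alpha \in (0,1)$, and $p \in (1,\infty)$ be such that $$\sigma := 1 - \frac{d+2/\alpha}{p} > 0.$$ Then, for $u \in \mathcal{H}_{p,0}^{\alpha,1}(\mathbb{R}^d_T)$, we have $$[u]_{C^{\sigma \alpha/2,\sigma}(\mathbb{R}^d_T)} \leq N \|u\|_{\mathcal{H}_p^{\alpha,1}(\mathbb{R}^d_T)},$$ where $N=N(d,\alpha,p)$.
   Context: $\mathbb{R}^d_T=(0,T)\times\mathbb{R}^d$. The parabolic Hölder seminorm is $[u]_{C^{\sigma\alpha/2,\sigma}(\mathcal{D})}=\sup\frac{|u(t,x)-u(s,y)|}{|t-s|^{\sigma\alpha/2}+|x-y|^\sigma}$ over distinct $(t,x),(s,y)\in\mathcal{D}$ (for a suitable representative of $u$). Fractional integral: $I_0^{1-\alpha}u(t,x)=\frac1{\Gamma(1-\alpha)}\int_0^t(t-s)^{-\alpha}u(s,x)\,ds$; $D_t^\alpha u=\partial_tI_0^{1-\alpha}u$. Summation over repeated indices is understood. Let $\Omega\subset\mathbb{R}^d$ be open and $\Omega_T=(0,T)\times\Omega$. Space $\mathbb{H}_p^{-1}(\Omega_T)$: distributions $w=D_ig_i+f$ with $g_i,f\in L_p(\Omega_T)$, with norm $\inf\{\sum_i\|g_i\|_{L_p}+\|f\|_{L_p}: w=D_ig_i+f\}$. Space $\mathcal{H}_p^{\alpha,1}(\Omega_T)$: functions $u\in L_p(\Omega_T)$ with $D_xu\in L_p(\Omega_T)$ for which there exist $g_i,f\in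 L_p(\Omega_T)$ such that $\int_0^T\int_\Omega I_0^{1-\alpha}u\,\partial_t\varphi\,dx\,dt=\int_0^T\int_\Omega (g_iD_i\varphi-f\varphi)\,dx\,dt$ for all $\varphi\in C_0^\infty([0,T)\times\Omega)$ (i.e. $D_t^\alpha u=D_ig_i+f\in\mathbb{H}_p^{-1}$); norm $\|u\|_{L_p}+\|D_xu\|_{L_p}+\|D_t^\alpha u\|_{\mathbb{H}_p^{-1}}$. Space $\mathcal{H}_{p,0}^{\alpha,1}(\Omega_T)$: those $u\in\mathcal{H}_p^{\alpha,1}(\Omega_T)$ that are limits in this norm of $u_n\in C^\infty([0,T]\times\Omega)$ vanishing for large $|x|$ with $u_n(0,x)=0$. *)

(* Defs.v *)
From HB Require Import structures.
From mathcomp Require Import all_boot all_order all_algebra.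
From mathcomp Require Import all_classical all_reals all_analysis.

Set Implicit Arguments.
Unset Strict Implicit.
Unset Printing Implicit Defensive.
Import Order.TTheory GRing.Theory Num.Theory.
Import numFieldNormedType.Exports.

Local Open Scope classical_set_scope.
Local Open Scope ring_scope.

Definition measure_rV_display : measure_display -> measure_display.
Proof. exact. Qed.

(* The sigma-algebra on ['rV[T]_n] is the one generated by the coordinates
   (the Borel sigma-algebra when [T] is the real line). *)
Section measurable_rV.
Context {d} {T : measurableType d} (n : nat).

Let coord (i : 'I_n) (v : 'rV[T]_n) : T := v ord0 i.

Let rV_set0 : g_sigma_preimage coord set0.
Proof. exact: sigma_algebra0. Qed.

Let rV_setC A : g_sigma_preimage coord A -> g_sigma_preimage coord (~` A).
Proof. exact: sigma_algebraC. Qed.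

Let rV_bigcup (F : (set 'rV[T]_n)^nat) :
  (forall i, g_sigma_preimage coord (F i)) ->
  g_sigma_preimage coord (\bigcup_i (F i)).
Proof. exact: sigma_algebra_bigcup. Qed.

HB.instance Definition _ := @isMeasurable.Build (measure_rV_display d)
  'rV[T]_n (g_sigma_preimage coord) rV_set0 rV_setC rV_bigcup.

End measurable_rV.

Lemma measurable_rV_coord d (T : measurableType d) n (i : 'I_n) :
  measurable_fun [set: 'rV[T]_n] (fun v => v ord0 i).
Proof.
move=> _ Y mY; rewrite setTI; apply: sub_sigma_algebra => /=.
rewrite -bigcup_seq/=; exists i => /=; first by rewrite mem_index_enum.
by exists Y => //; rewrite setTI.
Qed.

Lemma measurable_fun_rVP d1 d2 (T1 : measurableType d1) (T2 : measurableType d2)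
    n (f : T1 -> 'rV[T2]_n) :
  measurable_fun [set: T1] f <->
  forall i, measurable_fun [set: T1] (fun x => f x ord0 i).
Proof.
split=> [mf i|mf].
  exact: (measurableT_comp (@measurable_rV_coord _ _ _ i) mf).
apply: (@measurability _ _ _ _ setT f
    (\big[setU/set0]_(i < n)
       preimage_set_system setT (fun v : 'rV[T2]_n => v ord0 i) measurable)) => //.
move=> _ [B + <-]; rewrite setTI -bigcup_seq/= => -[i _ [Y mY <-]].
by rewrite setTI; have := mf i measurableT Y mY; rewrite setTI.
Qed.

Definition cons_rV (T : Type) n (p : T * 'rV[T]_n) : 'rV[T]_n.+1 :=
  \row_j (if unlift ord0 j is Some k then p.2 ord0 k else p.1).

Definition uncons_rV (T : Type) n (v : 'rV[T]_n.+1) : T * 'rV[T]_n :=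
  (v ord0 ord0, \row_j v ord0 (lift ord0 j)).

Lemma cons_rVK (T : Type) n : cancel (@cons_rV T n) (@uncons_rV T n).
Proof.
move=> [x v]; rewrite /uncons_rV /cons_rV; congr pair.
  by rewrite mxE unlift_none.
by apply/rowP => j; rewrite !mxE liftK.
Qed.

Section cons_measure.
Context (R : realType) (n : nat).

Lemma measurable_cons_rV :
  measurable_fun [set: measurableTypeR R * 'rV[R]_n] (@cons_rV R n).
Proof.
apply/measurable_fun_rVP => i.
rewrite (_ : (fun _ => _) = fun x : measurableTypeR R * 'rV[R]_n =>
  if unlift ord0 i is Some k then x.2 ord0 k else x.1); last first.
  by apply/funext => x; rewrite mxE.
case: unliftP => [j _|_]; last exact: measurable_fst.
exact: (measurableT_comp (@measurable_rV_coord _ _ _ j) measurable_snd).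
Qed.

Lemma measurable_uncons_rV :
  measurable_fun [set: 'rV[R]_n.+1]
    (@uncons_rV R n : 'rV[R]_n.+1 -> measurableTypeR R * 'rV[R]_n).
Proof.
apply: measurable_fun_pair; first exact: measurable_rV_coord.
apply/measurable_fun_rVP => i.
rewrite (_ : (fun _ => _) = fun v : 'rV[R]_n.+1 => v ord0 (lift ord0 i)).
  exact: measurable_rV_coord.
by apply/funext => v; rewrite mxE.
Qed.

Variable m : {sigma_finite_measure set 'rV[R]_n -> \bar R}.

Definition cons_measure : set 'rV[R]_n.+1 -> \bar R :=
  pushforward (@lebesgue_measure R \x m)%E (@cons_rV R n).

Let cons_measure_is_pushforward : {measure set 'rV[R]_n.+1 -> \bar R} :=
  measure_function_pushforward__canonical__measure_function_Measure
    [the {measure set _ -> \bar R} of (@lebesgue_measure R \x m)%E]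
    measurable_cons_rV.

HB.instance Definition _ :=
  Measure.copy cons_measure cons_measure_is_pushforward.

Lemma cons_measure_prod (A : set R) (B : set 'rV[R]_n) :
  measurable A -> measurable B ->
  cons_measure (@uncons_rV R n @^-1` (A `*` B)) = (lebesgue_measure A * m B)%E.
Proof.
move=> mA mB; rewrite /cons_measure /pushforward -comp_preimage.
rewrite (_ : _ \o _ = id) ?preimage_id; last first.
  by apply/funext => x; exact: cons_rVK.
exact: product_measure1E.
Qed.

Let cons_measure_sigma_finite : sigma_finite setT cons_measure.
Proof.
have /sigma_finiteP[F [TF ndF Foo]] := sigma_finiteT (@lebesgue_measure R).
have /sigma_finiteP[G [TG ndG Goo]] := sigma_finiteT m.
exists (fun k => @uncons_rV R n @^-1` (F k `*` G k)).
  rewrite predeqE => v; split=> // _.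
  have [i _ Fi] : (\bigcup_i F i) (uncons_rV v).1 by rewrite -TF.
  have [j _ Gj] : (\bigcup_i G i) (uncons_rV v).2 by rewrite -TG.
  exists (maxn i j) => //; split.
  - by move: Fi; exact/subsetPset/ndF/leq_maxl.
  - by move: Gj; exact/subsetPset/ndG/leq_maxr.
move=> k; have [mF Fk] := Foo k; have [mG Gk] := Goo k; split.
  rewrite -[X in measurable X]setTI; apply: measurable_uncons_rV => //.
  exact: measurableX.
by rewrite cons_measure_prod// lte_mul_pinfty// ge0_fin_numE.
Qed.

HB.instance Definition _ := Measure_isSigmaFinite.Build _ _ _ cons_measure
  cons_measure_sigma_finite.

End cons_measure.

Fixpoint lebesgue_rV (R : realType) (n : nat) :
    {sigma_finite_measure set 'rV[R]_n -> \bar R} :=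
  if n is n'.+1 then cons_measure (lebesgue_rV R n') else dirac (0 : 'rV[R]_0).

Lemma lebesgue_rV_box (R : realType) n (A : 'I_n -> set R) :
  (forall i, measurable (A i)) ->
  lebesgue_rV R n [set v | forall i, A i (v ord0 i)] =
  (\prod_(i < n) lebesgue_measure (A i))%E.
Proof.
elim: n A => [A _|n IH A mA].
  rewrite big_ord0 /= diracE mem_set// => -[].
  by [].
rewrite big_ord_recl -IH// /=.
have mB : measurable [set v : 'rV[R]_n | forall i, A (lift ord0 i) (v ord0 i)].
  rewrite (_ : [set _ | _] = \bigcap_(i in [set: 'I_n])
    (fun v : 'rV[R]_n => v ord0 i) @^-1` A (lift ord0 i)).
    apply: fin_bigcap_measurable => // i _.
    by rewrite -[X in measurable X]setTI; exact: measurable_rV_coord.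
  by apply/seteqP; split=> v /= Av i; have := Av i; [move=> + _|exact].
rewrite -cons_measure_prod//; congr cons_measure.
apply/seteqP; split=> v /= => [Av|[A0 Av] i].
  by split=> // i; rewrite mxE.
by case: (unliftP ord0 i) => [j ->|->//]; have := Av j; rewrite mxE.
Qed.

(* Meant for [U] open: [derivable] and ['D_v] look at a full neighborhood. *)
Fixpoint Ck (R : realType) (V : normedModType R) (k : nat) (U : set V)
    (f : V -> R) : Prop :=
  (forall x, U x -> {for x, continuous f}) /\
  if k is k'.+1 then
    forall v, (forall x, U x -> derivable f x v) /\ Ck k' U ('D_v f)
  else True.

(* Smoothness on a set that need not be open: [f] coincides on [S] with a
   function that is smooth on an open neighborhood of [S]. *)
Definition smooth_on (R : realType) (V : normedModType R) (S : set V)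
    (f : V -> R) : Prop :=
  exists (U : set V) (F : V -> R),
    [/\ open U, S `<=` U, forall k, Ck k U F & {in S, f =1 F}].

Definition test_fun (R : realType) (V : normedModType R) (S : set V)
    (phi : V -> R) : Prop :=
  smooth_on S phi /\
  exists K, [/\ compact K, K `<=` S & forall x, ~ K x -> phi x = 0].

(* The library norm on ['rV[R]_d] is the sup norm. *)
Definition eucl_norm (R : realType) (d : nat) (x : 'I_d -> R) : R :=
  Num.sqrt (\sum_(i < d) x i ^+ 2).

Definition parabolic_holder (R : realType) (d : nat) (a b : R)
    (D : set (R * 'rV[R]_d)) (u : R * 'rV[R]_d -> R) : \bar R :=
  ereal_sup [set q : \bar R | exists z w, [/\ D z, D w, z <> w &
    q = (`|u z - u w| / (`|z.1 - w.1| `^ a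
         + eucl_norm ((z.2 - w.2) ord0) `^ b))%:E]].

Definition Gamma_fun (R : realType) (x : R) : R :=
  \int[@lebesgue_measure R]_(t in `]0, +oo[) (t `^ (x - 1) * expR (- t)).

Section spaces.
Context (R : realType) (d : nat) (alpha p T : R) (Omega : set 'rV[R]_d).

Local Notation point := (R * 'rV[R]_d)%type.

Definition lebesgue_tx :
    {measure set (measurableTypeR R * 'rV[R]_d) -> \bar R} :=
  (@lebesgue_measure R \x lebesgue_rV R d)%E.

Definition cylinder : set point := `]0, T[%classic `*` Omega.

(* Elements of [L_p] are represented by functions that are Borel on the
   cylinder and arbitrary outside of it. *)
Definition Lp_cyl (f : point -> R) : Prop :=
  f \_ cylinder \in Lfun lebesgue_tx p%:E.

Definition Lp_norm (f : point -> R) : \bar R :=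
  ('N[lebesgue_tx]_(p%:E)[EFin \o (f \_ cylinder)])%E.

Definition int_cyl (f : point -> R) : R :=
  \int[lebesgue_tx]_(z in cylinder) f z.

Definition dt (f : point -> R) : point -> R := 'D_(1, 0) f.

Definition dx (i : 'I_d) (f : point -> R) : point -> R :=
  'D_(0, delta_mx ord0 i) f.

Definition is_weak_dx (i : 'I_d) (u g : point -> R) : Prop :=
  forall phi, test_fun cylinder phi ->
    int_cyl (fun z => u z * dx i phi z) = - int_cyl (fun z => g z * phi z).

Definition is_Lp_gradient (u : point -> R) (G : 'I_d -> point -> R) : Prop :=
  forall i, Lp_cyl (G i) /\ is_weak_dx i u (G i).

(* [Dx u] is unique up to null sets whenever it exists. *)
Definition Dx (u : point -> R) : 'I_d -> point -> R :=
  xget (fun _ _ => 0) (is_Lp_gradient u).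

Definition distribution_cyl := (point -> R) -> R.

Definition div_form (g : 'I_d -> point -> R) (f : point -> R) :
    distribution_cyl := fun phi =>
  int_cyl (fun z => f z * phi z - \sum_(i < d) g i z * dx i phi z).

Definition Hm1_norm (w : distribution_cyl) : \bar R :=
  ereal_inf [set q : \bar R | exists (g : 'I_d -> point -> R) (f : point -> R),
    [/\ forall i, Lp_cyl (g i), Lp_cyl f,
        forall phi, test_fun cylinder phi -> w phi = div_form g f phi &
        q = (\sum_(i < d) Lp_norm (g i) + Lp_norm f)%E]].

(* The Riemann-Liouville integral of order [1 - alpha]. *)
Definition frac_int (u : point -> R) : point -> R := fun z =>
  (Gamma_fun (1 - alpha))^-1 *
  \int[@lebesgue_measure R]_(s in `]0, z.1[)
    ((z.1 - s) `^ (- alpha) * u (s, z.2)).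

(* [D_t^alpha u], the distributional time derivative of [frac_int u] *)
Definition frac_Dt (u : point -> R) : distribution_cyl :=
  fun phi => - int_cyl (fun z => frac_int u z * dt phi z).

(* [D_t^alpha u = D_i g_i + f], tested against functions that need not vanish
   at time [0]. *)
Definition has_frac_Dt (u : point -> R) (g : 'I_d -> point -> R)
    (f : point -> R) : Prop :=
  forall phi, test_fun (`[0, T[%classic `*` Omega) phi ->
    int_cyl (fun z => frac_int u z * dt phi z) =
    int_cyl (fun z => \sum_(i < d) g i z * dx i phi z - f z * phi z).

Definition calH (u : point -> R) : Prop :=
  [/\ Lp_cyl u, exists G, is_Lp_gradient u G &
      exists (g : 'I_d -> point -> R) (f : point -> R),
        [/\ forall i, Lp_cyl (g i), Lp_cyl f & has_frac_Dt u g f]].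

Definition calH_norm (u : point -> R) : \bar R :=
  (Lp_norm u + Lp_norm (fun z => eucl_norm (fun i => Dx u i z))
   + Hm1_norm (frac_Dt u))%E.

Definition calH0 (u : point -> R) : Prop :=
  calH u /\ exists un : nat -> point -> R,
  [/\ forall n, calH (un n),
      forall n, smooth_on (`[0, T]%classic `*` Omega) (un n),
      forall n, exists M : R, forall t x, t \in `[0, T] -> Omega x ->
        M <= eucl_norm (x ord0) -> un n (t, x) = 0,
      forall n x, Omega x -> un n (0, x) = 0 &
      calH_norm (un n \- u) @[n --> \oo] --> 0%E].

End spaces.

(* Main.v *)
Require Import Defs.
From HB Require Import structures.
From mathcomp Require Import all_boot all_order all_algebra.
From mathcomp Require Import all_classical all_reals all_analysis.
From mathcomp Require Import ring lra.
From mathcomp Require Import measurable_realfun.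

Set Implicit Arguments.
Unset Strict Implicit.
Unset Printing Implicit Defensive.
Import Order.TTheory GRing.Theory Num.Theory.
Import numFieldNormedType.Exports.

Local Open Scope classical_set_scope.
Local Open Scope ring_scope.

(* Let [w] be continuous and bounded on the cylinder, such that the [L_p] norms
   of [w], of [D_x w] and of some [g], [f] with [D_t^alpha w = D_i g_i + f] are
   at most [M], and let [W(t; c, r)] be the average of [w (t, .)] against a
   product of smooth bumps supported in the cube with corner [c] and side [r].
   Since [w] is bounded, [I_0^(1 - alpha) w] vanishes at time zero.
   Testing the equation with products of functions of one variable and inverting
   the Abel integral writes [W] as the fractional integral of order [alpha] in
   time of a function in [L_p]; by Hoelder's inequality [W] is then
   [(alpha - 1/p)]-Hoelder in time with constant [C M r^(-1 - d/p)] for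
   [r <= 1].  Testing the weak gradient against antiderivatives of differences
   of bumps compares [W(t; c, r)] with [W(t; c', r')] when [r'] is comparable to
   [r] and [|c - c'| <= r], after averaging in time over a window of length
   [r^(2/alpha)].  Together these give
   [|W(t; c, r) - W(t; c', r')| <= C M r^sigma]; summing over [r = 2^(-k)]
   bounds both [w - W] and the parabolic Hoelder seminorm of [w].  Only linearity
   and [L_p] bounds enter, so the estimate applies to differences of the
   approximating functions [u_n], which therefore converge uniformly to a
   representative of [u]. *)

(** * Smooth functions of one variable *)

(** The equation is available only against functions supported in the open cylinder, so the absence
    of an initial term has to come from [w] itself: boundedness gives
    [I_0^(1 - alpha) w = O(t^(1 - alpha))], which beats the growth [1/t] of the derivative of a
    cutoff. The sup bound serves this and integrability but enters no constant; this matters because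
    nothing bounds the approximants uniformly beforehand. Cut off at time zero, averages vanish at
    negative times, and the kernel estimate may compare with such times; windows lie in the past of
    [t]. Hence no extension beyond [T] and no dependence on [T]. With [h = r^(2/alpha)] the two
    errors balance: [r^(-1 - d/p) h^(alpha - 1/p)] from time and [r r^(-d/p) h^(-1/p)] from the
    gradient both equal [r^sigma]. The assumption [sigma > 0] makes the dyadic sum converge and
    forces [alpha p > 2], hence [(alpha - 1) q > -1] for the conjugate exponent [q]: the Abel kernel
    is locally in [L_q]. *)

Section smooth1.
Context {R : realType}.
Implicit Types (f g h : R -> R) (k n : nat).

(** Each derivative is an existential witness, so that closure under sums, products and inverses
    goes by induction with the [is_derive] rules, without computing any [derive1]. *)
Fixpoint dtimes k f : Prop :=
  if k is k'.+1 then
    exists g, (forall x : R, is_derive x 1 f (g x)) /\ dtimes k' g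
  else True.

Definition smooth1 f := forall k, dtimes k f.

Lemma dtimesW k f : dtimes k.+1 f -> dtimes k f.
Proof.
elim: k f => // k IH f [g [fg gk]]; exists g; split => //; exact: IH.
Qed.

Lemma dtimes_cst k (c : R) : dtimes k (fun=> c).
Proof.
elim: k c => // k IH c; exists (fun=> 0); split => // x; exact: is_derive_cst.
Qed.

Lemma dtimesD k f g : dtimes k f -> dtimes k g -> dtimes k (fun x => f x + g x).
Proof.
elim: k f g => // k IH f g [f' [ff' f'k]] [g' [gg' g'k]].
exists (fun x => f' x + g' x); split; last exact: IH.
by move=> x; exact: is_deriveD.
Qed.

Lemma dtimesM k f g : dtimes k f -> dtimes k g -> dtimes k (fun x => f x * g x).
Proof.
elim: k f g => // k IH f g fk gk.
have [f' [ff' f'k]] := fk; have [g' [gg' g'k]] := gk.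
exists (fun x => f x * g' x + g x * f' x); split.
  by move=> x; apply: is_deriveM.
by apply: dtimesD; apply: IH => //; exact: dtimesW.
Qed.

Lemma dtimesZ k (c : R) f : dtimes k f -> dtimes k (fun x => c * f x).
Proof. by move=> fk; apply: dtimesM => //; exact: dtimes_cst. Qed.

Lemma dtimesN k f : dtimes k f -> dtimes k (fun x => - f x).
Proof.
move=> /(dtimesZ (-1)).
by rewrite (_ : (fun _ => _) = fun x => - f x)//; apply/funext => x; rewrite mulN1r.
Qed.

Lemma is_derive_affine f (a c x f' : R) : is_derive (a * x + c) 1 f f' ->
  is_derive x 1 (fun x => f (a * x + c)) (a * f').
Proof.
move=> ff'.
have h : is_derive x 1 (fun x => a * x + c) a.
  by apply: is_derive_eq; rewrite addr0 /GRing.scale/= mulr1.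
rewrite mulrC; exact: (@is_derive1_comp _ f (fun x => a * x + c)).
Qed.

Lemma dtimes_affine k f (a c : R) : dtimes k f -> dtimes k (fun x => f (a * x + c)).
Proof.
elim: k f => // k IH f [f' [ff' f'k]].
exists (fun x => a * f' (a * x + c)); split; last by apply: dtimesZ; exact: IH.
by move=> x; exact: is_derive_affine.
Qed.

(** The derivative of [1/f] is a product of [1/f], [1/f] and [- f'], all of them differentiable to
    one order less. *)
Lemma dtimesV k f : (forall x, f x != 0) -> dtimes k f -> dtimes k (fun x => (f x)^-1).
Proof.
move=> f0; elim: k => // k IH fk.
have [f' [ff' f'k]] := fk.
exists (fun x => (f x)^-1 * ((f x)^-1 * - f' x)); split.
  move=> x.
  apply: (is_derive_eq (is_deriveV (f0 x) (ff' x))).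
  by rewrite /GRing.scale/=; field.
have := IH (dtimesW fk) => IHk.
by apply: dtimesM => //; apply: dtimesM => //; exact: dtimesN.
Qed.

Lemma smooth1_derivable f x : smooth1 f -> derivable f x 1.
Proof. by move=> /(_ 1%N)[g [fg _]]; apply: ex_derive; exact: fg. Qed.

Lemma dtimes_derive1 k f : dtimes k.+1 f -> dtimes k (derive1 f).
Proof.
move=> [g [fg gk]]; suff -> : derive1 f = g by [].
by apply/funext => x; rewrite derive1E; have := fg x => ?; rewrite derive_val.
Qed.

Lemma smooth1_derive1 f : smooth1 f -> smooth1 (derive1 f).
Proof. by move=> fs k; exact/dtimes_derive1/fs. Qed.

Lemma smooth1_is_derive f (x : R) : smooth1 f -> is_derive x 1 f (derive1 f x).
Proof.
by move=> fs; rewrite derive1E; apply: DeriveDef => //; exact: smooth1_derivable.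
Qed.

Lemma smooth1_continuous f : smooth1 f -> continuous f.
Proof.
move=> fs x; apply: differentiable_continuous; apply/derivable1_diffP.
exact: smooth1_derivable.
Qed.

Lemma smooth1D f g : smooth1 f -> smooth1 g -> smooth1 (fun x => f x + g x).
Proof. by move=> fs gs k; exact: dtimesD. Qed.

Lemma smooth1N f : smooth1 f -> smooth1 (fun x => - f x).
Proof. by move=> fs k; exact: dtimesN. Qed.

Lemma smooth1B f g : smooth1 f -> smooth1 g -> smooth1 (fun x => f x - g x).
Proof. by move=> fs gs; apply: smooth1D => //; exact: smooth1N. Qed.

Lemma smooth1M f g : smooth1 f -> smooth1 g -> smooth1 (fun x => f x * g x).
Proof. by move=> fs gs k; exact: dtimesM. Qed.

Lemma smooth1Z (c : R) f : smooth1 f -> smooth1 (fun x => c * f x).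
Proof. by move=> fs k; exact: dtimesZ. Qed.

Lemma smooth1_affine f (a c : R) : smooth1 f -> smooth1 (fun x => f (a * x + c)).
Proof. by move=> fs k; exact: dtimes_affine. Qed.

Lemma smooth1V f : (forall x, f x != 0) -> smooth1 f -> smooth1 (fun x => (f x)^-1).
Proof. by move=> f0 fs k; exact: dtimesV. Qed.

(* The factor [h] vanishes near [x <= 0], so the singularity is harmless. *)
Lemma smooth1_powR_cutoff (gam del : R) h : 0 < del ->
  smooth1 h -> (forall x, x <= del -> h x = 0) ->
  smooth1 (fun x => x `^ gam * h x).
Proof.
move=> + + + k; elim: k gam del h => // k IH gam del h del0 hs h0.
have h'0 x : x <= del / 2 -> derive1 h x = 0.
  move=> xd; rewrite derive1E (@near_eq_derive _ _ _ _ (cst 0)) ?derive_cst//.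
  by near=> y; apply: h0; apply: ltW; near: y; apply: lt_nbhsl; lra.
have del2 : 0 < del / 2 by lra.
exists (fun x => gam * (x `^ (gam - 1) * h x) + x `^ gam * derive1 h x); split.
  move=> x; have [xd|xd] := leP x (del / 2).
    rewrite h0 ?h'0 ?mulr0 ?addr0//; last by lra.
    apply: (@near_eq_is_derive _ _ _ (cst 0)).
    near=> y; rewrite h0 ?mulr0//; apply: ltW; near: y; apply: lt_nbhsl; lra.
  have x0 : 0 < x by lra.
  apply: (is_derive_eq (is_deriveM (is_derive1_powR gam x0) (smooth1_is_derive x hs))).
  by rewrite /GRing.scale/=; ring.
apply: dtimesD; first by apply: dtimesZ; exact: (IH _ del).
apply: (IH _ (del / 2)) => //; exact: smooth1_derive1.
Unshelve. all: by end_near. Qed.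

(** The family [x^(-n) exp(-1/x)], extended by zero, is closed under differentiation up to linear
    combinations; smoothness at the origin is then an induction over the whole family. *)
Definition flat n (x : R) : R := if x <= 0 then 0 else x ^- n * expR (- x^-1).

Lemma flatE n x : 0 < x -> flat n x = x ^- n * expR (- x^-1).
Proof. by rewrite /flat leNgt => ->. Qed.

Lemma flat_ge0 n x : 0 <= flat n x.
Proof.
rewrite /flat; case: ifPn => // x0; rewrite mulr_ge0 ?expR_ge0//.
by rewrite invr_ge0 exprn_ge0//; lra.
Qed.

Lemma flat_gt0 x : 0 < x -> 0 < flat 0 x.
Proof. by move=> x0; rewrite flatE// expr0 invr1 mul1r expR_gt0. Qed.

(** The term of order [n + 1] in the series of [exp(1/x)] already gives this. *)
Lemma flat_le n (x : R) : 0 < x -> flat n x <= n.+1`!%:R * x.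
Proof.
move=> x0; rewrite flatE// expRN -invfM -[leRHS]invrK.
have xn : 0 < x ^+ n by rewrite exprn_gt0.
rewrite lef_pV2 ?posrE ?mulr_gt0 ?expR_gt0 ?invr_gt0 ?ltr0n ?fact_gt0//.
have x1 : 0 <= x^-1 by rewrite invr_ge0 ltW.
have f0 : 0 < n.+1`!%:R :> R by rewrite ltr0n fact_gt0.
have := expR_ge1Dxn n x1; rewrite -(ler_pM2l xn); apply: le_trans.
rewrite mulrDr mulr1 -[leLHS]add0r lerD ?(ltW xn)//.
by rewrite exprVn exprS le_eqVlt; apply/orP; left; apply/eqP; field; rewrite !gt_eqF.
by rewrite mulr_gt0 ?ltr0n ?fact_gt0.
Qed.

Lemma is_derive_flat n (x : R) :
  is_derive x 1 (flat n) (flat n.+2 x - n%:R * flat n.+1 x).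
Proof.
have [x0|x0|->] := ltgtP x 0.
- have fx k : flat k x = 0 by rewrite /flat ltW.
  rewrite !fx mulr0 subr0.
  apply: (@near_eq_is_derive _ _ _ (cst 0)).
  by near=> y; rewrite /flat ifT// ltW//; near: y; exact: lt_nbhsl.
- rewrite !flatE//.
  have xn0 : x != 0 by rewrite gt_eqF.
  have xn1 : x ^+ n != 0 by rewrite expf_neq0.
  have h1 : is_derive x 1 (fun x => x^-1) (- x ^- 2 *: 1) by exact: is_deriveV.
  have h2 : is_derive x 1 (fun x => - x^-1) (- (- x ^- 2 *: 1)) by exact: is_deriveN.
  have h3 := @is_derive1_comp _ (@expR R) (fun x => - x^-1) x _ _ (is_derive_expR _) h2.
  have h4 : is_derive x 1 (fun x => (x ^+ n)^-1) (- (x ^+ n) ^- 2 *: (n%:R * x ^+ n.-1)).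
    apply: is_deriveV => //.
    have := is_deriveX n (is_derive_id x 1).
    rewrite (_ : id ^+ n = fun x => x ^+ n); last by apply/funext => y; rewrite exprfctE.
    by move=> h; apply: (is_derive_eq h); rewrite /GRing.scale/= mulr1 -mulr_natl.
  have h5 : is_derive x 1 (fun x => x ^- n * expR (- x^-1))
      (x ^- n.+2 * expR (- x^-1) - n%:R * (x ^- n.+1 * expR (- x^-1))).
    apply: (is_derive_eq (is_deriveM h4 h3)).
    rewrite /GRing.scale/=.
    case: n xn1 {h4} => [|n] xn1.
      by rewrite !expr0; field.
    have xn2 : x ^+ n != 0 by rewrite expf_neq0.
    rewrite /= !exprS; move: xn2; set X := x ^+ n => xn2; set m := n.+1%:R; set E := expR _.
    field.
    by rewrite ?xn0 ?xn2.
  apply: (near_eq_is_derive _ h5).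
  by near=> y; rewrite flatE//; near: y; exact: lt_nbhsr.
- have fx k : flat k 0 = 0 by rewrite /flat lexx.
  rewrite !fx mulr0 subr0.
  (* At the origin the difference quotient [flat n h / h] is [flat n.+1 h], which is at most a
     multiple of [h]. *)
  have h : (fun h : R => h^-1 *: (flat n (h *: 1 + 0) - flat n 0)) @ 0^' --> (0 : R).
    apply/cvgrPdist_le => /= e e0; near=> h.
    have h0 : h != 0 by near: h; exact: nbhs_dnbhs_neq.
    rewrite fx subr0 addr0 sub0r normrN /GRing.scale/= mulr1 normrM.
    have [hp|hp] := ltP 0 h; last first.
      by rewrite /flat hp normr0 mulr0 ltW.
    rewrite gtr0_norm ?invr_gt0// ger0_norm ?flat_ge0//.
    have -> : h^-1 * flat n h = flat n.+1 h.
      by rewrite !flatE// mulrA exprS invfM.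
    apply: (le_trans (flat_le _ hp)).
    rewrite -ler_pdivlMl ?ltr0n ?fact_gt0//.
    rewrite -[leLHS](gtr0_norm hp); near: h.
    apply: (dnbhs0_le); rewrite mulr_gt0// invr_gt0 ltr0n fact_gt0//.
  by apply: DeriveDef; [apply/cvg_ex; exists 0|exact: cvg_lim h].
Unshelve. all: by end_near. Qed.

Lemma smooth1_flat n : smooth1 (flat n).
Proof.
move=> k; elim: k n => // k IH n.
exists (fun x => flat n.+2 x - n%:R * flat n.+1 x); split.
  by move=> x; exact: is_derive_flat.
by apply: dtimesD => //; apply: dtimesN; exact: dtimesZ.
Qed.

(** The classical smooth transition from 0 to 1 on [[0, 1]]. The argument [1 - x] is spelled
    [-1 * x + 1] to match the affine substitution lemmas. *)
Definition step (x : R) : R := flat 0 x / (flat 0 x + flat 0 (-1 * x + 1)).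

Let step_den x : 0 < flat 0 x + flat 0 (-1 * x + 1).
Proof.
have [x0|x0] := ltP 0 x; first by rewrite ltr_pwDl ?flat_ge0// flat_gt0.
by rewrite ltr_wpDl ?flat_ge0// flat_gt0//; lra.
Qed.

Lemma smooth1_step : smooth1 step.
Proof.
apply: smooth1M; first exact: smooth1_flat.
apply: smooth1V; first by move=> x; rewrite gt_eqF.
by apply: smooth1D; [|apply: smooth1_affine]; exact: smooth1_flat.
Qed.

Lemma step0 x : x <= 0 -> step x = 0.
Proof. by move=> x0; rewrite /step {1}/flat x0 mul0r. Qed.

Lemma step1 x : 1 <= x -> step x = 1.
Proof.
move=> x1; have := step_den x; rewrite /step.
have -> : flat 0 (-1 * x + 1) = 0 by rewrite /flat ifT//; lra.
by rewrite addr0 => h; rewrite divff// gt_eqF.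
Qed.

Lemma step_ge0 x : 0 <= step x.
Proof. by rewrite /step divr_ge0 ?flat_ge0// ltW. Qed.

Lemma step_le1 x : step x <= 1.
Proof. by rewrite /step ler_pdivrMr// mul1r lerDl flat_ge0. Qed.

Lemma derive1_eq0 f (x y c : R) : x < y ->
  (forall z, x < z < y -> f z = c) -> forall z, x < z < y -> derive1 f z = 0.
Proof.
move=> xy fc z /andP[xz zy]; rewrite derive1E (@near_eq_derive _ _ _ _ (cst c)) ?derive_cst//.
near=> t; apply: fc; apply/andP; split; near: t; [exact: lt_nbhsr|exact: lt_nbhsl].
Unshelve. all: by end_near. Qed.

(* The closed endpoints are reached by continuity. *)
Lemma smooth1_supp_derive1 f (a b : R) : smooth1 f ->
  (forall x, ~~ (a <= x <= b) -> f x = 0) ->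
  forall x, ~~ (a <= x <= b) -> derive1 f x = 0.
Proof.
move=> fs f0 x; rewrite negb_and -!ltNge => /orP[xa|bx].
  apply: (@derive1_eq0 _ (x - 1) a 0); [lra| |lra].
  by move=> z /andP[_ za]; apply: f0; rewrite negb_and -ltNge za.
apply: (@derive1_eq0 _ b (x + 1) 0); [lra| |lra].
by move=> z /andP[za _]; apply: f0; rewrite negb_and -!ltNge za orbT.
Qed.

Lemma smooth1_bounded f (a b : R) : smooth1 f ->
  (forall x, ~~ (a <= x <= b) -> f x = 0) ->
  exists2 M, 0 < M & forall x, `|f x| <= M.
Proof.
move=> fs f0; have [ab|ba] := leP a b; last first.
  by exists 1 => // x; rewrite f0 ?normr0// ?ler01//; apply/negP => /andP[]; lra.
have cf : {within `[a, b], continuous f}.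
  by apply: continuous_subspaceT; exact: smooth1_continuous.
have [c _ cM] : exists2 c, c \in `[a, b] & forall t, t \in `[a, b] -> `|f t| <= `|f c|.
  apply: (@EVT_max _ (fun x => `|f x|)) => //; apply: continuous_subspaceT => x.
  by apply: continuous_comp; [exact: smooth1_continuous|exact: norm_continuous].
exists (`|f c| + 1); first by rewrite ltr_wpDl.
move=> x; have [xab|xab] := boolP (a <= x <= b).
  by apply: (le_trans (cM x _)) => //=; rewrite ?in_itv//= lerDl.
by rewrite f0// normr0 addr_ge0.
Qed.

(** Taken as a derivative so that its integral is 1 by the fundamental theorem and its
    antiderivative is known in closed form. *)
Definition bump : R -> R := derive1 step.

Lemma smooth1_bump : smooth1 bump.
Proof. exact/smooth1_derive1/smooth1_step. Qed.

Lemma bump_supp x : ~~ (0 <= x <= 1) -> bump x = 0.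
Proof.
rewrite negb_and -!ltNge => /orP[x0|x1].
  apply: (@derive1_eq0 _ (x - 1) 0 0); [lra| |lra].
  by move=> z /andP[_ z0]; rewrite step0 ?ltW.
apply: (@derive1_eq0 _ 1 (x + 1) 1); [lra| |lra].
by move=> z /andP[z1 _]; rewrite step1 ?ltW.
Qed.

Lemma bump_bounded : exists B : R, [/\ 1 <= B, forall x, `|bump x| <= B &
  forall x, `|derive1 bump x| <= B].
Proof.
have [B B0 bB] := smooth1_bounded smooth1_bump bump_supp.
have [B' B'0 b'B] := smooth1_bounded (smooth1_derive1 smooth1_bump)
  (smooth1_supp_derive1 smooth1_bump bump_supp).
exists (1 + B + B'); split; first by lra.
  by move=> x; apply: le_trans (bB x) _; lra.
by move=> x; apply: le_trans (b'B x) _; lra.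
Qed.

End smooth1.

(** * Integrals on the line: affine substitution, powers, the beta integral *)

Section line_integrals.
Context {R : realType}.
Local Notation lam := (@lebesgue_measure R).

Section affine.
Variables (a c : R).
Hypothesis a0 : a != 0.

Let phi (x : measurableTypeR R) : measurableTypeR R := a * x + c.

Let mphi : measurable_fun setT phi.
Proof. by apply: measurable_funD => //; exact: measurable_funM. Qed.

Let pushforward_affine : {measure set (measurableTypeR R) -> \bar R} :=
  measure_function_pushforward__canonical__measure_function_Measure lam mphi.

(** By uniqueness of Lebesgue measure it suffices to compare on the intervals []u, v]]; for negative
    [a] the preimage is closed on the left instead, with the same length. *)
Let lam_affine (A : set (measurableTypeR R)) : measurable A ->
  lam A = mscale `|a|%:nng pushforward_affine A.
Proof.
apply: lebesgue_measure_unique => _ [[u v]] _ <-.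
rewrite [RHS](_ : _ = `|a|%:E * lam (phi @^-1` `]u, v]))%E//.
rewrite lebesgue_measure_itv/= lte_fin.
have [alt0|agt0] := ltP a 0.
  rewrite (_ : phi @^-1` _ = `[(v - c) / a, (u - c) / a[%classic); last first.
    apply/seteqP; split=> x /=; rewrite /phi !in_itv/= => /andP[h1 h2]; apply/andP; split.
    - by rewrite ler_ndivrMr//; lra.
    - by rewrite ltr_ndivlMr//; lra.
    - by move: h2; rewrite ltr_ndivlMr//; lra.
    - by move: h1; rewrite ler_ndivrMr//; lra.
  rewrite lebesgue_measure_itv/= lte_fin ltr_ndivrMr// mulfVK//.
  rewrite ltrD2r; case: ifPn => uv; last by rewrite mule0.
  by rewrite -!EFinB -EFinM ltr0_norm//; congr EFin; field.
have {}agt0 : 0 < a by rewrite lt_def a0.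
rewrite (_ : phi @^-1` _ = `](u - c) / a, (v - c) / a]%classic); last first.
  apply/seteqP; split=> x /=; rewrite /phi !in_itv/= => /andP[h1 h2]; apply/andP; split.
  - by rewrite ltr_pdivrMr//; lra.
  - by rewrite ler_pdivlMr//; lra.
  - by move: h1; rewrite ltr_pdivrMr//; lra.
  - by move: h2; rewrite ler_pdivlMr//; lra.
rewrite lebesgue_measure_itv/= lte_fin ltr_pdivrMr// mulfVK//.
rewrite ltrD2r; case: ifPn => uv; last by rewrite mule0.
by rewrite -!EFinB -EFinM gtr0_norm//; congr EFin; field.
Qed.

Lemma ge0_integral_affine (f : R -> \bar R) :
  measurable_fun setT f -> (forall x, 0 <= f x)%E ->
  (\int[lam]_x f (a * x + c)%R = (`|a|^-1)%:E * \int[lam]_x f x)%E.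
Proof.
move=> mf f0.
have -> : (\int[lam]_x f x = `|a|%:E * \int[lam]_x f (a * x + c)%R)%E.
  rewrite (@eq_measure_integral _ _ _ setT (mscale `|a|%:nng pushforward_affine)).
    rewrite ge0_integral_mscale// ge0_integral_pushforward//.
  by move=> A mA _; exact: lam_affine.
by rewrite muleA -EFinM mulVf ?mul1e// normr_eq0.
Qed.

End affine.

(** Away from the singularity the fundamental theorem applies; monotone convergence lets the left
    endpoint tend to 0, where [b + 1 > 0] kills the boundary term. *)
Lemma integral_powR (b L : R) : -1 < b -> 0 < L ->
  (\int[lam]_(x in `]0%R, L]) (x `^ b)%:E = (L `^ (b + 1) / (b + 1))%:E)%E.
Proof.
move=> b1 L0.
have b10 : 0 < b + 1 by lra.
(* The denominator [n + 2] keeps every interval nondegenerate, as the fundamental theorem asks for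
   [L / (n + 2) < L]. *)
pose F n : set R := `[L / n.+2%:R, L]%classic.
have -> : `]0%R, L]%classic = \bigcup_n F n.
  apply/seteqP; split=> [x /=|x [n _] /=]; rewrite !in_itv/= => /andP[x0 xL].
    have [n nx] : exists n, L / n.+2%:R <= x.
      exists (Num.truncn (L / x)); rewrite ler_pdivrMr ?ltr0n// mulrC -ler_pdivrMr//.
      by rewrite ltW// (lt_trans (truncnS_gt _))// ltr_nat.
    by exists n => //; rewrite /F/= in_itv/= nx.
  by rewrite !bnd_simp in x0 xL; rewrite xL andbT (lt_le_trans _ x0)// divr_gt0// ltr0n.
have mp D : measurable D -> measurable_fun D (fun x : R => (x `^ b)%:E).
  by move=> mD; apply/measurable_EFinP/measurable_funTS; exact: measurable_powR.
have nF : nondecreasing_seq F.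
  move=> m n mn; apply/subsetPset; apply: subset_itvr; rewrite bnd_simp.
  by rewrite ler_pM2l// lef_pV2 ?posrE ?ltr0n// ler_nat !ltnS.
have cF : (\int[lam]_(x in F n) (x `^ b)%:E)%E @[n --> \oo] -->
    (\int[lam]_(x in \bigcup_n F n) (x `^ b)%:E)%E.
  apply: ge0_nondecreasing_set_cvg_integral => //.
  - by move=> n; exact: measurable_itv.
  - by move=> n; apply: mp; exact: measurable_itv.
  - by move=> n x _; rewrite lee_fin powR_ge0.
apply: (cvg_unique _ cF) => //.
have FE n : (\int[lam]_(x in F n) (x `^ b)%:E)%E =
    (L `^ (b + 1) / (b + 1) - (L / n.+2%:R) `^ (b + 1) / (b + 1))%:E.
  have n0 : 0 < L / n.+2%:R by rewrite divr_gt0// ltr0n.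
  rewrite EFinB (@continuous_FTC2 _ _ (fun x => x `^ (b + 1) / (b + 1)))//.
  - by rewrite ltr_pdivrMr ?ltr0n// ltr_pMr// ltr1n.
  - apply: derivable_within_continuous => x; rewrite in_itv/= => /andP[xn _].
    by apply: derivable_powR; rewrite in_itv/= andbT (lt_le_trans n0).
  - have dd x : 0 < x -> derivable (fun x => x `^ (b + 1) / (b + 1)) x 1.
      by move=> x0; apply: derivableM => //; apply: derivable_powR; rewrite in_itv/= andbT.
    have cc x : 0 < x -> {for x, continuous (fun x => x `^ (b + 1) / (b + 1))}.
      by move=> x0; apply: differentiable_continuous; exact/derivable1_diffP/dd.
    split.
    + by move=> x; rewrite in_itv/= => /andP[xn _]; apply: dd; exact: lt_trans xn.
    + by apply: cvg_at_right_filter; exact: cc.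
    + by apply: cvg_at_left_filter; exact: cc.
  - move=> x; rewrite in_itv/= => /andP[xn _].
    have x0 : 0 < x by exact: lt_trans xn.
    have h := is_deriveM (is_derive1_powR (b + 1) x0) (is_derive_cst (b + 1)^-1 x 1).
    rewrite derive1E; have -> := @derive_val _ _ _ _ _ _ _ h.
    by rewrite /GRing.scale/= mulr0 add0r addrK mulrA mulVf ?mul1r// gt_eqF.
rewrite (_ : (fun n => _) = (fun n => (L `^ (b + 1) / (b + 1) - (L / n.+2%:R) `^ (b + 1) / (b + 1))%:E)); last first.
  by apply/funext => n; exact: FE.
apply: cvg_EFin; first by near=> n.
rewrite /comp/= -[X in _ --> X]subr0; apply: cvgB; first exact: cvg_cst.
rewrite -(mul0r (b + 1)^-1); apply: cvgM; last exact: cvg_cst.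
have cv : (L / n.+2%:R : R) @[n --> \oo] --> 0.
  rewrite -(mulr0 L); apply: cvgM; first exact: cvg_cst.
  have h := @cvg_harmonic R; rewrite /harmonic/= in h.
  by rewrite -(cvg_shiftS (fun n => n.+1%:R^-1 : R)) in h.
have /cvg_at_rightP := powR_cvg0 b10; apply.
by split => // n; rewrite divr_gt0// ltr0n.
Unshelve. all: by end_near. Qed.

Lemma measurable_bool_natr d (T : measurableType d) (f : T -> bool) :
  measurable_fun setT f -> measurable_fun setT (fun x => (f x)%:R : R).
Proof.
move=> mf; rewrite (_ : (fun _ => _) = fun x => if f x then 1 else 0 : R).
  by apply: measurable_fun_ifT => //; exact: measurable_cst.
by apply/funext => x; case: (f x).
Qed.

(** The truncated power [x_+^b]. Since [powR] does not vanish at negative bases, the truncation is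
    built in, and convolution kernels can be integrated over the whole line. *)
Definition ppow (b x : R) : R := if 0 < x then x `^ b else 0.

Lemma ppow_ge0 b x : 0 <= ppow b x.
Proof. by rewrite /ppow; case: ifP => // _; exact: powR_ge0. Qed.

Lemma ppowE b x : 0 < x -> ppow b x = x `^ b.
Proof. by rewrite /ppow => ->. Qed.

Lemma ppow0 b x : x <= 0 -> ppow b x = 0.
Proof. by rewrite /ppow leNgt; case: ifP. Qed.

Lemma ppowX b x q : q != 0 -> ppow b x `^ q = ppow (b * q) x.
Proof.
by move=> q0; rewrite /ppow; case: ifP => _; [rewrite powRrM|rewrite powR0].
Qed.

Lemma measurable_ppow b : measurable_fun setT (ppow b).
Proof.
apply: measurable_fun_if => //.
  apply: measurable_fun_ltr => //; exact: measurable_cst.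
by apply: measurable_funTS; exact: measurable_powR.
Qed.

Lemma measurable_ppow_comp d (T : measurableType d) (f : T -> R) b :
  measurable_fun setT f -> measurable_fun setT (fun x => ppow b (f x)).
Proof. exact: measurableT_comp (measurable_ppow b). Qed.

Lemma ppow_nincr b x y : b <= 0 -> 0 < x -> x <= y -> ppow b y <= ppow b x.
Proof.
move=> b0 x0 xy; have y0 : 0 < y by exact: lt_le_trans xy.
rewrite !ppowE//; rewrite -(opprK b) !(powRN _ (- b)) lef_pV2 ?posrE ?powR_gt0//.
by apply: ge0_ler_powR => //; rewrite ?nnegrE ?oppr_ge0// ltW.
Qed.

Lemma integral_ppow b L : -1 < b -> 0 < L ->
  (\int[lam]_x (ppow b x * (x <= L)%R%:R)%:E = (L `^ (b + 1) / (b + 1))%:E)%E.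
Proof.
move=> b1 L0; rewrite -(integral_powR b1 L0) [RHS]integral_mkcond.
apply: eq_integral => x _; rewrite patchE.
case: ifPn => [|/negP].
  by rewrite inE/= in_itv/= => /andP[x0 xL]; rewrite ppowE// xL mulr1.
have [x0|x0] := ltP 0 x; last by rewrite ppow0// mul0r.
by rewrite inE/= in_itv/= x0/= => /negP/negbTE ->; rewrite mulr0.
Qed.

(* Lower half: [(1 - x)^(a-1) <= 2]; upper half: [x^(-a) <= 2]. *)
Let beta_kernel_le (a x : R) : 0 < a < 1 ->
  ppow (a - 1) (1 - x) * ppow (- a) x <=
  2 * (ppow (- a) x * (x <= 1)%R%:R + ppow (a - 1) (1 - x) * (1 - x <= 1)%R%:R).
Proof.
move=> /andP[a0 a1].
have [x0|x0] := leP x 0; first by rewrite (@ppow0 (- a))// mulr0 mulr_ge0// addr_ge0// mulr_ge0// ?ppow_ge0// ler0n.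
have [x1|x1] := leP 1 x; first by rewrite (@ppow0 (a - 1)) ?subr_le0// mul0r mulr_ge0// addr_ge0// mulr_ge0// ?ppow_ge0// ler0n.
have -> : (x <= 1)%R by lra.
have -> : (1 - x <= 1)%R by lra.
rewrite !mulr1.
have le2 b : -1 <= b -> b <= 0 -> (2^-1 : R) `^ b <= 2.
  move=> b1 b0; have e2 : (2^-1 : R) `^ (-1) = 2 by rewrite powR_inv1 ?invrK ?invr_ge0.
  by rewrite -[leRHS]e2; apply: ger_powR => //; lra.
have e1 : 0 <= ppow (- a) x by exact: ppow_ge0.
have e2 : 0 <= ppow (a - 1) (1 - x) by exact: ppow_ge0.
have [xh|xh] := leP x 2^-1.
  have : ppow (a - 1) (1 - x) <= 2.
    apply: (le_trans (@ppow_nincr _ 2^-1 (1 - x) _ _ _)); [lra|lra|lra|].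
    by rewrite ppowE//; apply: le2; lra.
  by move=> h; nra.
have : ppow (- a) x <= 2.
  apply: (le_trans (@ppow_nincr _ 2^-1 x _ _ _)); [lra|lra|lra|].
  by rewrite ppowE//; apply: le2; lra.
by move=> h; nra.
Qed.

Let mbeta_kernel (a : R) :
  measurable_fun [set: R] (fun x : R => ppow (a - 1) (1 - x) * ppow (- a) x).
Proof.
apply: measurable_funM; last exact: measurable_ppow.
by apply: measurable_ppow_comp; exact: measurable_funB.
Qed.

Let mppow_le (b s L : R) (f : R -> R) : measurable_fun [set: R] f ->
  measurable_fun [set: R] (fun x : R => (ppow b (f x) * (f x <= L)%R%:R)%:E).
Proof.
move=> mf; apply/measurable_EFinP; apply: measurable_funM; first exact: measurable_ppow_comp.
by apply: measurable_bool_natr; apply: measurable_fun_ler => //; exact: measurable_cst.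
Qed.

Lemma integral_ppow_sub b (s L : R) : -1 < b -> 0 < L ->
  (\int[lam]_x (ppow b (s - x) * (s - x <= L)%R%:R)%:E = (L `^ (b + 1) / (b + 1))%:E)%E.
Proof.
move=> b1 L0; rewrite -integral_ppow//.
have mf : measurable_fun [set: R] (fun x : R => (ppow b x * (x <= L)%R%:R)%:E).
  exact: mppow_le.
have := @ge0_integral_affine (-1) s _ _ mf.
rewrite normrN1 invr1 mul1e => <-//.
- by apply: eq_integral => x _; rewrite mulN1r [- x + s]addrC.
- by move=> x; rewrite lee_fin mulr_ge0// ?ppow_ge0// ler0n.
Qed.

(** Euler's integral [B(1 - a, a)]; the inversion relies on its being finite and positive. *)
Definition beta_const (a : R) : R :=
  fine (\int[lam]_x (ppow (a - 1) (1 - x) * ppow (- a) x)%:E)%E.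

Lemma beta_constE a : 0 < a < 1 ->
  (\int[lam]_x (ppow (a - 1) (1 - x) * ppow (- a) x)%:E)%E = (beta_const a)%:E.
Proof.
move=> a01; have /andP[a0 a1] := a01.
rewrite /beta_const fineK// ge0_fin_numE; last first.
  by apply: integral_ge0 => x _; rewrite lee_fin mulr_ge0// ppow_ge0.
apply: (@le_lt_trans _ _ (\int[lam]_x (2%:E * ((ppow (- a) x * (x <= 1)%R%:R)%:E +
    (ppow (a - 1) (1 - x) * (1 - x <= 1)%R%:R)%:E)))%E).
  apply: ge0_le_integral => //.
  - by move=> x _; rewrite lee_fin mulr_ge0// ppow_ge0.
  - by apply/measurable_EFinP; exact: mbeta_kernel.
  - by apply: emeasurable_funM => //; apply: emeasurable_funD; apply: mppow_le => //; exact: measurable_funB.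
  - by move=> x _; rewrite -EFinD -EFinM lee_fin; exact: beta_kernel_le.
have h0 (b x L : R) : (0 <= (ppow b x * (x <= L)%R%:R)%:E)%E.
  by rewrite lee_fin mulr_ge0// ?ppow_ge0// ler0n.
rewrite ge0_integralZl//; last 2 first.
- by apply: emeasurable_funD; apply: mppow_le => //; exact: measurable_funB.
- by move=> x _; rewrite adde_ge0.
rewrite ge0_integralD//; last 2 first.
- exact: mppow_le.
- by apply: mppow_le => //; exact: measurable_funB.
by rewrite integral_ppow ?integral_ppow_sub ?ltry//; lra.
Qed.

Lemma beta_const_gt0 a : 0 < a < 1 -> 0 < beta_const a.
Proof.
move=> a01; have /andP[a0 a1] := a01.
rewrite -lte_fin -beta_constE// (@lt_le_trans _ _ 1%E)//.
have <- : (\int[lam]_x (\1_`]0, 1[%classic x)%:E = 1)%E.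
  by rewrite integral_indic//= setIT lebesgue_measure_itv/= lte_fin ltr01 oppr0 adde0.
apply: ge0_le_integral => //.
- by apply/measurable_EFinP; exact: measurable_indic.
- by apply/measurable_EFinP; exact: mbeta_kernel.
move=> x _; rewrite lee_fin indicE; have [|] := boolP (x \in _); last first.
  by rewrite mulr_ge0// ppow_ge0.
rewrite inE/= in_itv/= => /andP[x0 x1].
have ge1 b y : 0 < y < 1 -> b <= 0 -> 1 <= ppow b y.
  move=> /andP[y0 y1] b0; rewrite ppowE// -(powRr0 y).
  by apply: ger_powR => //; rewrite y0 ltW.
by rewrite -[leLHS]mulr1; apply: ler_pM => //; apply: ge1; lra.
Qed.

(** Substituting [x = s + (t - s) y] produces the factors [(t - s)^(a - 1)], [(t - s)^(-a)] and
    [t - s], which cancel: the value does not depend on the length of the interval. This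
    cancellation is why Abel's equation can be inverted. *)
Lemma beta_integral a s t : 0 < a < 1 ->
  (\int[lam]_x (ppow (a - 1) (t - x) * ppow (- a) (x - s))%:E)%E =
  (beta_const a * (s < t)%R%:R)%:E.
Proof.
move=> a01; have [st|ts] := ltP s t; last first.
  rewrite mulr0 integral0_eq// => x _; have [xs|sx] := leP x s.
    by rewrite (@ppow0 (- a)) ?subr_le0// mulr0.
  by rewrite ppow0 ?mul0r// subr_le0 (le_trans ts)// ltW.
have D0 : 0 < t - s by rewrite subr_gt0.
rewrite mulr1 -(beta_constE a01).
pose f (x : R) : \bar R := (ppow (a - 1) (1 - x) * ppow (- a) x)%:E.
have mf : measurable_fun [set: R] f by apply/measurable_EFinP; exact: mbeta_kernel.
have D1 : (t - s)^-1 != 0 by rewrite invr_neq0// gt_eqF.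
have f0 x : (0 <= f x)%E by rewrite lee_fin mulr_ge0// ppow_ge0.
have h := ge0_integral_affine (- s / (t - s)) D1 mf f0.
have e : `|(t - s)^-1|^-1 = t - s by rewrite gtr0_norm ?invr_gt0// invrK.
rewrite e in h.
have -> : (\int[lam]_x (ppow (a - 1) (1 - x) * ppow (- a) x)%:E = \int[lam]_x f x)%E by [].
have -> : (\int[lam]_x f x = (t - s)^-1%:E * ((t - s)%:E * \int[lam]_x f x))%E.
  by rewrite muleA -EFinM mulVf ?mul1e// gt_eqF.
rewrite -h -ge0_integralZl//; last 2 first.
- by apply: (measurableT_comp mf); apply: measurable_funD => //; exact: measurable_funM.
- by rewrite lee_fin invr_ge0 ltW.
apply: eq_integral => x _; rewrite /f -EFinM; congr EFin.
have -> : 1 - ((t - s)^-1 * x + - s / (t - s)) = (t - x) / (t - s).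
  by field; rewrite gt_eqF.
have -> : (t - s)^-1 * x + - s / (t - s) = (x - s) / (t - s).
  by field; rewrite gt_eqF.
have ppowM b y : ppow b (y / (t - s)) = ppow b y / (t - s) `^ b.
  rewrite /ppow pmulr_lgt0 ?invr_gt0//; case: ifP => [y0|]; last by rewrite mul0r.
  by rewrite powRM ?(ltW y0) ?invr_ge0 ?(ltW D0)// -powR_inv1 ?(ltW D0)// powRAC powR_inv1 ?powR_ge0.
have pB : (t - s) `^ (a - 1) = (t - s) `^ a / (t - s).
  by rewrite powRB ?powRr1 ?(ltW D0)// (gt_eqF D0) implybT.
rewrite !ppowM pB powRN.
have D2 : (t - s) `^ a != 0 by rewrite gt_eqF// powR_gt0.
by field; rewrite D2 gt_eqF.
Qed.

End line_integrals.

(** * Abel kernels on the line *)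

Section difference_quotient.
Context {R : realType}.
Local Notation lam := (@lebesgue_measure R).
Implicit Types (a q e x y : R).

(** For [q >= 1] a fraction [l] in []0, 1]] satisfies [l^q <= l]; apply this to [x / (x + y)] and
    [y / (x + y)], which sum to 1. *)
Lemma powR_superadd q x y : 1 <= q -> 0 <= x -> 0 <= y ->
  x `^ q + y `^ q <= (x + y) `^ q.
Proof.
move=> q1; rewrite le_eqVlt => /predU1P[<- y0|x0].
  by rewrite powR0 ?add0r//; lra.
rewrite le_eqVlt => /predU1P[<-|y0].
  by rewrite powR0 ?addr0//; lra.
have xy0 : 0 < x + y by exact: addr_gt0.
have h z : 0 < z <= x + y -> z `^ q <= z / (x + y) * (x + y) `^ q.
  move=> /andP[z0 zxy].
  have {1}-> : z = z / (x + y) * (x + y) by field; rewrite gt_eqF.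
  apply: ge1r_powRZ => //; last exact: ltW.
  by rewrite divr_gt0//= ler_pdivrMr// mul1r.
have -> : (x + y) `^ q = x / (x + y) * (x + y) `^ q + y / (x + y) * (x + y) `^ q.
  by rewrite -!mulrDl divff ?mul1r// gt_eqF.
by apply: lerD; apply: h; lra.
Qed.

Lemma powR_addr_le q x y : 0 <= q -> 0 <= x -> 0 <= y ->
  (x + y) `^ q <= 2 `^ q * (x `^ q + y `^ q).
Proof.
move=> q0 x0 y0; wlog xy : x y x0 y0 / x <= y.
  by move=> h; have [xy|/ltW yx] := leP x y; [exact: h|rewrite addrC [X in _ * X]addrC; exact: h].
apply: (@le_trans _ _ ((2 * y) `^ q)).
  by apply: ge0_ler_powR => //; rewrite ?nnegrE; lra.
by rewrite powRM// ler_wpM2l ?powR_ge0// lerDr powR_ge0.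
Qed.

(** Stands in for the derivative [a x^(a - 1)] of the truncated power: with estimates uniform in
    [e], the identity for the primitive of an average can be differentiated at the very end, outside
    the integral. *)
Definition diffq a e x := (ppow a (x + e) - ppow a x) / e.

Lemma ppow_ndecr a x y : 0 <= a -> x <= y -> ppow a x <= ppow a y.
Proof.
move=> a0 xy; have [x0|x0] := ltP 0 x; last by rewrite ppow0// ppow_ge0.
have y0 := lt_le_trans x0 xy.
by rewrite !ppowE//; apply: ge0_ler_powR => //; rewrite nnegrE ltW.
Qed.

Lemma diffq_ge0 a e x : 0 <= a -> 0 < e -> 0 <= diffq a e x.
Proof. by move=> a0 e0; rewrite divr_ge0 ?(ltW e0)// subr_ge0 ppow_ndecr// lerDl ltW. Qed.

(** For [x > 0] use [(1 + e/x)^a <= 1 + e/x]. For [x <= 0] only the shifted power survives, and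
    [x + e <= e] turns the division by [e] into a loss of one exponent; this is where the second
    summand is needed. *)
Lemma diffq_le a e x : 0 < a < 1 -> 0 < e ->
  diffq a e x <= ppow (a - 1) x + ppow (a - 1) (x + e).
Proof.
move=> /andP[a0 a1] e0; rewrite /diffq ler_pdivrMr//.
have [x0|x0] := ltP 0 x.
  rewrite (le_trans (_ : _ <= ppow (a - 1) x * e))//; last first.
    by rewrite ler_wpM2r ?(ltW e0)// lerDl ppow_ge0.
  have xe0 : 0 < x + e by exact: addr_gt0.
  rewrite !ppowE// lerBlDl.
  have e1 : x + e = x * (1 + e / x) by field; rewrite gt_eqF.
  have e2 : 1 <= 1 + e / x by rewrite lerDl divr_ge0// ltW.
  rewrite e1 powRM ?(ltW x0)//; last by lra.
  rewrite powRB ?(gt_eqF x0) ?implybT// powRr1 ?(ltW x0)//.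
  have h : (1 + e / x) `^ a <= 1 + e / x by apply: ler1_powR => //; exact: ltW.
  have := ler_wpM2l (powR_ge0 x a) h; move=> /le_trans; apply.
  by rewrite mulrDr mulr1 lerD2l le_eqVlt; apply/orP; left; apply/eqP; field; rewrite gt_eqF.
rewrite !(ppow0 _ x0) subr0 add0r.
have [xe0|xe0] := ltP 0 (x + e); last by rewrite !ppow0// mul0r.
rewrite !ppowE// powRB ?(gt_eqF xe0) ?implybT// powRr1 ?(ltW xe0)//.
rewrite -mulrA -[leLHS]mulr1 ler_wpM2l ?powR_ge0//.
by rewrite mulrC ler_pdivlMr// mul1r; lra.
Qed.

(** Concavity of the power. It fails across the origin, where the quotient rises from 0, hence the
    restriction to positive arguments. *)
Lemma diffq_nincr a e x y : 0 < a < 1 -> 0 < e -> 0 < x -> x <= y ->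
  diffq a e y <= diffq a e x.
Proof.
move=> /andP[a0 a1] e0 x0 xy; rewrite /diffq ler_wpM2r ?invr_ge0 ?(ltW e0)//.
pose f z := (z + e) `^ a - z `^ a.
have -> : ppow a (y + e) - ppow a y = f y by rewrite !ppowE//; lra.
have -> : ppow a (x + e) - ppow a x = f x by rewrite !ppowE//; lra.
have fd (z : R) : 0 < z -> is_derive z 1 f (a * (z + e) `^ (a - 1) - a * z `^ (a - 1)).
  move=> z0.
  have h : is_derive z 1 (fun z => (1 * z + e) `^ a) (1 * (a * (1 * z + e) `^ (a - 1))).
    by apply: (@is_derive_affine _ (fun z => z `^ a)); apply: is_derive1_powR; lra.
  have := is_deriveB h (is_derive1_powR a z0); rewrite !mul1r => h'.
  by have -> : f = (fun z => (1 * z + e) `^ a) - (@powR R)^~ a by apply/funext => w; rewrite /f !fctE mul1r.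
have [->//|xny] := eqVneq x y.
have xy' : x < y by rewrite lt_neqAle xny.
apply: (@ler0_derive1_nincr _ f x y) => //.
- by move=> z; rewrite in_itv/= => /andP[xz _]; apply: ex_derive; apply: fd; lra.
- move=> z; rewrite in_itv/= => /andP[xz _].
  have z0 : 0 < z by lra.
  have ? := fd z z0; rewrite derive1E derive_val subr_le0 ler_wpM2l ?(ltW a0)//.
  by rewrite -!ppowE//; [apply: ppow_nincr; lra|lra].
- apply: derivable_within_continuous => z; rewrite in_itv/= => /andP[xz _].
  by apply: ex_derive; apply: fd; lra.
Qed.

Lemma measurable_diffq a e : measurable_fun [set: R] (diffq a e).
Proof.
apply: measurable_funM => //.
apply: measurable_funB; apply: measurable_ppow_comp => //.
exact: measurable_funD.
Qed.

Let mcut (f g : R -> R) (L : R) : measurable_fun [set: R] f -> measurable_fun [set: R] g ->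
  measurable_fun [set: R] (fun x => (f x * (g x <= L)%R%:R)%:E).
Proof.
move=> mf mg; apply/measurable_EFinP; apply: measurable_funM => //.
by apply: measurable_bool_natr; exact: measurable_fun_ler.
Qed.

Let integral_reflect (f : R -> R) (s L : R) : measurable_fun [set: R] f -> (forall x, 0 <= f x) ->
  (\int[lam]_x (f (s - x) * (s - x <= L)%R%:R)%:E = \int[lam]_x (f x * (x <= L)%R%:R)%:E)%E.
Proof.
move=> mf f0.
have := @ge0_integral_affine _ (-1) s _ (fun x => (f x * (x <= L)%R%:R)%:E) (mcut L mf (@measurable_id _ _ _)).
rewrite normrN1 invr1 mul1e => <-//.
- by apply: eq_integral => x _; rewrite mulN1r [- x + s]addrC.
- by move=> x; rewrite lee_fin mulr_ge0// ler0n.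
Qed.

(* Telescoping: on [tau < s] the integral of [g] is at most
   [\int_0^s F - \int_(t - s)^t F <= \int_0^(t - s) F]. *)
Lemma integral_telescope (F g : R -> R) (s t K J J' : R) :
  measurable_fun [set: R] F -> measurable_fun [set: R] g ->
  (forall x, 0 <= F x) -> (forall x, 0 <= g x) -> s < t -> 0 <= K ->
  (forall x, 0 < x < s -> g x + F (t - x) <= F (s - x)) ->
  (forall x, s <= x -> g x <= K * (F (t - x) + F (s - x))) ->
  (\int[lam]_x (F x * (x <= t - s)%R%:R)%:E <= J%:E)%E ->
  (\int[lam]_x (F x * (x <= t)%R%:R)%:E <= J'%:E)%E ->
  (\int[lam]_x (g x * (0 < x)%R%:R)%:E <= (J + 2 * K * J)%:E)%E.
Proof.
move=> mF mg F0 g0 st K0 gF gK FJ FJ'.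
pose A x := g x * (0 < x < s)%R%:R.
pose P x := F (t - x) * (0 < x < s)%R%:R.
pose Q x := F (s - x) * (0 < x < s)%R%:R.
have mint : measurable_fun [set: R] (fun x : R => (0 < x < s)%R%:R : R).
  by apply: measurable_bool_natr; apply: measurable_and; exact: measurable_fun_ltr.
have mFc u : measurable_fun [set: R] (fun x : R => F (u - x)).
  by apply: measurableT_comp => //; exact: measurable_funB.
have mA : measurable_fun [set: R] (EFin \o A) by apply/measurable_EFinP; exact: measurable_funM.
have mP : measurable_fun [set: R] (EFin \o P) by apply/measurable_EFinP; exact: measurable_funM.
have mQ : measurable_fun [set: R] (EFin \o Q) by apply/measurable_EFinP; exact: measurable_funM.
have A0 x : (0 <= (A x)%:E)%E by rewrite lee_fin mulr_ge0// ler0n.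
have P0 x : (0 <= (P x)%:E)%E by rewrite lee_fin mulr_ge0// ler0n.
have Q0 x : (0 <= (Q x)%:E)%E by rewrite lee_fin mulr_ge0// ler0n.
have c0 (f : R -> R) b x : (forall x, 0 <= f x) -> (0 <= (f x * (b : bool)%:R)%:E)%E.
  by move=> f0; rewrite lee_fin mulr_ge0// ler0n.
have AP : (\int[lam]_x (A x)%:E + \int[lam]_x (P x)%:E <= \int[lam]_x (Q x)%:E)%E.
  rewrite -ge0_integralD//; apply: ge0_le_integral => //.
  - by move=> x _; rewrite adde_ge0.
  - exact: emeasurable_funD.
  - move=> x _; rewrite -EFinD lee_fin /A /P /Q -mulrDl.
    by have [xs|xs] := boolP (0 < x < s); rewrite ?mulr0// !mulr1 gF.
pose B x := F (t - x) * (t - x <= t - s)%R%:R.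
have mB : measurable_fun [set: R] (EFin \o B).
  by apply: mcut => //; exact: measurable_funB.
have B0 x : (0 <= (B x)%:E)%E by exact: c0.
have BE : (\int[lam]_x (B x)%:E <= J%:E)%E by rewrite integral_reflect.
pose F1 x := F x * (0 < x < s)%R%:R.
pose F2 x := F x * (t - s < x < t)%R%:R.
have mF1 : measurable_fun [set: R] (EFin \o F1) by apply/measurable_EFinP; exact: measurable_funM.
have mF2 : measurable_fun [set: R] (EFin \o F2).
  apply/measurable_EFinP; apply: measurable_funM => //.
  by apply: measurable_bool_natr; apply: measurable_and; exact: measurable_fun_ltr.
have QE : (\int[lam]_x (Q x)%:E = \int[lam]_x (F1 x)%:E)%E.
  have := @ge0_integral_affine _ (-1) s _ _ mF1.
  rewrite normrN1 invr1 mul1e => <-//; last by move=> x; exact: c0.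
  apply: eq_integral => x _; rewrite /Q /F1 mulN1r [- x + s]addrC.
  by congr (_ * _%:R)%:E; congr nat_of_bool; apply/idP/idP => /andP[? ?]; apply/andP; split; lra.
have PE : (\int[lam]_x (P x)%:E = \int[lam]_x (F2 x)%:E)%E.
  have := @ge0_integral_affine _ (-1) t _ _ mF2.
  rewrite normrN1 invr1 mul1e => <-//; last by move=> x; exact: c0.
  apply: eq_integral => x _; rewrite /P /F2 mulN1r [- x + t]addrC.
  by congr (_ * _%:R)%:E; congr nat_of_bool; apply/idP/idP => /andP[? ?]; apply/andP; split; lra.
have QP : (\int[lam]_x (Q x)%:E <= J%:E + \int[lam]_x (P x)%:E)%E.
  rewrite QE PE; apply: (@le_trans _ _ (\int[lam]_x (F x * (x <= t - s)%R%:R)%:E + \int[lam]_x (F2 x)%:E)%E).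
    pose F3 x := F x * (x <= t - s)%R%:R.
    have mF3 : measurable_fun [set: R] (EFin \o F3) by exact: mcut.
    have F30 x : (0 <= (F3 x)%:E)%E by exact: c0.
    have F20 x : (0 <= (F2 x)%:E)%E by exact: c0.
    have -> : (\int[lam]_x (F x * (x <= t - s)%R%:R)%:E + \int[lam]_x (F2 x)%:E =
        \int[lam]_x ((F3 x)%:E + (F2 x)%:E))%E by rewrite ge0_integralD.
    apply: ge0_le_integral => //.
      + by move=> x _; exact: c0.
      + exact: emeasurable_funD.
      + move=> x _; rewrite -EFinD lee_fin /F1 /F2 /F3 -mulrDr ler_wpM2l// -natrD ler_nat.
        have [/andP[x0 xs]/=|//] := boolP (0 < x < s).
        by have [//|xts] := leP x (t - s); rewrite (_ : (x < t))//; lra.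
  by rewrite leeD2r.
(* The bound [J'] is used only for this finiteness, which allows the integral of [P] to be
   cancelled. *)
have Pfin : (\int[lam]_x (P x)%:E)%E \is a fin_num.
  rewrite ge0_fin_numE; last exact: integral_ge0.
  apply: (@le_lt_trans _ _ J'%:E); last exact: ltry.
  rewrite PE; apply: le_trans FJ'; apply: ge0_le_integral => //.
  - by move=> x _; exact: c0.
  - exact: mcut.
  - move=> x _; rewrite lee_fin ler_wpM2l// ler_nat.
    by have [/andP[_ /ltW ->]//|] := boolP (t - s < x < t).
have AJ : (\int[lam]_x (A x)%:E <= J%:E)%E.
  by rewrite -(@leeD2rE _ (\int[lam]_x (P x)%:E)%E)// (le_trans AP).
pose C x := F (s - x) * (s - x <= t - s)%R%:R.
have mC : measurable_fun [set: R] (EFin \o C).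
  by apply: mcut => //; exact: measurable_funB.
have C0 x : (0 <= (C x)%:E)%E by exact: c0.
have CE : (\int[lam]_x (C x)%:E <= J%:E)%E by rewrite integral_reflect.
apply: (@le_trans _ _ (\int[lam]_x ((A x)%:E + K%:E * ((B x)%:E + (C x)%:E)))%E).
  apply: ge0_le_integral => //.
  - by move=> x _; exact: c0.
  - apply/measurable_EFinP; apply: measurable_funM => //.
    by apply: measurable_bool_natr; exact: measurable_fun_ltr.
  - apply: emeasurable_funD => //; apply: emeasurable_funM => //.
    exact: emeasurable_funD.
  - move=> x _; rewrite (_ : (A x)%:E + _ = (A x + K * (B x + C x))%:E)%E// lee_fin.
    have BC0 : 0 <= K * (B x + C x) by rewrite mulr_ge0// addr_ge0// -lee_fin.
    have [x0|x0] := ltP 0 x; last by rewrite mulr0 addr_ge0// -lee_fin.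
    rewrite mulr1; have [xs|sx] := ltP x s.
      by rewrite {1}/A x0 xs/= mulr1 lerDl.
    (* Past [s] both [t - x] and [s - x] are at most [t - s], so the cutoffs in [B] and [C] equal
       1. *)
    rewrite /A x0 (ltNge x s) sx mulr0 add0r /B /C lerD2l lerN2 sx mulr1.
    by rewrite (_ : (s - x <= t - s))%R ?mulr1 ?gK//; lra.
rewrite ge0_integralD//; last 2 first.
- by move=> x _; rewrite mule_ge0// adde_ge0.
- by apply: emeasurable_funM => //; exact: emeasurable_funD.
rewrite EFinD leeD// ge0_integralZl//; last 2 first.
- exact: emeasurable_funD.
- by move=> x _; rewrite adde_ge0.
rewrite ge0_integralD// (_ : (2 * K * J)%:E = K%:E * (J%:E + J%:E))%E; last first.
  by rewrite -EFinD -EFinM; congr EFin; ring.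
by rewrite lee_wpmul2l// leeD.
Qed.

Lemma diffq_kernel_bound a q : 0 < a < 1 -> 1 < q -> -1 < (a - 1) * q ->
  exists2 C : R, 0 < C & forall s t e : R, s < t -> 0 < e -> e <= t - s ->
  (\int[lam]_x (`|diffq a e (t - x) - diffq a e (s - x)| `^ q * (0 < x)%R%:R)%:E
    <= (C * (t - s) `^ ((a - 1) * q + 1))%:E)%E.
Proof.
move=> a01 q1 b1; have /andP[a0 a1] := a01.
set b := (a - 1) * q.
have b10 : 0 < b + 1 by rewrite /b; lra.
have q0 : 0 < q by lra.
(* The integral of [diffq^q] up to [L], bounded through [diffq_le] by two power integrals; the shift
   by [e] accounts for [L + e]. *)
pose c L e := 2 `^ q * ((L `^ (b + 1) + (L + e) `^ (b + 1)) / (b + 1)).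
have mDX e : measurable_fun [set: R] (fun x : R => diffq a e x `^ q).
  by apply: (measurableT_comp (measurable_powR q)); exact: measurable_diffq.
have pc0 x y (k : bool) : (0 <= (ppow x y * k%:R)%:E)%E.
  by rewrite lee_fin mulr_ge0// ?ppow_ge0// ler0n.
have diffqX L e : 0 < L -> 0 < e ->
    (\int[lam]_x (diffq a e x `^ q * (x <= L)%R%:R)%:E <= (c L e)%:E)%E.
  move=> L0 e0.
  pose f (x : R) := (ppow b x * (x <= L)%R%:R)%:E.
  pose g (x : R) := (ppow b x * (x <= L + e)%R%:R)%:E.
  have mf : measurable_fun [set: R] f by apply: mcut => //; exact: measurable_ppow.
  have mg : measurable_fun [set: R] g by apply: mcut => //; exact: measurable_ppow.
  have mg' : measurable_fun [set: R] (fun x : R => g (x + e)).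
    by apply: (measurableT_comp mg); exact: measurable_funD.
  have f0 x : (0 <= f x)%E by exact: pc0.
  have g0 x : (0 <= g x)%E by exact: pc0.
  have gE : (\int[lam]_x g (x + e)%R = ((L + e) `^ (b + 1) / (b + 1))%:E)%E.
    rewrite -integral_ppow//; last by lra.
    have := ge0_integral_affine e (oner_neq0 R) mg g0.
    rewrite normr1 invr1 mul1e => <-.
    by apply: eq_integral => x _; rewrite mul1r.
  apply: (@le_trans _ _ (\int[lam]_x ((2 `^ q)%:E * (f x + g (x + e)%R)))%E).
    apply: ge0_le_integral => //.
    - by move=> x _; rewrite lee_fin mulr_ge0// ?powR_ge0// ler0n.
    - exact: mcut.
    - by apply: emeasurable_funM => //; exact: emeasurable_funD.
    - move=> x _; rewrite /f /g -EFinD -EFinM lee_fin lerD2r -mulrDl mulrA ler_wpM2r// ?ler0n//.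
      rewrite /b -!ppowX ?gt_eqF//.
      apply: le_trans (powR_addr_le _ _ _); rewrite ?ppow_ge0 ?(ltW q0)//.
      apply: ge0_ler_powR; rewrite ?nnegrE ?(ltW q0) ?addr_ge0 ?ppow_ge0 ?diffq_ge0 ?(ltW a0)//.
      exact: diffq_le.
  rewrite ge0_integralZl//; last 2 first.
  - exact: emeasurable_funD.
  - by move=> x _; rewrite adde_ge0.
  by rewrite ge0_integralD// gE integral_ppow// -EFinD -EFinM /c mulrDl.
have cle L e : 0 < L -> 0 < e -> e <= L -> c L e <= 2 `^ q * (2 * (2 * L) `^ (b + 1) / (b + 1)).
  move=> L0 e0 eL; rewrite ler_wpM2l ?powR_ge0// ler_wpM2r ?invr_ge0 ?(ltW b10)//.
  rewrite mulrDl mul1r lerD// ge0_ler_powR// ?nnegrE ?(ltW b10)//; lra.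
pose K := 2 `^ q.
exists ((1 + 2 * K) * (2 `^ q * (2 * 2 `^ (b + 1) / (b + 1)))).
  by rewrite !mulr_gt0 ?addr_gt0 ?mulr_gt0 ?invr_gt0 ?powR_gt0//.
move=> s t e st e0 ets; set r := t - s.
have r0 : 0 < r by rewrite subr_gt0.
have K0 : 0 <= K by exact: powR_ge0.
apply: (@le_trans _ _ (c r e + 2 * K * c r e)%:E).
  have dq0 x : 0 <= diffq a e x by apply: diffq_ge0 => //; exact: ltW.
  (* Here [t] may be nonpositive, while the power integral wants a positive endpoint. *)
  pose L := Num.max t 1.
  apply: (@integral_telescope (fun x => diffq a e x `^ q) _ s t K _ (c L e)) => //.
  - apply: (measurableT_comp (measurable_powR q)); apply: measurableT_comp => //.
    by apply: measurable_funB; apply: (measurableT_comp (measurable_diffq _ _)); exact: measurable_funB.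
  - by move=> x; exact: powR_ge0.
  - move=> x /andP[x0 xs]; rewrite distrC ger0_norm; last first.
      by rewrite subr_ge0; apply: diffq_nincr => //; lra.
    rewrite -[in leRHS](subrK (diffq a e (t - x)) (diffq a e (s - x))).
    apply: powR_superadd => //; first exact: ltW.
    by rewrite subr_ge0; apply: diffq_nincr => //; lra.
  - move=> x sx; apply: le_trans (powR_addr_le _ _ _); rewrite ?(ltW q0)//.
    apply: ge0_ler_powR; rewrite ?nnegrE ?(ltW q0) ?addr_ge0//.
    by rewrite (le_trans (ler_normB _ _))// !ger0_norm.
  - exact: diffqX.
  - apply: le_trans (diffqX L e _ e0); last by rewrite /L lt_max ltr01 orbT.
    apply: ge0_le_integral => //.
    + by move=> x _; rewrite lee_fin mulr_ge0// ?powR_ge0// ler0n.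
    + exact: mcut.
    + exact: mcut.
    + move=> x _; rewrite lee_fin ler_wpM2l ?powR_ge0// ler_nat.
      by have [xt|//] := leP x t; rewrite /L le_max xt.
have h := cle r e r0 e0 ets.
rewrite lee_fin (_ : _ + _ = (1 + 2 * K) * c r e); last by ring.
rewrite -mulrA ler_wpM2l ?addr_ge0 ?mulr_ge0//.
apply: (le_trans h); rewrite powRM ?(ltW r0)//.
by rewrite le_eqVlt; apply/orP; left; apply/eqP; field; rewrite gt_eqF.
Qed.

End difference_quotient.

(** * Product test functions *)

Section Ck_closure.
Context {R : realType} {V : normedModType R}.
Implicit Types f g : V -> R.

Lemma CkW k f : Ck k.+1 setT f -> Ck k setT f.
Proof.
elim: k f => [|k IH] f; first by case.
move=> [cf h]; split => // v; have [df dkf] := h v.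
by split => //; exact: IH.
Qed.

Lemma Ck_cst k (c : R) : Ck k setT (fun _ : V => c).
Proof.
elim: k c => [|k IH] c; split => //; try by move=> x _; exact: cst_continuous.
move=> v; split; first by move=> x _; exact: derivable_cst.
by rewrite (_ : 'D_v _ = fun=> 0); [exact: IH|apply/funext => x; exact: derive_cst].
Qed.

Lemma CkD k f g : Ck k setT f -> Ck k setT g -> Ck k setT (fun x => f x + g x).
Proof.
elim: k f g => [|k IH] f g [cf hf] [cg hg]; split => //.
- by move=> x _; apply: continuousD; [exact: cf|exact: cg].
- by move=> x _; apply: continuousD; [exact: cf|exact: cg].
move=> v; have [df dkf] := hf v; have [dg dkg] := hg v.
split; first by move=> x _; apply: derivableD; [exact: df|exact: dg].
rewrite (_ : 'D_v _ = fun x => 'D_v f x + 'D_v g x); first exact: IH.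
by apply/funext => x; apply: deriveD; [exact: df|exact: dg].
Qed.

Lemma CkM k f g : Ck k setT f -> Ck k setT g -> Ck k setT (fun x => f x * g x).
Proof.
elim: k f g => [|k IH] f g fk gk; have [cf hf] := fk; have [cg hg] := gk; split => //.
- by move=> x _; apply: continuousM; [exact: cf|exact: cg].
- by move=> x _; apply: continuousM; [exact: cf|exact: cg].
move=> v; have [df dkf] := hf v; have [dg dkg] := hg v.
split; first by move=> x _; apply: derivableM; [exact: df|exact: dg].
rewrite (_ : 'D_v _ = fun x => f x * 'D_v g x + g x * 'D_v f x).
  by apply: CkD; apply: IH => //; exact: CkW.
by apply/funext => x; apply: deriveM; [exact: df|exact: dg].
Qed.

Lemma Ck_prod k (I : Type) (r : seq I) (F : I -> V -> R) :
  (forall i, Ck k setT (F i)) -> Ck k setT (fun x => \prod_(i <- r) F i x).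
Proof.
move=> Fk; elim: r => [|i r IH].
  by under eq_fun do rewrite big_nil; exact: Ck_cst.
by under eq_fun do rewrite big_cons; exact: CkM.
Qed.

(* Along the line [h |-> z + h v] the function [phi] only sees [f]. *)
Lemma is_derive_line (phi : V -> R) (v z : V) (f : R -> R) (c s a : R) :
  (forall h : R, phi (h *: v + z) = c * f (a * h + s)) -> derivable f s 1 ->
  is_derive z v phi (c * (a * derive1 f s)).
Proof.
move=> phiE fs.
have fd : is_derive (a * 0 + s) 1 f (derive1 f s).
  by rewrite mulr0 add0r derive1E; apply: DeriveDef.
have := is_derive_affine fd; have h := @is_deriveZ _ _ _ (fun x => f (a * x + s)) c 0 1 _ _.
move=> /h{h}; rewrite /GRing.scale/= => -[dd vv].
have E : (fun h : R => h^-1 *: ((phi \o shift z) (h *: v) - phi z)) =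
    (fun h : R => h^-1 *: (((c \*: (fun x => f (a * x + s))) \o shift 0) (h *: 1) -
      (c \*: (fun x => f (a * x + s))) 0)).
  apply/funext => h /=; congr (_ *: (_ - _)).
    by rewrite phiE addr0 /GRing.scale/= mulr1.
  by have := phiE 0; rewrite scale0r add0r.
apply: DeriveDef; first by rewrite /derivable E.
by rewrite /derive E -vv.
Qed.

(** Deriving [f \o l] in direction [v] gives the constant [l v] times a function of the same form,
    so the induction on [k] closes. It will be applied to the coordinates of time and space. *)
Lemma Ck_smooth1_comp k (l : V -> R) (f : R -> R) : continuous l ->
  (forall (h : R) v x, l (h *: v + x) = h * l v + l x) ->
  smooth1 f -> Ck k setT (f \o l).
Proof.
move=> cl linl; elim: k f => [|k IH] f fs.
  by split => // x _; apply: continuous_comp; [exact: cl|exact: smooth1_continuous].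
split; first by move=> x _; apply: continuous_comp; [exact: cl|exact: smooth1_continuous].
move=> v.
have dfl (x : V) : is_derive x v (f \o l) (1 * (l v * derive1 f (l x))).
  apply: is_derive_line; last exact: smooth1_derivable.
  by move=> h /=; rewrite mul1r linl mulrC.
split; first by move=> x _; have [] := dfl x.
rewrite (_ : 'D_v _ = fun x => l v * (derive1 f \o l) x).
  by apply: CkM; [exact: Ck_cst|apply: IH; exact: smooth1_derive1].
by apply/funext => x; have [_ ->] := dfl x; rewrite mul1r.
Qed.

End Ck_closure.

Section tensor.
Context {R : realType} {d : nat}.
Local Notation point := (R * 'rV[R]_d)%type.
Implicit Types (beta : 'I_d -> R -> R) (chi : R -> R).

Definition tensor beta (x : 'rV[R]_d) : R := \prod_(i < d) beta i (x ord0 i).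

Definition upd (S : Type) (beta : 'I_d -> S) i (b : S) : 'I_d -> S :=
  fun j => if j == i then b else beta j.

Lemma upd_same (S : Type) (beta : 'I_d -> S) i b : upd beta i b i = b.
Proof. by rewrite /upd eqxx. Qed.

Definition tprod chi beta (z : point) : R := chi z.1 * tensor beta z.2.

Lemma tensor_upd beta i b x :
  tensor (upd beta i b) x = (\prod_(j < d | j != i) beta j (x ord0 j)) * b (x ord0 i).
Proof.
rewrite /tensor (bigD1 i)//= upd_same mulrC; congr (_ * _).
by apply: eq_bigr => j /negbTE ji; rewrite /upd ji.
Qed.

Lemma tensorD1 beta i x :
  tensor beta x = (\prod_(j < d | j != i) beta j (x ord0 j)) * beta i (x ord0 i).
Proof. by rewrite /tensor (bigD1 i)//= mulrC. Qed.

Lemma dt_tprod chi beta z : smooth1 chi ->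
  dt (tprod chi beta) z = tprod (derive1 chi) beta z.
Proof.
move=> chis; have h : is_derive z (1, 0) (tprod chi beta) (tensor beta z.2 * (1 * derive1 chi z.1)).
  apply: is_derive_line; last exact: smooth1_derivable.
  by case: z => t x h; rewrite /tprod /= scaler0 add0r mulrC mul1r /GRing.scale/= mulr1.
by rewrite /dt derive_val mul1r mulrC.
Qed.

Lemma dx_tprod chi beta i z : smooth1 (beta i) ->
  dx i (tprod chi beta) z = tprod chi (upd beta i (derive1 (beta i))) z.
Proof.
move=> bs; pose c := chi z.1 * \prod_(j < d | j != i) beta j (z.2 ord0 j).
have h : is_derive z (0, delta_mx ord0 i) (tprod chi beta) (c * (1 * derive1 (beta i) (z.2 ord0 i))).
  apply: is_derive_line; last exact: smooth1_derivable.
  case: z @c => t x c h; rewrite /tprod /= scaler0 add0r (tensorD1 _ i) mulrA.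
  congr (_ * _); last by rewrite !mxE !eqxx mulr1 mul1r.
  rewrite /c/=; congr (_ * _); apply: eq_bigr => j ji.
  by rewrite !mxE eqxx (negbTE ji) mulr0 add0r.
by rewrite /dx derive_val mul1r /tprod tensor_upd mulrA.
Qed.

Lemma measurable_tensor beta : (forall i, measurable_fun [set: R] (beta i)) ->
  measurable_fun [set: 'rV[R]_d] (tensor beta).
Proof.
move=> mb; apply: measurable_prod => i _.
exact: (measurableT_comp (mb i) (measurable_rV_coord i)).
Qed.

Definition box (l u : 'I_d -> R) : set 'rV[R]_d := [set x | forall i, l i <= x ord0 i <= u i].

Lemma tensor_box beta l u : (forall i x, ~~ (l i <= x <= u i) -> beta i x = 0) ->
  forall x, ~ box l u x -> tensor beta x = 0.
Proof.
move=> b0 x /existsNP[i /negP xi].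
by rewrite (tensorD1 _ i) b0 ?mulr0.
Qed.

Lemma tensor_le beta l u (L : 'I_d -> R) :
  (forall i x, ~~ (l i <= x <= u i) -> beta i x = 0) ->
  (forall i x, `|beta i x| <= L i) ->
  forall x, `|tensor beta x| <= \prod_i L i.
Proof.
by move=> b0 bL x; rewrite normr_prod; apply: ler_prod => i _; rewrite normr_ge0/=.
Qed.

Lemma test_fun_tprod chi beta (T a b : R) (l u : 'I_d -> R) :
  smooth1 chi -> (forall i, smooth1 (beta i)) -> 0 < a -> b < T ->
  (forall t, ~~ (a <= t <= b) -> chi t = 0) ->
  (forall i x, ~~ (l i <= x <= u i) -> beta i x = 0) ->
  test_fun (cylinder T setT) (tprod chi beta).
Proof.
move=> chis bs a0 bT chi0 beta0; split.
  exists setT, (tprod chi beta); split => //; first exact: openT.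
  move=> k; apply: CkM.
    apply: (@Ck_smooth1_comp _ _ k (fun z : point => z.1)) => //.
    by move=> z; exact: cvg_fst.
  apply: Ck_prod => i.
  apply: (@Ck_smooth1_comp _ _ k (fun z : point => z.2 ord0 i)) => //.
    move=> z; apply: (@continuous_comp _ _ _ (fun z : point => z.2) (fun x : 'rV[R]_d => x ord0 i)).
      exact: cvg_snd.
    exact: coord_continuous.
  by move=> h v x; rewrite !mxE.
exists (`[a, b]%classic `*` box l u); split.
- apply: compact_setX; first exact: segment_compact.
  apply: (@rV_compact _ _ (fun i => `[l i, u i]%classic)) => i.
  exact: segment_compact.
- move=> [t x] /= [+ _]; rewrite /cylinder/= !in_itv/= => /andP[at_ tb]; split => //.
  by rewrite (lt_le_trans a0)//= (le_lt_trans tb).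
- move=> [t x] /= /not_andP[tab|xb].
    by rewrite /tprod/= chi0 ?mul0r//; apply/negP => tab'; apply: tab; rewrite in_itv.
  by rewrite /tprod/= (tensor_box beta0)// mulr0.
Qed.

End tensor.

(** * The product measure on the cylinder and Hoelder's inequality for product weights *)

Section cylinder_integrals.
Context {R : realType} {d : nat}.
Local Notation lam := (@lebesgue_measure R).
Local Notation mu := (lebesgue_rV R d).
Local Notation m := (lebesgue_tx R d).
Local Notation point := (R * 'rV[R]_d)%type.
Local Notation cyl T := (cylinder T (@setT 'rV[R]_d)).

Lemma measurable_cylinder (T : R) :
  measurable (cyl T : set (measurableTypeR R * 'rV[R]_d)).
Proof. by apply: measurableX => //; exact: measurable_itv. Qed.

Lemma int_cylE (T : R) (f : point -> R) :
  int_cyl T setT f = \int[m]_z (f \_ (cyl T)) z.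
Proof. by rewrite /int_cyl Rintegral_mkcond. Qed.

Lemma Lp_cyl_measurable (p T : R) (f : point -> R) : Lp_cyl p T setT f ->
  measurable_fun [set: measurableTypeR R * 'rV[R]_d] (f \_ (cyl T)).
Proof. by move=> /sub_Lfun_mfun; rewrite inE. Qed.

Lemma integral_box (l u : 'I_d -> R) : (forall i, l i <= u i) ->
  mu (box l u) = (\prod_(i < d) (u i - l i))%:E.
Proof.
move=> lu; rewrite -prodEFin.
have -> : box l u = [set v | forall i, `[l i, u i]%classic (v ord0 i)].
  by apply/seteqP; split=> v /= h i; have := h i; rewrite /= in_itv.
transitivity (\prod_(i < d) lam `[l i, u i]%classic)%E.
  by apply: (@lebesgue_rV_box R d (fun i => `[l i, u i]%classic)) => i; exact: measurable_itv.
apply: eq_bigr => i _; rewrite lebesgue_measure_itv/= lte_fin.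
case: ltP => [//|ul]; congr EFin; apply/eqP; rewrite eq_sym subr_eq0 eq_le ul; exact: lu.
Qed.

Lemma measurable_box (l u : 'I_d -> R) : measurable (box l u).
Proof.
have -> : box l u = \bigcap_(i in [set: 'I_d]) (fun v : 'rV[R]_d => v ord0 i) @^-1` `[l i, u i].
  by apply/seteqP; split=> v /= h i; have := h i; rewrite /= in_itv//=; exact.
apply: fin_bigcap_measurable => // i _.
by rewrite -[X in measurable X]setTI; apply: measurable_rV_coord => //; exact: measurable_itv.
Qed.

Lemma integral_tensor_le (beta : 'I_d -> R -> R) (l : 'I_d -> R) (w q B : R) (L : 'I_d -> R) :
  0 <= q -> 0 <= w -> 0 <= B -> (forall i, measurable_fun [set: R] (beta i)) ->
  (forall i x, ~~ (l i <= x <= l i + w) -> beta i x = 0) ->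
  (forall i x, `|beta i x| <= L i) -> \prod_(i < d) L i <= B ->
  (q != 0) ->
  (\int[mu]_x (`|tensor beta x| `^ q)%:E <= (B `^ q * w ^+ d)%:E)%E.
Proof.
move=> q0 w0 B0 mb b0 bL LB qn0.
have tB x : `|tensor beta x| <= B by apply: le_trans LB; exact: tensor_le b0 bL x.
apply: (@le_trans _ _ (\int[mu]_x ((B `^ q)%:E * (\1_(box l (fun i => l i + w)) x)%:E))%E).
  apply: ge0_le_integral => //.
  - apply/measurable_EFinP; apply: (measurableT_comp (measurable_powR q)).
    by apply: measurableT_comp => //; exact: measurable_tensor.
  - apply: emeasurable_funM => //; apply/measurable_EFinP.
    by apply: measurable_indic; exact: measurable_box.
  - move=> x _; rewrite -EFinM lee_fin indicE.
    have [xb|/negP xb] := boolP (x \in box l (fun i => l i + w)).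
      by rewrite mulr1; apply: ge0_ler_powR; rewrite ?nnegrE.
    rewrite (tensor_box b0) ?normr0 ?powR0 ?mulr0// => ?; apply: xb; exact: mem_set.
rewrite ge0_integralZl//; last 2 first.
- by apply/measurable_EFinP; apply: measurable_indic; exact: measurable_box.
- by rewrite lee_fin powR_ge0.
rewrite integral_indic//= ?setIT; last exact: measurable_box.
rewrite integral_box; last by move=> i; rewrite lerDl.
rewrite -EFinM lee_fin; under eq_bigr do rewrite addrC addKr.
by rewrite prodr_const card_ord.
Qed.

(** By Tonelli the [L_q] norm of [k(t) psi(x)] is the product of the two norms. The cylinder sees
    positive times only, so the hypothesis on [k] carries the factor [0 < t], in the form in which
    the kernel estimate delivers it. *)
Lemma hoelder_cyl (p q T M K L : R) (f : point -> R) (k : R -> R) (psi : 'rV[R]_d -> R) :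
  0 < p -> 0 < q -> p^-1 + q^-1 = 1 -> 0 <= M -> 0 <= K -> 0 <= L ->
  Lp_cyl p T setT f -> (Lp_norm p T setT f <= M%:E)%E ->
  measurable_fun [set: R] k -> measurable_fun setT psi ->
  (\int[lam]_t (`|k t| `^ q * (0 < t)%R%:R)%:E <= (K `^ q)%:E)%E ->
  (\int[mu]_x (`|psi x| `^ q)%:E <= (L `^ q)%:E)%E ->
  m.-integrable (cyl T) (EFin \o (fun z => f z * (k z.1 * psi z.2))) /\
  `|int_cyl T setT (fun z => f z * (k z.1 * psi z.2))| <= M * K * L.
Proof.
move=> p0 q0 pq M0 K0 L0 fp fM mk mpsi kK psiL.
set F := fun z => _.
pose fc : measurableTypeR R * 'rV[R]_d -> R := f \_ (cyl T).
have mfc : measurable_fun setT fc by exact: Lp_cyl_measurable fp.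
pose h (z : measurableTypeR R * 'rV[R]_d) := (k z.1 * (0 < z.1)%R%:R) * psi z.2.
have mk' : measurable_fun [set: measurableTypeR R] (fun t => k t * (0 < t)%R%:R).
  apply: measurable_funM => //.
  by apply: measurable_bool_natr; exact: measurable_fun_ltr.
have mh : measurable_fun setT h.
  apply: measurable_funM; first exact: (measurableT_comp mk' measurable_fst).
  exact: (measurableT_comp mpsi measurable_snd).
have Fh : F \_ (cyl T) = fc \* h.
  apply/funext => z; rewrite /fc /h /= !patchE; case: ifPn => zc; last by rewrite mul0r.
  by move: zc; rewrite inE /cylinder/= in_itv/= => -[/andP[-> _] _]; rewrite mulr1.
have qn0 : q != 0 by rewrite gt_eqF.
have hN : ('N[m]_q%:E[EFin \o h] <= (K * L)%:E)%E.
  have -> : ('N[m]_q%:E[EFin \o h] = (\int[m]_z (`|h z| `^ q)%:E) `^ q^-1)%E.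
    by rewrite unlock.
  have -> : (K * L)%:E = (((K * L) `^ q)%:E `^ q^-1)%E.
    by rewrite poweR_EFin -powRrM divff// powRr1// mulr_ge0.
  apply: gt0_ler_poweR; rewrite ?invr_ge0 ?(ltW q0) ?in_itv/= ?leey ?andbT//.
  - by apply: integral_ge0 => z _; rewrite lee_fin powR_ge0.
  - by rewrite lee_fin powR_ge0.
  pose G (t : measurableTypeR R) := (`|k t| `^ q * (0 < t)%R%:R)%:E.
  pose H (x : 'rV[R]_d) := (`|psi x| `^ q)%:E.
  have hE z : (`|h z| `^ q)%:E = (G z.1 * H z.2)%E.
    rewrite /G /H -EFinM /h !normrM powRM// powRM//.
    by case: (0 < z.1)%R; rewrite ?normr1 ?normr0 ?powR1 ?powR0.
  under eq_integral do rewrite hE.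
  have G0 t : (0 <= G t)%E by rewrite lee_fin mulr_ge0// ?powR_ge0// ler0n.
  have H0 t : (0 <= H t)%E by rewrite lee_fin powR_ge0.
  have mG : measurable_fun setT G.
    apply/measurable_EFinP; apply: measurable_funM.
      by apply: (measurableT_comp (measurable_powR q)); exact: measurableT_comp.
    by apply: measurable_bool_natr; exact: measurable_fun_ltr.
  have mH : measurable_fun setT H.
    by apply/measurable_EFinP; apply: (measurableT_comp (measurable_powR q)); exact: measurableT_comp.
  have mGH : measurable_fun setT (fun z : measurableTypeR R * 'rV[R]_d => G z.1 * H z.2)%E.
    by apply: emeasurable_funM; [exact: (measurableT_comp mG)|exact: (measurableT_comp mH)].
  rewrite fubini_tonelli1//; last by move=> z; rewrite mule_ge0.
  rewrite /fubini_F/=; under eq_integral do rewrite ge0_integralZl//.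
  rewrite ge0_integralZr//; last exact: integral_ge0.
  rewrite powRM// EFinM; apply: lee_pmul => //; exact: integral_ge0.
have fN : ('N[m]_p%:E[EFin \o fc] <= M%:E)%E by [].
have FN : ('N[m]_1[EFin \o (fc \* h)%R] <= (M * K * L)%:E)%E.
  apply: (le_trans (hoelder _ mfc mh p0 q0 pq)).
  by rewrite -mulrA EFinM; apply: lee_pmul => //; exact: Lnorm_ge0.
rewrite Lnorm1 in FN.
have mF : measurable_fun setT (fc \* h) by exact: measurable_funM.
have iF : m.-integrable setT (EFin \o (fc \* h)).
  apply/integrableP; split; first exact/measurable_EFinP.
  by apply: (le_lt_trans FN); exact: ltry.
split.
  by rewrite (integrable_mkcond _ (measurable_cylinder T)) restrict_EFin Fh.
rewrite int_cylE Fh -lee_fin; apply: le_trans FN.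
rewrite EFin_normr_Rintegral// /=; apply: le_abse_integral => //.
exact/measurable_EFinP.
Qed.

End cylinder_integrals.

(** * Inversion of the Abel integral *)

Section parameter_integral.
Context d1 d2 (T1 : measurableType d1) (T2 : measurableType d2) (R : realType).
Variable m2 : {sigma_finite_measure set T2 -> \bar R}.

(** Tonelli handles the positive and the negative part; subtraction and [fine] preserve
    measurability, whatever the size of the sections. *)
Lemma measurable_fun_integral_section (f : T1 * T2 -> R) : measurable_fun setT f ->
  measurable_fun setT (fun x => \int[m2]_y f (x, y))%R.
Proof.
move=> mf; rewrite /Rintegral.
apply: (measurableT_comp (f := fine)) => //.
have mf' : measurable_fun setT (EFin \o f) by exact/measurable_EFinP.
have -> : (fun x => \int[m2]_y (f (x, y))%:E)%E = (fun x =>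
    \int[m2]_y (EFin \o f)^\+ (x, y) - \int[m2]_y (EFin \o f)^\- (x, y))%E.
  apply/funext => x; rewrite [LHS]integralE.
  by congr (_ - _)%E; apply: eq_integral => y _; rewrite !unlock.
apply: emeasurable_funB.
  by apply: measurable_fun_fubini_tonelli_F => //; exact: measurable_funepos.
by apply: measurable_fun_fubini_tonelli_F => //; exact: measurable_funeneg.
Qed.

End parameter_integral.

Section abel.
Context {R : realType}.
Local Notation lam := (@lebesgue_measure R).
Variables (a K : R) (y : R -> R).
Hypotheses (a01 : 0 < a < 1) (my : measurable_fun [set: R] y).
Hypotheses (y0 : forall s, s <= 0 -> y s = 0) (yK : forall s, `|y s| <= K).

Definition abel (tau : R) : R := \int[lam]_s (ppow (- a) (tau - s) * y s).

Let K0 : 0 <= K. Proof. exact: le_trans (normr_ge0 _) (yK 0). Qed.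
Let a0 : 0 < a. Proof. by case/andP: a01. Qed.
Let a1 : a < 1. Proof. by case/andP: a01. Qed.

Let mker tau : measurable_fun [set: R] (fun s => ppow (- a) (tau - s) * y s).
Proof.
apply: measurable_funM => //; apply: measurable_ppow_comp.
exact: measurable_funB.
Qed.

Let ker_le tau : 0 < tau -> (\int[lam]_s `|(ppow (- a) (tau - s) * y s)%:E| <=
   (K * (tau `^ (1 - a) / (1 - a)))%:E)%E.
Proof.
move=> tau0; have a1' : -1 < - a by rewrite ltrN2.
rewrite EFinM [1 - a]addrC -(integral_ppow_sub tau a1' tau0) -ge0_integralZl//=; last 2 first.
- apply/measurable_EFinP; apply: measurable_funM.
    by apply: measurable_ppow_comp; exact: measurable_funB.
  by apply: measurable_bool_natr; apply: measurable_fun_ler => //; exact: measurable_funB.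
- by move=> x _; rewrite lee_fin mulr_ge0// ?ppow_ge0// ler0n.
apply: ge0_le_integral => //.
- by apply/measurable_EFinP; apply: measurableT_comp => //; exact: mker.
- apply/measurable_EFinP; apply: measurable_funM => //; apply: measurable_funM.
    by apply: measurable_ppow_comp; exact: measurable_funB.
  by apply: measurable_bool_natr; apply: measurable_fun_ler => //; exact: measurable_funB.
- move=> s _; rewrite lee_fin normrM ger0_norm ?ppow_ge0// mulrC.
  have [s0|s0] := ltP 0 s.
    by rewrite gerBl (ltW s0) mulr1 ler_wpM2r ?ppow_ge0.
  by rewrite y0// normr0 mul0r !mulr_ge0// ?ppow_ge0// ler0n.
Qed.

Lemma abel_integrable tau : 0 < tau ->
  lam.-integrable setT (fun s => (ppow (- a) (tau - s) * y s)%:E).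
Proof.
move=> tau0; apply/integrableP; split; first by apply/measurable_EFinP; exact: mker.
by apply: (le_lt_trans (ker_le tau0)); exact: ltry.
Qed.

Lemma abel_le0 tau : tau <= 0 -> abel tau = 0.
Proof.
move=> tau0; rewrite /abel (_ : (fun s => _) = fun=> 0); first by rewrite /Rintegral integral0.
apply/funext => s; have [s0|s0] := ltP 0 s; last by rewrite y0// mulr0.
by rewrite ppow0 ?mul0r//; lra.
Qed.

Lemma abel_bound tau : 0 < tau -> `|abel tau| <= K * (tau `^ (1 - a) / (1 - a)).
Proof.
move=> tau0; rewrite -lee_fin EFin_normr_Rintegral//; last exact: abel_integrable.
apply: le_trans (ker_le tau0); apply: le_abse_integral => //.
by apply/measurable_EFinP; exact: mker.
Qed.

(** After exchanging the integrals, the one over [tau] is [beta_integral] and equals [beta_const a]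
    for [s < t], 0 otherwise; what remains is the plain primitive of [y]. *)
Lemma abel_inversion t : lam.-integrable setT (fun tau => (ppow (a - 1) (t - tau) * abel tau)%:E) /\
  \int[lam]_tau (ppow (a - 1) (t - tau) * abel tau) =
    beta_const a * \int[lam]_(s in `]0, t]) y s.
Proof.
pose F (z : measurableTypeR R * measurableTypeR R) : \bar R :=
  (ppow (a - 1) (t - z.1) * (ppow (- a) (z.1 - z.2) * y z.2))%:E.
have mF : measurable_fun setT F.
  apply/measurable_EFinP; apply: measurable_funM.
    by apply: measurable_ppow_comp; apply: measurable_funB => //; exact: measurable_fst.
  apply: measurable_funM; last exact: (measurableT_comp my measurable_snd).
  by apply: measurable_ppow_comp; apply: measurable_funB; [exact: measurable_fst|exact: measurable_snd].
have mK s : measurable_fun [set: R] (fun x : R => (ppow (a - 1) (t - x) * ppow (- a) (x - s))%:E).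
  apply/measurable_EFinP; apply: measurable_funM; apply: measurable_ppow_comp; exact: measurable_funB.
(* Integrating in [tau] first makes the absolute integrand at most [K * beta_const a] on []0, t[]
   and 0 elsewhere. *)
have iF : (lam \x lam)%E.-integrable setT F.
  apply/integrable21ltyP => //.
  apply: (@le_lt_trans _ _ (\int[lam]_s ((K * beta_const a)%:E * (\1_`]0, t[%classic s)%:E))%E).
    apply: ge0_le_integral => //.
    - by move=> s _; apply: integral_ge0.
    - apply: (measurable_fun_fubini_tonelli_G (abse \o F)) => //.
      exact: measurableT_comp.
    - by move=> z; rewrite /F /= lee_fin.
    - apply: emeasurable_funM => //; apply/measurable_EFinP.
      by apply: measurable_indic; exact: measurable_itv.
    move=> s _.
    under eq_integral => tau _.
      rewrite /F/= mulrA normrM (@ger0_norm _ (_ * ppow _ _)) ?mulr_ge0 ?ppow_ge0// mulrC EFinM.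
      over.
    rewrite ge0_integralZl//; [|exact: mK|by move=> x _; rewrite lee_fin mulr_ge0// ppow_ge0].
    rewrite beta_integral// -EFinM lee_fin indicE -mulrA.
    have [s0|s0] := ltP 0 s.
      have -> : (s \in `]0, t[%classic) = (s < t)%R by rewrite mem_setE in_itv/= s0.
      by rewrite ler_wpM2r// mulr_ge0// ?ler0n// ltW// beta_const_gt0.
    by rewrite y0// normr0 mul0r !mulr_ge0// ltW// beta_const_gt0.
  rewrite ge0_integralZl//; last 2 first.
  - by apply/measurable_EFinP; apply: measurable_indic; exact: measurable_itv.
  - by rewrite lee_fin mulr_ge0// ltW// beta_const_gt0.
  rewrite integral_indic//= setIT lebesgue_measure_itv/= lte_fin.
  by case: ifP => _; rewrite ?mule0// -EFinB -EFinM ltry.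
have FE tau : fubini_F lam F tau = (ppow (a - 1) (t - tau) * abel tau)%:E.
  rewrite /fubini_F/F/=; have [tau0|tau0] := ltP 0 tau; last first.
    rewrite abel_le0// mulr0; under eq_integral => s _.
      rewrite (_ : _ * _ = 0); first by over.
      have [s0|s0] := ltP 0 s; last by rewrite y0// !mulr0.
      by rewrite (@ppow0 _ (- a)) ?mul0r ?mulr0//; lra.
    exact: integral0.
  under eq_integral do rewrite EFinM.
  rewrite integralZl//; last exact: abel_integrable.
  by rewrite EFinM /abel /Rintegral fineK// integrable_fin_num// abel_integrable.
have iFF : lam.-integrable setT (fun tau => (ppow (a - 1) (t - tau) * abel tau)%:E).
  have := integrable_fubini_F iF; apply: eq_integrable => // tau _; exact: FE.
split => //.
apply: EFin_inj; rewrite -[LHS]fineK ?integrable_fin_num//.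
have -> : (fine (\int[lam]_tau (ppow (a - 1) (t - tau) * abel tau)%R%:E))%:E = (\int[lam]_tau fubini_F lam F tau)%E.
  by rewrite fineK ?integrable_fin_num//; apply: eq_integral => tau _; rewrite FE.
have -> : (\int[lam]_tau fubini_F lam F tau = \int[lam]_s fubini_G lam F s)%E.
  by rewrite integral12_prod_meas1// -integral21_prod_meas1.
have GE s : fubini_G lam F s = ((beta_const a * y s) * (s < t)%R%:R)%:E.
  rewrite /fubini_G/F/=.
  under eq_integral => tau _ do rewrite mulrA mulrC EFinM.
  rewrite integralZl//; last first.
    apply/integrableP; split; first exact: mK.
    under eq_integral => tau _ do rewrite gee0_abs ?lee_fin ?mulr_ge0 ?ppow_ge0//.
    by rewrite beta_integral ?ltry.
  by rewrite beta_integral// -EFinM mulrA [y s * _]mulrC.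
under eq_integral => s _ do rewrite GE.
rewrite -Rintegral_itv_bndo_bndc; last first.
  apply: measurable_bounded_integrable => //.
  - by rewrite /= lebesgue_measure_itv/= lte_fin; case: ifP => _; rewrite ?ltry// -EFinB ltry.
  - exact: measurable_funTS.
  - exists K; split; first by rewrite num_real.
    by move=> M KM s _ /=; rewrite (le_trans (yK s))// ltW.
rewrite Rintegral_mkcond /Rintegral.
have iy : lam.-integrable setT (EFin \o (y \_ `]0, t[)).
  rewrite -restrict_EFin; apply/(integrable_mkcond _ _).1 => //.
  apply: measurable_bounded_integrable => //.
  - by rewrite /= lebesgue_measure_itv/= lte_fin; case: ifP => _; rewrite ?ltry// -EFinB ltry.
  - exact: measurable_funTS.
  - exists K; split; first by rewrite num_real.
    by move=> M KM s _ /=; rewrite (le_trans (yK s))// ltW.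
have fy : (\int[lam]_s ((y \_ `]0, t[) s)%:E)%E \is a fin_num by exact: integrable_fin_num.
rewrite EFinM (fineK fy) -integralZl//.
apply: eq_integral => s _; rewrite -EFinM; congr EFin; rewrite patchE -mulrA; congr (_ * _).
rewrite mem_setE in_itv/=; have [s0|s0] := ltP 0 s; last by rewrite y0// mul0r.
by case: (s < t)%R => /=; rewrite ?mulr1 ?mulr0.
Qed.

End abel.

Section Rdominated.
Context d (T : measurableType d) (R : realType).
Variables (nu : {measure set T -> \bar R}) (D : set T) (mD : measurable D).

Lemma Rdominated_cvg (f_ : nat -> T -> R) (f g : T -> R) :
  (forall n, measurable_fun D (f_ n)) ->
  (forall x, D x -> f_ n x @[n --> \oo] --> f x) ->
  nu.-integrable D (EFin \o g) ->
  (forall n x, D x -> `|f_ n x| <= g x) ->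
  nu.-integrable D (EFin \o f) /\
  \int[nu]_(x in D) f_ n x @[n --> \oo] --> \int[nu]_(x in D) f x.
Proof.
move=> mf ff ig fg.
have mlim : measurable_fun D f by apply: (measurable_fun_cvg mf) => x /ff.
have [//|||//||i0 _ cv] := @dominated_convergence _ T R nu D mD (fun n => EFin \o f_ n) (EFin \o f) (EFin \o g).
- by move=> n; exact/measurable_EFinP.
- exact/measurable_EFinP.
- by apply/aeW => x Dx; apply: cvg_EFin; [near=> n|exact: ff].
- by apply/aeW => x n Dx; rewrite /= lee_fin; exact: fg.
split => //.
have fin : (\int[nu]_(x in D) (f x)%:E)%E \is a fin_num by exact: integrable_fin_num.
by apply: fine_cvg; rewrite fineK.
Unshelve. all: by end_near. Qed.

End Rdominated.

(** * Smooth cutoffs of the power kernel, with bounds uniform in the cutoff parameter *)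

Section cutoffs.
Context {R : realType}.
Variable a : R.
Hypothesis a01 : 0 < a < 1.

(** Vanishes up to [1/(n+1)] and equals 1 from [2/(n+1)] on, so a test function multiplied by it
    stays away from time zero. *)
Definition rise n (x : R) : R := step (n.+1%:R * x + - 1).

Lemma smooth1_rise n : smooth1 (rise n).
Proof. exact/smooth1_affine/smooth1_step. Qed.

Lemma rise0 n x : x <= n.+1%:R^-1 -> rise n x = 0.
Proof.
move=> xn; rewrite /rise step0//; rewrite -(ler_pM2l (x := n.+1%:R)) ?ltr0n// in xn.
by rewrite divff ?pnatr_eq0// in xn; lra.
Qed.

Lemma rise1 n x : 2 / n.+1%:R <= x -> rise n x = 1.
Proof.
move=> nx; rewrite /rise step1//; rewrite ler_pdivrMr ?ltr0n// mulrC in nx; lra.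
Qed.

Lemma rise_ge0 n x : 0 <= rise n x. Proof. exact: step_ge0. Qed.
Lemma rise_le1 n x : rise n x <= 1. Proof. exact: step_le1. Qed.

Lemma derive1_rise n x : derive1 (rise n) x = n.+1%:R * bump (n.+1%:R * x + -1).
Proof.
have := is_derive_affine (smooth1_is_derive (n.+1%:R * x + -1) smooth1_step).
by move=> h; rewrite derive1E /rise derive_val.
Qed.

(** On the support of the derivative [(n + 1) x <= 2], which trades the factor [n + 1] for [2/x]:
    dominated convergence needs a bound free of [n]. *)
Lemma derive1_rise_le B n x : (forall x : R, `|bump x| <= B) -> 0 < x ->
  `|derive1 (rise n) x| <= 2 * B / x.
Proof.
move=> bB x0; rewrite derive1_rise ler_pdivlMr//.
have B0 : 0 <= B by exact: le_trans (bB 0).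
have [/andP[h1 h2]|xs] := boolP (0 <= n.+1%:R * x + -1 <= 1); last first.
  by rewrite bump_supp// mulr0 normr0 mul0r mulr_ge0.
rewrite normrM normr_nat mulrAC ler_pM// ?mulr_ge0//; first exact: ltW.
by lra.
Qed.

Lemma derive1_rise_cvg (x : R) : 0 < x -> \forall n \near \oo, derive1 (rise n) x = 0.
Proof.
move=> x0; near=> n; rewrite derive1_rise bump_supp ?mulr0//.
rewrite negb_and -!ltNge; apply/orP; right.
suff : 2 < n.+1%:R * x by lra.
rewrite -ltr_pdivrMr//; near: n; apply: (filterS _ (nbhs_infty_gtr (2 / x))).
by move=> n /lt_trans; apply; rewrite ltr_nat.
Unshelve. all: by end_near. Qed.

Lemma rise_cvg (x : R) : 0 < x -> \forall n \near \oo, rise n x = 1.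
Proof.
move=> x0; near=> n; rewrite rise1// ler_pdivrMr ?ltr0n// mulrC -ler_pdivrMr//.
apply: ltW; near: n; apply: (filterS _ (nbhs_infty_gtr (2 / x))).
by move=> n /lt_trans; apply; rewrite ltr_nat.
Unshelve. all: by end_near. Qed.

Definition pcut n (x : R) := x `^ a * rise n x.

Let a0 : 0 < a. Proof. by case/andP: a01. Qed.
Let a1 : a < 1. Proof. by case/andP: a01. Qed.

Lemma smooth1_pcut n : smooth1 (pcut n).
Proof.
apply: (@smooth1_powR_cutoff _ _ (n.+1%:R^-1)); first by rewrite invr_gt0 ltr0n.
  exact: smooth1_rise.
by move=> x; exact: rise0.
Qed.

Lemma pcut0 n x : x <= n.+1%:R^-1 -> pcut n x = 0.
Proof. by move=> /rise0; rewrite /pcut => ->; rewrite mulr0. Qed.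

Lemma pcut_le n x : `|pcut n x| <= ppow a x.
Proof.
have [x0|x0] := ltP 0 x; last first.
  by rewrite pcut0 ?normr0 ?ppow_ge0// (le_trans x0)// invr_ge0.
rewrite ger0_norm; last by apply: mulr_ge0; [exact: powR_ge0|exact: rise_ge0].
by rewrite ppowE// ler_piMr ?powR_ge0 ?rise_le1.
Qed.

Lemma pcut_cvg x : pcut n x @[n --> \oo] --> ppow a x.
Proof.
have [x0|x0] := ltP 0 x.
  rewrite ppowE//; apply: cvg_near_cst; near=> n.
  by rewrite /pcut (_ : rise n x = 1) ?mulr1//; near: n; exact: rise_cvg.
rewrite ppow0//; apply: cvg_near_cst; near=> n.
by rewrite pcut0// (le_trans x0)// invr_ge0.
Unshelve. all: by end_near. Qed.

Lemma derive1_pcut n x : 0 < x ->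
  derive1 (pcut n) x = a * x `^ (a - 1) * rise n x + x `^ a * derive1 (rise n) x.
Proof.
move=> x0.
have h := is_deriveM (is_derive1_powR a x0) (smooth1_is_derive x (smooth1_rise n)).
rewrite derive1E; have := @derive_val _ _ _ _ _ _ _ h => ->.
by rewrite /GRing.scale/= addrC; congr (_ + _); rewrite mulrC.
Qed.

Lemma derive1_pcut0 n x : x <= 0 -> derive1 (pcut n) x = 0.
Proof.
move=> x0; have n0 : 0 < n.+1%:R^-1 :> R by rewrite invr_gt0 ltr0n.
have x1 : x - 1 < n.+1%:R^-1 by rewrite (lt_trans _ n0)//; lra.
apply: (@derive1_eq0 _ _ (x - 1) (n.+1%:R^-1) 0) => //.
  by move=> z /andP[_ /ltW]; exact: pcut0.
by rewrite (le_lt_trans x0 n0) andbT; lra.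
Qed.

(** Both terms of the product rule have size [x^(a - 1)]: in the second, [x^a] absorbs the [1/x] of
    the cutoff. *)
Lemma derive1_pcut_le B n x : (forall x : R, `|bump x| <= B) ->
  `|derive1 (pcut n) x| <= (1 + 2 * B) * ppow (a - 1) x.
Proof.
move=> bB; have B0 : 0 <= B by exact: le_trans (bB 0).
have [x0|x0] := ltP 0 x; last first.
  by rewrite derive1_pcut0// normr0 mulr_ge0 ?ppow_ge0// addr_ge0// mulr_ge0.
rewrite derive1_pcut// ppowE// mulrDl.
apply: (le_trans (ler_normD _ _)); apply: lerD.
  have xr0 : 0 <= x `^ (a - 1) * rise n x by apply: mulr_ge0; [exact: powR_ge0|exact: rise_ge0].
  rewrite -mulrA normrM (gtr0_norm a0) ger0_norm//.
  apply: ler_pM; rewrite ?(ltW a0) ?(ltW a1)//.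
  by rewrite ler_piMr ?powR_ge0 ?rise_le1.
rewrite normrM (ger0_norm (powR_ge0 _ _)).
apply: (@le_trans _ _ (x `^ a * (2 * B / x))).
  by rewrite ler_wpM2l ?powR_ge0//; exact: derive1_rise_le.
rewrite powRB ?(gt_eqF x0) ?implybT// powRr1 ?(ltW x0)//.
by rewrite le_eqVlt; apply/orP; left; apply/eqP; field; rewrite gt_eqF.
Qed.

Lemma derive1_pcut_cvg x : derive1 (pcut n) x @[n --> \oo] --> a * ppow (a - 1) x.
Proof.
have [x0|x0] := ltP 0 x.
  rewrite ppowE//; apply: cvg_near_cst; near=> n.
  rewrite derive1_pcut// (_ : rise n x = 1) ?mulr1; last by near: n; exact: rise_cvg.
  rewrite (_ : derive1 (rise n) x = 0) ?mulr0 ?addr0//.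
  by near: n; exact: derive1_rise_cvg.
by rewrite ppow0// mulr0; apply: cvg_near_cst; near=> n; rewrite derive1_pcut0.
Unshelve. all: by end_near. Qed.

End cutoffs.

Lemma smooth1_measurable {R : realType} (f : R -> R) : smooth1 f -> measurable_fun [set: R] f.
Proof. by move=> fs; apply: continuous_measurable_fun; exact: smooth1_continuous. Qed.

Section restrict.
Context {T : Type} {R : realType}.
Implicit Types (D : set T) (f : T -> R).

Lemma restrict_in D f x : D x -> (f \_ D) x = f x.
Proof. by move=> Dx; rewrite patchE mem_set. Qed.

Lemma restrict_notin D f x : ~ D x -> (f \_ D) x = 0.
Proof. by move=> Dx; rewrite patchE memNset. Qed.

End restrict.

Section integrable_product.
Context d1 d2 (T1 : measurableType d1) (T2 : measurableType d2) (R : realType).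
Variables (m1 : {sigma_finite_measure set T1 -> \bar R})
  (m2 : {sigma_finite_measure set T2 -> \bar R}).

Lemma integrable_prod (k : T1 -> R) (psi : T2 -> R) :
  m1.-integrable setT (EFin \o k) -> m2.-integrable setT (EFin \o psi) ->
  (m1 \x m2)%E.-integrable setT (fun z => (k z.1 * psi z.2)%:E).
Proof.
move=> ik ipsi.
have mk : measurable_fun setT k by apply/measurable_EFinP; exact: measurable_int ik.
have mpsi : measurable_fun setT psi by apply/measurable_EFinP; exact: measurable_int ipsi.
apply/integrable12ltyP.
  apply/measurable_EFinP; apply: measurable_funM.
    exact: (measurableT_comp mk measurable_fst).
  exact: (measurableT_comp mpsi measurable_snd).
under eq_integral => x _.
  under eq_integral => y _ do rewrite /= normrM EFinM.
  rewrite ge0_integralZl//; last first.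
    by apply/measurable_EFinP; exact: measurableT_comp.
  over.
rewrite ge0_integralZr//; last 2 first.
- by apply/measurable_EFinP; exact: measurableT_comp.
- exact: integral_ge0.
move/integrableP : ik => [_ /= ik]; move/integrableP : ipsi => [_ /= ipsi].
by apply: lte_mul_pinfty => //; rewrite ?ge0_fin_numE// integral_ge0.
Qed.

(** The inner integral is finite almost everywhere, and there the inner [fine] changes nothing. *)
Lemma Rintegral12 (F : T1 * T2 -> R) : (m1 \x m2)%E.-integrable setT (EFin \o F) ->
  \int[(m1 \x m2)%E]_z F z = \int[m1]_x \int[m2]_y F (x, y).
Proof.
move=> iF; rewrite /Rintegral -integral12_prod_meas1//; congr fine.
have iFF := integrable_fubini_F iF.
apply: ae_eq_integral => //.
- exact: measurable_int iFF.
- by apply/measurable_EFinP; apply: measurableT_comp => //; exact: measurable_int iFF.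
- have := integrable_ae measurableT iFF; apply: filterS => x /= h _.
  by rewrite fineK//; exact: h.
Qed.

Lemma Rintegral21 (F : T1 * T2 -> R) : (m1 \x m2)%E.-integrable setT (EFin \o F) ->
  \int[(m1 \x m2)%E]_z F z = \int[m2]_y \int[m1]_x F (x, y).
Proof.
move=> iF; rewrite /Rintegral -integral21_prod_meas1//; congr fine.
have mG := measurable_fubini_G iF.
apply: ae_eq_integral => //.
- by apply/measurable_EFinP; apply: (measurableT_comp _ mG).
- have := ae_integrable2 iF; apply: filterS => y /= h _.
  by rewrite fineK//; exact: integrable_fin_num h.
Qed.

End integrable_product.

(** * From the weak equation to an identity for the primitive of a spatial average *)

Section frac_identity.
Context {R : realType} {d : nat}.
Local Notation lam := (@lebesgue_measure R).
Local Notation mu := (lebesgue_rV R d).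
Local Notation m := (lebesgue_tx R d).
Local Notation point := (R * 'rV[R]_d)%type.
Local Notation mpoint := (measurableTypeR R * 'rV[R]_d)%type.
Local Notation cyl T := (cylinder T (@setT 'rV[R]_d)).

Variables (a T Kw : R) (w : point -> R) (psi : 'rV[R]_d -> R).
Hypotheses (a01 : 0 < a < 1) (T0 : 0 < T).
Hypothesis mw : measurable_fun [set: mpoint] (w \_ (cyl T)).
Hypothesis wK : forall z, cyl T z -> `|w z| <= Kw.
Hypothesis ipsi : mu.-integrable setT (EFin \o psi).

Let wc : mpoint -> R := w \_ (cyl T).

Let a0 : 0 < a. Proof. by case/andP: a01. Qed.
Let a1 : a < 1. Proof. by case/andP: a01. Qed.

Let Kw0 : 0 <= Kw.
Proof.
apply: le_trans (wK (_ : cyl T (T / 2, 0))); first exact: normr_ge0.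
by move: T0 => h; split => //=; rewrite in_itv/=; apply/andP; split; lra.
Qed.

Let mpsi : measurable_fun setT psi.
Proof. by apply/measurable_EFinP; exact: measurable_int ipsi. Qed.

Let wcK z : `|wc z| <= Kw.
Proof.
have [zc|zc] := pselect (cyl T z); last by rewrite /wc restrict_notin// normr0.
by rewrite /wc restrict_in//; exact: wK.
Qed.

Let wc_out s x : ~~ (0 < s < T) -> wc (s, x) = 0.
Proof.
move=> sT; rewrite /wc restrict_notin// => -[/=]; rewrite in_itv/= => sT' _.
by rewrite sT' in sT.
Qed.

Let wc0 x s : s <= 0 -> wc (s, x) = 0.
Proof. by move=> s0; rewrite wc_out// negb_and -leNgt s0. Qed.

Let msec x : measurable_fun [set: R] (fun s : R => wc (s, x)).
Proof. exact: (measurableT_comp mw (@measurable_pair2 _ _ _ _ x)). Qed.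

Let J (z : mpoint) : R := abel a (fun s => wc (s, z.2)) z.1.

Lemma frac_intE z : cyl T z -> frac_int a w z = (Gamma_fun (1 - a))^-1 * J z.
Proof.
case: z => t x [/= + _]; rewrite in_itv/= => /andP[t0 tT].
rewrite /frac_int /J /abel/=; congr (_ * _); rewrite Rintegral_mkcond.
apply: eq_Rintegral => s _; rewrite patchE mem_setE in_itv/=.
have [s0|s0] := ltP 0 s => /=; last by rewrite wc0// mulr0.
have [st|ts] := ltP s t; last by rewrite ppow0 ?mul0r// subr_le0.
rewrite ppowE ?subr_gt0// /wc patchE mem_set//; split => //=.
by rewrite in_itv/= s0/= (lt_trans st).
Qed.

Let mJ : measurable_fun setT J.
Proof.
apply: (@measurable_fun_integral_section _ _ mpoint (measurableTypeR R) R lam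
  (fun zs : mpoint * measurableTypeR R => ppow (- a) (zs.1.1 - zs.2) * wc (zs.2, zs.1.2))).
have m11 : measurable_fun setT (fun zs : mpoint * measurableTypeR R => zs.1.1).
  exact: (measurableT_comp measurable_fst measurable_fst).
have m12 : measurable_fun setT (fun zs : mpoint * measurableTypeR R => zs.1.2).
  exact: (measurableT_comp measurable_snd measurable_fst).
apply: measurable_funM.
  by apply: measurable_ppow_comp; apply: measurable_funB => //; exact: measurable_snd.
apply: (measurableT_comp mw).
by apply: measurable_fun_pair => //; exact: measurable_snd.
Qed.

Let J_bound z : 0 < z.1 -> `|J z| <= Kw / (1 - a) * z.1 `^ (1 - a).
Proof.
move=> z0; apply: (le_trans (abel_bound a01 (msec z.2) (wc0 z.2) (fun s => wcK (s, z.2)) z0)).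
by rewrite mulrA mulrAC.
Qed.

(** The cutoff [wc] makes this defined at all times and zero outside []0, T[]; the zero extension to
    negative times takes over the role of the initial condition. *)
Definition slice (s : R) : R := \int[mu]_x (wc (s, x) * psi x).

(** To be instantiated by [f psi - \sum_i g_i D_i psi], the right-hand side of the equation paired
    with the spatial weight. *)
Variable H : point -> R.
Hypothesis iH : m.-integrable (cyl T) (EFin \o H).
Hypothesis weak : forall chi l u, smooth1 chi -> 0 < l -> u < T ->
  (forall t, ~~ (l <= t <= u) -> chi t = 0) ->
  int_cyl T setT (fun z => frac_int a w z * (derive1 chi z.1 * psi z.2)) =
  - int_cyl T setT (fun z => chi z.1 * H z).

Let iker t L b : -1 < b -> 0 < L ->
  lam.-integrable setT (fun s : R => (ppow b (t - s) * (t - s <= L)%R%:R)%:E).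
Proof.
move=> b1 L0; apply/integrableP; split.
  apply/measurable_EFinP; apply: measurable_funM.
    by apply: measurable_ppow_comp; exact: measurable_funB.
  by apply: measurable_bool_natr; apply: measurable_fun_ler => //; exact: measurable_funB.
under eq_integral do rewrite gee0_abs ?lee_fin ?mulr_ge0 ?ppow_ge0 ?ler0n//.
by rewrite integral_ppow_sub// ltry.
Qed.

Let iker' L b : -1 < b -> 0 < L ->
  lam.-integrable setT (fun s : R => (ppow b s * (s <= L)%R%:R)%:E).
Proof.
move=> b1 L0; apply/integrableP; split.
  apply/measurable_EFinP; apply: measurable_funM; first exact: measurable_ppow.
  by apply: measurable_bool_natr; exact: measurable_fun_ler.
under eq_integral do rewrite gee0_abs ?lee_fin ?mulr_ge0 ?ppow_ge0 ?ler0n//.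
by rewrite integral_ppow// ltry.
Qed.

Let G := (Gamma_fun (1 - a))^-1.

Section fixed_time.
Variable t : R.
Hypotheses (t0 : 0 < t) (tT : t < T).

(** Admissible test functions converging to the kernel [(t - s)_+^a]: one cutoff smooths the corner
    at [s = t], the other keeps the support away from [s = 0]. *)
Let chi n (s : R) := pcut a n (-1 * s + t) * rise n s.

Let smooth1_chi n : smooth1 (chi n).
Proof.
apply: smooth1M; last exact: smooth1_rise.
by apply: smooth1_affine; exact: (smooth1_pcut a).
Qed.

Let chi_supp n s : ~~ (n.+1%:R^-1 <= s <= t - n.+1%:R^-1) -> chi n s = 0.
Proof.
rewrite negb_and -!ltNge => /orP[sn|sn].
  by rewrite /chi rise0 ?mulr0// ltW.
by rewrite /chi pcut0 ?mul0r//; move: sn; set e := n.+1%:R^-1 => sn; lra.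
Qed.

Let derive1_chi n s : derive1 (chi n) s =
  - derive1 (pcut a n) (t - s) * rise n s + pcut a n (t - s) * derive1 (rise n) s.
Proof.
have h1 := is_derive_affine (smooth1_is_derive (-1 * s + t) (smooth1_pcut a n)).
have h2 := smooth1_is_derive s (@smooth1_rise R n).
rewrite derive1E; have := @derive_val _ _ _ _ _ _ _ (is_deriveM h1 h2) => ->.
rewrite /GRing.scale/= !mulN1r (addrC (- s) t) [RHS]addrC; congr (_ + _).
by rewrite mulrC.
Qed.

Let lim_f (z : mpoint) := G * J z * (- (a * ppow (a - 1) (t - z.1)) * psi z.2).

(** The derivative of the cutoff at time zero grows like [1/s], but [J] is [O(s^(1 - a))] because
    [w] is bounded. Their product is dominated by [s^(-a)] and tends to 0 pointwise, so no initial
    term is left in the limit. *)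
Let lhs_cvg : m.-integrable (cyl T) (EFin \o lim_f) /\
  int_cyl T setT (fun z => frac_int a w z * (derive1 (chi n) z.1 * psi z.2)) @[n --> \oo]
  --> \int[m]_(z in cyl T) lim_f z.
Proof.
have [B [B1 bB _]] := @bump_bounded R.
(* [c1] goes with [(t - s)^(a - 1)], from the derivative of the kernel; [c2] goes with [s^(-a)],
   from the derivative of the cutoff at zero. *)
pose c1 := `|G| * (Kw / (1 - a) * T `^ (1 - a)) * (1 + 2 * B).
pose c2 := `|G| * (Kw / (1 - a)) * (t `^ a * (2 * B)).
pose k (s : R) := c1 * (ppow (a - 1) (t - s) * (t - s <= t)%R%:R) + c2 * (ppow (- a) s * (s <= T)%R%:R).
pose g (z : mpoint) := k z.1 * `|psi z.2|.
have ik : lam.-integrable setT (EFin \o k).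
  have i1 := iker t (_ : -1 < a - 1) t0.
  have i2 := iker' (_ : -1 < - a) T0.
  have {}i1 := integrableZl measurableT c1 (i1 _).
  have {}i2 := integrableZl measurableT c2 (i2 _).
  have := integrableD measurableT (i1 _) (i2 _); apply; last by rewrite ltrN2.
  by rewrite -subr_gt0 opprK subrK.
have ig : m.-integrable (cyl T) (EFin \o g).
  have h := integrable_prod ik (integrable_norm ipsi).
  by apply: (integrableS _ (measurable_cylinder T) _ h).
pose f_ n (z : mpoint) := G * J z * (derive1 (chi n) z.1 * psi z.2).
have -> : (fun n => int_cyl T setT (fun z => frac_int a w z * (derive1 (chi n) z.1 * psi z.2))) =
    (fun n => \int[m]_(z in cyl T) f_ n z).
  by apply/funext => n; apply: eq_Rintegral => z /set_mem zT; rewrite /f_ frac_intE.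
apply: (@Rdominated_cvg _ _ _ _ _ _ _ _ g) => //.
- exact: measurable_cylinder.
- move=> n; apply: measurable_funTS; apply: measurable_funM.
    by apply: measurable_funM => //; exact: measurable_cst.
  apply: measurable_funM; last exact: (measurableT_comp mpsi measurable_snd).
  have mchi := smooth1_measurable (smooth1_derive1 (smooth1_chi n)).
  exact: (measurableT_comp mchi measurable_fst).
- move=> [s x] [/= + _]; rewrite in_itv/= => /andP[s0 sT]; rewrite /f_ /lim_f/=.
  apply: cvgM; first exact: cvg_cst.
  apply: cvgM; last exact: cvg_cst.
  under eq_fun do rewrite derive1_chi.
  have -> : - (a * ppow (a - 1) (t - s)) = - (a * ppow (a - 1) (t - s)) * 1 + ppow a (t - s) * 0.
    by rewrite mulr1 mulr0 addr0.
  apply: cvgD; apply: cvgM.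
  + by apply: cvgN; exact: derive1_pcut_cvg.
  + by apply: cvg_near_cst; exact: rise_cvg.
  + exact: pcut_cvg.
  + by apply: cvg_near_cst; exact: derive1_rise_cvg.
- move=> n [s x] [/= + _]; rewrite in_itv/= => /andP[s0 sT]; rewrite /f_ /g/=.
  rewrite mulrA normrM ler_wpM2r// !normrM derive1_chi.
  have B0 : 0 <= B by exact: le_trans B1.
  have Js := @J_bound (s, x) s0; rewrite /= in Js.
  have h1 := derive1_pcut_le a01 n (t - s) bB.
  have h2 := pcut_le a n (t - s).
  have h3 := derive1_rise_le n bB s0.
  have h4 : ppow a (t - s) <= t `^ a.
    by rewrite -ppowE//; apply: ppow_ndecr; rewrite ?(ltW a0)// gerBl ltW.
  have h5 : s `^ (1 - a) <= T `^ (1 - a).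
    by apply: ge0_ler_powR; rewrite ?nnegrE ?subr_ge0 ?(ltW a1) ?(ltW s0) ?(ltW T0)// ltW.
  have c0 : 0 <= Kw / (1 - a) by rewrite divr_ge0// subr_ge0 ltW.
  rewrite /k (_ : (t - s <= t)%R); last by rewrite gerBl ltW.
  rewrite (ltW sT) !mulr1.
  apply: (@le_trans _ _ (`|G| * (Kw / (1 - a) * s `^ (1 - a)) *
      ((1 + 2 * B) * ppow (a - 1) (t - s) + t `^ a * (2 * B / s)))).
    apply: ler_pM => //; first by rewrite ler_wpM2l.
    apply: (le_trans (ler_normD _ _)); apply: lerD.
      rewrite normrM normrN (ger0_norm (rise_ge0 n s)) (le_trans _ h1)// ler_piMr//.
      exact: rise_le1.
    by rewrite normrM; apply: ler_pM => //; exact: le_trans h4.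
  rewrite mulrDr; apply: lerD.
    rewrite /c1 -!mulrA ler_wpM2l// ler_wpM2l//.
    rewrite !mulrA ler_wpM2r ?ppow_ge0//.
    by rewrite ler_wpM2r ?ler_wpM2l// ?addr_ge0 ?mulr_ge0// invr_ge0 subr_ge0 ltW.
  rewrite /c2 ppowE// powRB ?(gt_eqF s0) ?implybT// powRr1 ?(ltW s0)// powRN.
  rewrite le_eqVlt; apply/orP; left; apply/eqP; field.
  by rewrite gt_eqF ?powR_gt0// (gt_eqF s0) subr_eq0 eq_sym lt_eqF.
Qed.

Let rhs_cvg : int_cyl T setT (fun z => chi n z.1 * H z) @[n --> \oo] -->
  int_cyl T setT (fun z => ppow a (t - z.1) * H z).
Proof.
have mH : measurable_fun (cyl T : set mpoint) H.
  by apply/measurable_EFinP; exact: measurable_int iH.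
have ig : m.-integrable (cyl T) (EFin \o (fun z => t `^ a * `|H z|)).
  have := integrableZl (measurable_cylinder T) (t `^ a) (integrable_norm iH).
  by [].
have [] // := @Rdominated_cvg _ mpoint R m (cyl T) (measurable_cylinder T)
  (fun n z => chi n z.1 * H z) (fun z => ppow a (t - z.1) * H z) (fun z => t `^ a * `|H z|).
- move=> n; apply: measurable_funM => //; apply: measurable_funTS.
  exact: (measurableT_comp (smooth1_measurable (smooth1_chi n)) measurable_fst).
- move=> [s x] [/= + _]; rewrite in_itv/= => /andP[s0 sT].
  apply: cvgM; last exact: cvg_cst.
  rewrite -[X in _ --> X]mulr1 /chi; apply: cvgM.
    by rewrite mulN1r [- s + t]addrC; exact: pcut_cvg.
  by apply: cvg_near_cst; exact: rise_cvg.
- move=> n [s x] [/= + _]; rewrite in_itv/= => /andP[s0 sT].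
  rewrite normrM ler_wpM2r// /chi normrM (ger0_norm (rise_ge0 n s)).
  apply: (@le_trans _ _ (ppow a (t - s))).
    rewrite -[leRHS]mulr1 mulN1r [- s + t]addrC; apply: ler_pM => //.
    + exact: rise_ge0.
    + exact: pcut_le.
    + exact: rise_le1.
  by rewrite -ppowE//; apply: ppow_ndecr; rewrite ?(ltW a0)// gerBl ltW.
Qed.

(** For fixed [x] the time integral is an Abel inversion and yields the primitive of [wc (., x)]; a
    second use of Fubini, for the integrable function [E], exchanges this primitive with the spatial
    average. *)
Let lhs_fubini : \int[m]_(z in cyl T) lim_f z =
  - (G * a * beta_const a * \int[lam]_(s in `]0, t]) slice s).
Proof.
have mc := measurable_cylinder (d := d) T.
have [il _] := lhs_cvg.
have lim_out z : ~ cyl T z -> lim_f z = 0.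
  case: z => s x sT; rewrite /lim_f/=.
  have [s0|s0] := ltP 0 s; last first.
    by rewrite /J/= abel_le0 ?mulr0 ?mul0r// => r; exact: wc0.
  rewrite ppow0 ?mulr0 ?oppr0 ?mul0r ?mulr0// subr_le0.
  rewrite leNgt; apply/negP => st; apply: sT; split => //=.
  by rewrite in_itv/= s0 (lt_trans st).
have limE : lim_f \_ (cyl T) = lim_f.
  apply/funext => z; have [zT|zT] := pselect (cyl T z).
    by rewrite restrict_in.
  by rewrite restrict_notin// lim_out.
rewrite Rintegral_mkcond limE Rintegral21; last first.
  by have := (integrable_mkcond _ mc).1 il; rewrite restrict_EFin limE.
have inner x : \int[lam]_s lim_f (s, x) =
    - (G * a * beta_const a) * (\int[lam]_(s in `]0, t]) wc (s, x) * psi x).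
  have [iab ab] := abel_inversion a01 (msec x) (wc0 x) (fun s => wcK (s, x)) t.
  transitivity (- (G * a) * psi x * \int[lam]_s (ppow (a - 1) (t - s) * abel a (fun s => wc (s, x)) s)).
    rewrite -RintegralZl//; apply: eq_Rintegral => s _; rewrite /lim_f /J/=; ring.
  by rewrite ab; ring.
pose E (z : mpoint) := (\1_(`]0%R, t]%classic) z.1 * wc z) * psi z.2.
have mI : measurable (`]0%R, t]%classic : set (measurableTypeR R)) by exact: measurable_itv.
have m1 : measurable_fun setT (\1_(`]0%R, t]%classic) : measurableTypeR R -> R).
  exact: measurable_indic.
have mE : measurable_fun setT E.
  apply: measurable_funM; last exact: (measurableT_comp mpsi measurable_snd).
  by apply: measurable_funM => //; exact: (measurableT_comp m1 measurable_fst).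
have iI : lam.-integrable setT (EFin \o (fun s => Kw * \1_(`]0%R, t]%classic) s)).
  have i1 : lam.-integrable setT (EFin \o \1_(`]0%R, t]%classic)).
    exact: integrable_indic_itv.
  exact: (integrableZl measurableT Kw i1).
have iE : m.-integrable setT (EFin \o E).
  apply: (le_integrable measurableT _ _ (integrable_prod iI (integrable_norm ipsi))).
    exact/measurable_EFinP.
  move=> [s x] _ /=; rewrite lee_fin /E/= !normrM normr_id ler_wpM2r//.
  rewrite mulrC ler_wpM2r// (ger0_norm Kw0); exact: wcK.
have isec x : lam.-integrable setT (EFin \o (fun s => \1_(`]0%R, t]%classic) s * wc (s, x))).
  apply: (le_integrable measurableT _ _ iI).
    by apply/measurable_EFinP; apply: measurable_funM => //; exact: msec.
  move=> s _ /=; rewrite lee_fin !normrM mulrC ler_wpM2r// (ger0_norm Kw0); exact: wcK.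
have isec' s : mu.-integrable setT (EFin \o (fun x => wc (s, x) * psi x)).
  apply: (le_integrable measurableT _ _ (integrableZl measurableT Kw (integrable_norm ipsi))).
    apply/measurable_EFinP; apply: measurable_funM => //.
    exact: (measurableT_comp mw (@measurable_pair1 _ _ _ _ s)).
  move=> x _ /=; rewrite lee_fin !normrM normr_id ler_wpM2r// (ger0_norm Kw0); exact: wcK.
have e1 x : \int[lam]_s lim_f (s, x) = \int[lam]_s (- (G * a * beta_const a) * E (s, x)).
  rewrite inner; transitivity (- (G * a * beta_const a) * psi x * \int[lam]_s (\1_(`]0%R, t]%classic) s * wc (s, x))).
    have -> : \int[lam]_(s in `]0, t]) wc (s, x) = \int[lam]_s (\1_(`]0%R, t]%classic) s * wc (s, x)).
      rewrite Rintegral_mkcond; apply: eq_Rintegral => s _; rewrite indicE patchE.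
      by case: ifPn => _; rewrite ?mul1r ?mul0r.
    by ring.
  by rewrite -RintegralZl//; apply: eq_Rintegral => s _; rewrite /E/=; ring.
have e2 s : \int[mu]_x E (s, x) = \1_(`]0%R, t]%classic) s * slice s.
  rewrite /slice -RintegralZl//.
  by apply: eq_Rintegral => x _; rewrite /E/= mulrA.
under eq_Rintegral do rewrite e1.
have iCE : m.-integrable setT (EFin \o (fun z => - (G * a * beta_const a) * E z)).
  exact: (integrableZl measurableT (- (G * a * beta_const a)) iE).
rewrite -(Rintegral21 iCE) RintegralZl// Rintegral12// mulNr; congr (- (_ * _)).
rewrite [in RHS]Rintegral_mkcond; apply: eq_Rintegral => s _.
by rewrite e2 indicE patchE; case: ifPn => _; rewrite ?mul1r ?mul0r.
Qed.

(** The limit of the weak equation tested with [chi n]. The kernel has exponent [a], not [a - 1]: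
    this is the time-integrated form of the statement that the average is a fractional integral of
    order [a]. *)
Lemma frac_identity : G * a * beta_const a * \int[lam]_(s in `]0, t]) slice s =
  int_cyl T setT (fun z => ppow a (t - z.1) * H z).
Proof.
have [_ lc] := lhs_cvg.
have e n : int_cyl T setT (fun z => frac_int a w z * (derive1 (chi n) z.1 * psi z.2)) =
    - int_cyl T setT (fun z => chi n z.1 * H z).
  apply: (weak (smooth1_chi n) _ _ (@chi_supp n)); first by rewrite invr_gt0 ltr0n.
  by rewrite ltrBlDr (lt_trans tT)// ltrDl invr_gt0 ltr0n.
have rc : - int_cyl T setT (fun z => chi n z.1 * H z) @[n --> \oo] -->
    - int_cyl T setT (fun z => ppow a (t - z.1) * H z).
  by apply: cvgN; exact: rhs_cvg.
have {}lc : - int_cyl T setT (fun z => chi n z.1 * H z) @[n --> \oo] --> \int[m]_(z in cyl T) lim_f z.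
  by under eq_fun do rewrite -e.
have := cvg_unique _ lc rc; rewrite lhs_fubini => h; apply: oppr_inj; exact: h.
Qed.

End fixed_time.
End frac_identity.

(** * Time regularity of averages *)

Section time_holder.
Context {R : realType} {d : nat}.
Local Notation lam := (@lebesgue_measure R).
Local Notation m := (lebesgue_tx R d).
Local Notation point := (R * 'rV[R]_d)%type.
Local Notation cyl T := (cylinder T (@setT 'rV[R]_d)).

(** With [Y] the primitive of [V], the difference of the forward quotients of [Y] at [t] and at [s]
    is, up to [c0], the pairing of [H] with a difference of two [diffq] kernels, whose [L_q] norm is
    bounded uniformly in the step; then the step tends to 0. The exponent is [((a - 1) q + 1) / q].
    The time [s = 0] is left out because a forward quotient there sees [V] at positive times, not
    the value [V 0 = 0]. *)
Lemma time_holder (a q : R) : 0 < a < 1 -> 1 < q -> -1 < (a - 1) * q ->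
  exists2 C : R, 0 < C & forall (T c0 A : R) (V : R -> R) (H : point -> R),
  0 < T -> 0 < c0 -> 0 <= A -> m.-integrable (cyl T) (EFin \o H) ->
  (forall (k : R -> R) (K : R), 0 <= K -> measurable_fun [set: R] k ->
    (\int[lam]_t (`|k t| `^ q * (0 < t)%R%:R)%:E <= (K `^ q)%:E)%E ->
    `|int_cyl T setT (fun z => k z.1 * H z)| <= A * K) ->
  lam.-integrable setT (EFin \o V) -> (forall s : R, s <= 0 -> V s = 0) ->
  (forall s : R, 0 < s < T -> {for s, continuous V}) ->
  (forall t : R, 0 < t < T ->
    c0 * \int[lam]_(s in `]0, t]) V s = int_cyl T setT (fun z => ppow a (t - z.1) * H z)) ->
  forall s t : R, s != 0 -> s < t -> 0 < t < T ->
    `|V t - V s| <= C * A / c0 * (t - s) `^ (a - 1 + q^-1).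
Proof.
move=> a01 q1 aq; have [C C0 hC] := diffq_kernel_bound a01 q1 aq.
have q0 : 0 < q by apply: lt_trans q1.
have /andP[a0 a1] := a01.
exists (C `^ q^-1); first by rewrite powR_gt0.
move=> T c0 A V H T0 c00 A0 iH bH iV V0 cV idV s t sn0 st /andP[t0 tT].
pose Y x := \int[lam]_(s in `]0, x]) V s.
have Y0 (x : R) : x <= 0 -> Y x = 0 by move=> x0; rewrite /Y set_itv_ge ?Rintegral_set0// -leNgt bnd_simp.
(* The identity persists at nonpositive times, where both sides vanish. *)
have idY (x : R) : x < T -> c0 * Y x = int_cyl T setT (fun z => ppow a (x - z.1) * H z).
  move=> xT; have [x0|x0] := ltP 0 x; first by rewrite /Y idV// x0.
  rewrite Y0// mulr0 /int_cyl.
  transitivity (\int[m]_(z in cyl T) (0:R)); first by rewrite /Rintegral integral0.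
  apply: eq_Rintegral => -[r y] /set_mem[/= + _]; rewrite in_itv/= => /andP[r0 _].
  by rewrite ppow0 ?mul0r//; lra.
(* By the fundamental theorem at positive times; at negative times [Y] vanishes on a
   neighborhood. *)
have dY (x : R) : x != 0 -> x < T -> (Y (x + e) - Y x) / e @[e --> 0^'+] --> V x.
  move=> xn0 xT; have [x0|x0] := ltP 0 x.
    have iV' : lam.-integrable `]0, T] (EFin \o V).
      by apply: integrableS iV => //; exact: measurable_itv.
    have cx : {for x, continuous V} by apply: cV; rewrite x0.
    have [|d1 d2] := @continuous_FTC1 R V (BRight 0) x T xT iV' _ cx.
      by exact: x0.
    rewrite -d2 derive1E; have {}d1 := cvg_dnbhs_at_right d1.
    apply: cvg_trans d1; apply: near_eq_cvg; near=> e.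
    by rewrite /= [e%:A]mulr1 [e + x]addrC [RHS]mulrC.
  have x0' : x < 0 by rewrite lt_neqAle xn0.
  apply: cvg_near_cst; near=> e.
  rewrite !Y0 ?subr0 ?mul0r ?V0//.
  by rewrite addrC -lerBrDr sub0r; near: e; apply: nbhs_right_le; rewrite oppr_gt0.
have ik (x : R) : x < T -> m.-integrable (cyl T) (EFin \o (fun z : measurableTypeR R * 'rV[R]_d => ppow a (x - z.1) * H z)).
  move=> xT.
  have mc := measurable_cylinder (d := d) T.
  apply: (le_integrable mc _ _ (integrableZl mc (T `^ a) (integrable_norm iH))).
    apply/measurable_EFinP; apply: measurable_funM; last first.
      by apply/measurable_EFinP; exact: measurable_int iH.
    have mp : measurable_fun [set: R] (fun r : R => ppow a (x - r)).
      by apply: measurable_ppow_comp; exact: measurable_funB.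
    by apply: measurable_funTS; exact: (measurableT_comp mp measurable_fst).
  move=> [r y] [/= + _]; rewrite in_itv/= => /andP[r0 rT].
  rewrite lee_fin !normrM normr_id ler_wpM2r// ger0_norm ?ppow_ge0// ger0_norm ?powR_ge0//.
  by rewrite -ppowE//; apply: ppow_ndecr; [exact: ltW|lra].
have quot (e : R) : 0 < e -> e <= t - s -> t + e < T ->
  `|(Y (t + e) - Y t) / e - (Y (s + e) - Y s) / e| <= A * (C * (t - s) `^ ((a - 1) * q + 1)) `^ q^-1 / c0.
  move=> e0 ets eT; rewrite ler_pdivlMr// mulrC.
  pose k x := diffq a e (t - x) - diffq a e (s - x).
  have kE : int_cyl T setT (fun z => k z.1 * H z) = c0 * ((Y (t + e) - Y t) / e - (Y (s + e) - Y s) / e).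
    have mc := measurable_cylinder (d := d) T.
    have sT : s < T by exact: lt_trans tT.
    have se : s + e < T by apply: lt_trans eT; rewrite ltrD2r.
    rewrite mulrBr !mulrA !(mulrBr c0) !idY// /int_cyl.
    have iD x y : x < T -> y < T -> m.-integrable (cyl T) (EFin \o
        (fun z : measurableTypeR R * 'rV[R]_d => ppow a (x - z.1) * H z - ppow a (y - z.1) * H z)).
      by move=> xT yT; exact: (integrableB mc (ik x xT) (ik y yT)).
    have iDe x y : x < T -> y < T -> m.-integrable (cyl T) (EFin \o
        (fun z : measurableTypeR R * 'rV[R]_d => (ppow a (x - z.1) * H z - ppow a (y - z.1) * H z) / e)).
      by move=> xT yT; exact: (integrableZr mc e^-1 (iD x y xT yT)).
    pose D x y := \int[m]_(z in cyl T) (ppow a (x - z.1) * H z - ppow a (y - z.1) * H z).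
    pose De x y := \int[m]_(z in cyl T) ((ppow a (x - z.1) * H z - ppow a (y - z.1) * H z) / e).
    transitivity (D (t + e) t / e - D (s + e) s / e); last first.
      by congr (_ / e - _ / e); apply: (RintegralB mc); exact: ik.
    transitivity (De (t + e) t - De (s + e) s); last first.
      by congr (_ - _); apply: (@RintegralZr _ _ _ m (cyl T) _ e^-1 mc); exact: iD.
    rewrite -(RintegralB mc (iDe _ _ eT tT) (iDe _ _ se sT)).
    apply: eq_Rintegral => z _; rewrite /k /diffq.
    rewrite !(addrAC _ e); ring.
  rewrite -{1}(ger0_norm (ltW c00)) -normrM -kE.
  apply: bH; first exact: powR_ge0.
    by apply: measurable_funB; apply: (measurableT_comp (measurable_diffq _ _)); exact: measurable_funB.
  rewrite -powRrM mulVf ?gt_eqF// powRr1; last by rewrite mulr_ge0 ?powR_ge0// ltW.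
  exact: hC.
have Pe : (C * (t - s) `^ ((a - 1) * q + 1)) `^ q^-1 = C `^ q^-1 * (t - s) `^ (a - 1 + q^-1).
  rewrite powRM ?powR_ge0 ?(ltW C0)// -powRrM; congr (_ * _ `^ _).
  by rewrite mulrDl mul1r mulfK// gt_eqF.
rewrite (_ : C `^ q^-1 * A / c0 * _ = A * (C * (t - s) `^ ((a - 1) * q + 1)) `^ q^-1 / c0); last first.
  by rewrite Pe; field; rewrite gt_eqF.
have cvt : `|(Y (t + e) - Y t) / e - (Y (s + e) - Y s) / e| @[e --> 0^'+] --> `|V t - V s|.
  by apply: cvg_norm; apply: cvgB; apply: dY; rewrite ?(gt_eqF t0)//; exact: lt_trans tT.
rewrite -(cvg_lim _ cvt)//; apply: limr_le; first by apply/cvg_ex; exists (`|V t - V s|).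
near=> e; apply: quot => //.
- by near: e; apply: nbhs_right_le; rewrite subr_gt0.
- by rewrite addrC -ltrBrDr; near: e; apply: nbhs_right_lt; rewrite subr_gt0.
Unshelve. all: by end_near.
Qed.

End time_holder.

(** * Positivity of the Gamma function on []0, 1[] *)

Section gamma.
Context {R : realType}.
Local Notation lam := (@lebesgue_measure R).

(** As a real integral is the [fine] of an extended one, positivity includes finiteness. The
    integrand is dominated by [t^(-a)] up to 1 and by the exponential density afterwards; from
    below, it is at least [exp(-1)] on []0, 1]]. *)
Lemma Gamma_fun_gt0 (a : R) : 0 < a < 1 -> 0 < Gamma_fun (1 - a).
Proof.
move=> /andP[a0 a1]; pose f (t : R) := t `^ (1 - a - 1) * expR (- t).
have f0 t : 0 <= f t by rewrite mulr_ge0 ?powR_ge0 ?expR_ge0.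
have mf : measurable_fun [set: R] f.
  apply: measurable_funM; first exact: measurable_powR.
  apply: continuous_measurable_fun => t.
  by apply: continuous_comp; [exact: opp_continuous|exact: continuous_expR].
pose g (t : R) := ppow (- a) t * (t <= 1)%R%:R + exponential_pdf 1 t.
have ig : lam.-integrable setT (EFin \o g).
  have i1 : lam.-integrable setT (EFin \o (fun t : R => ppow (- a) t * (t <= 1)%R%:R)).
    apply/integrableP; split.
      apply/measurable_EFinP; apply: measurable_funM; first exact: measurable_ppow.
      by apply: measurable_bool_natr; exact: measurable_fun_ler.
    under eq_integral do rewrite gee0_abs ?lee_fin ?mulr_ge0 ?ppow_ge0 ?ler0n//.
    by rewrite integral_ppow ?ltry// ltrN2.
  have i2 := @integrable_exponential_pdf R 1 ltr01.
  exact: (integrableD measurableT i1 i2).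
have mI : measurable (`]0%R, +oo[%classic : set (measurableTypeR R)) by exact: measurable_itv.
have if_ : lam.-integrable `]0%R, +oo[ (EFin \o f).
  have {}ig : lam.-integrable `]0%R, +oo[ (EFin \o g) by exact: integrableS ig.
  apply: (le_integrable mI _ _ ig).
    by apply/measurable_EFinP; exact: measurable_funTS.
  move=> t /=; rewrite in_itv/= andbT => t0; rewrite lee_fin (ger0_norm (f0 t)).
  apply: le_trans (ler_norm _); rewrite /g exponential_pdfE ?(ltW t0)// mul1r mulN1r.
  rewrite ppowE// /f (_ : 1 - a - 1 = - a); last by ring.
  have e0 := expR_ge0 (- t); have p0 := powR_ge0 t (- a).
  have [t1|t1] := leP t 1.
    by rewrite mulr1 ler_wpDr// ler_piMr// -expR0 ler_expR; lra.
  rewrite mulr0 add0r ler_piMl// powRN invf_le1 ?powR_gt0//.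
  by rewrite -[leLHS](powRr0 t) ler_powR// ltW.
have m01 : measurable (`]0%R, 1%R]%classic : set R) by exact: measurable_itv.
have le1 : ((expR (-1))%:E <= \int[lam]_(t in `]0%R, +oo[) (f t)%:E)%E.
  have -> : ((expR (-1))%:E = \int[lam]_(t in `]0%R, 1%R]) (expR (-1))%:E)%E.
    by rewrite integral_cst//= lebesgue_measure_itv/= lte_fin ltr01 sube0 mule1.
  apply: (@le_trans _ _ (\int[lam]_(t in `]0%R, 1%R]) (f t)%:E)%E).
    apply: ge0_le_integral => //.
    - by apply/measurable_EFinP; exact: measurable_funTS.
    - move=> t /=; rewrite in_itv/= => /andP[t0 t1]; rewrite lee_fin.
      rewrite -[leLHS]mul1r ler_pM//; last by rewrite ler_expR; lra.
      rewrite (_ : 1 - a - 1 = - a); last by ring.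
      rewrite powRN invf_ge1 ?powR_gt0//.
      have -> : 1 = (1 : R) `^ a by rewrite powR1.
      by apply: ge0_ler_powR; rewrite ?nnegrE ?ler01 ?(ltW a0) ?(ltW t0).
  apply: ge0_subset_integral => //; first exact/measurable_EFinP/measurable_funTS.
    by move=> t _; rewrite lee_fin.
  by move=> t /=; rewrite !in_itv/= andbT => /andP[].
rewrite /Gamma_fun /Rintegral fine_gt0//; apply/andP; split.
  by apply: lt_le_trans le1; rewrite lte_fin expR_gt0.
have /integrableP[_] := if_; congr (_ < _)%E.
by apply: eq_integral => t _; rewrite [in LHS]gee0_abs ?lee_fin.
Qed.

End gamma.

(** * Smooth averaging kernels on the line *)

Section kernel.
Context {R : realType}.
Local Notation lam := (@lebesgue_measure R).

(* A smooth probability density supported in [[c, c + r]]. *)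
Definition ker (c r y : R) : R := r^-1 * bump (r^-1 * y + - (c / r)).

Lemma smooth1_ker (c r : R) : smooth1 (ker c r).
Proof. by apply: smooth1Z; apply: smooth1_affine; exact: smooth1_bump. Qed.

Lemma derive1_step_affine c r (y : R) :
  is_derive y 1 (fun y => step (r^-1 * y + - (c / r))) (ker c r y).
Proof. exact: is_derive_affine (smooth1_is_derive _ smooth1_step). Qed.

Lemma derive1_ker c r (y : R) :
  derive1 (ker c r) y = r^-1 * (r^-1 * derive1 bump (r^-1 * y + - (c / r))).
Proof.
have h := is_derive_affine (smooth1_is_derive (r^-1 * y + - (c / r)) (@smooth1_bump R)).
by rewrite derive1E; have := @derive_val _ _ _ _ _ _ _ (is_deriveZ r^-1 h).
Qed.

Lemma ker_supp (c r y : R) : 0 < r -> ~~ (c <= y <= c + r) -> ker c r y = 0.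
Proof.
move=> r0 yc; rewrite /ker bump_supp ?mulr0//; apply: contra yc.
rewrite mulrC -mulrBl => /andP[]; rewrite pmulr_lge0 ?invr_gt0// subr_ge0 => ->/=.
by rewrite ler_pdivrMr// mul1r lerBlDl.
Qed.

Lemma ker_le (c r B y : R) : 0 < r -> (forall x : R, `|bump x| <= B) -> `|ker c r y| <= B / r.
Proof.
move=> r0 bB; rewrite /ker normrM gtr0_norm ?invr_gt0// mulrC ler_wpM2r ?invr_ge0// ltW//.
Qed.

Lemma derive1_ker_le (c r B y : R) : 0 < r -> (forall x : R, `|derive1 bump x| <= B) ->
  `|derive1 (ker c r) y| <= B / r / r.
Proof.
move=> r0 bB; rewrite derive1_ker 2!normrM gtr0_norm ?invr_gt0//.
by rewrite mulrA mulrC -mulrA ler_wpM2r// mulr_ge0 ?invr_ge0 ?ltW.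
Qed.

Lemma measurable_ker (c r : R) : measurable_fun [set: R] (ker c r).
Proof. exact: smooth1_measurable (smooth1_ker c r). Qed.

Lemma integral_ker_powR_le (c r B q : R) : 0 < r -> 0 < q -> (forall x : R, `|bump x| <= B) ->
  (\int[lam]_y (`|ker c r y| `^ q)%:E <= ((B / r) `^ q * r)%:E)%E.
Proof.
move=> r0 q0 bB.
have B0 : 0 <= B by apply: le_trans (bB 0).
have mI : measurable (`[c, c + r]%classic : set R) by exact: measurable_itv.
pose I := (\int[lam]_(y in `[c, (c + r)%R]) ((B / r) `^ q)%:E)%E.
apply: (@le_trans _ _ I); rewrite /I.
  rewrite [leRHS]integral_mkcond; apply: ge0_le_integral => //.
  - apply/measurable_EFinP; apply: (measurableT_comp (measurable_powR q)).
    by apply: measurableT_comp => //; exact: measurable_ker.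
  - by apply: (measurable_restrictT _ mI).1.
  - move=> y _; rewrite patchE; case: ifPn => [_|/negP yI].
      rewrite lee_fin; apply: ge0_ler_powR; rewrite ?nnegrE ?divr_ge0 ?(ltW q0) ?(ltW r0)//.
      exact: ker_le.
    rewrite ker_supp// ?normr0 ?powR0 ?gt_eqF//.
    by apply/negP => yI'; apply: yI; rewrite mem_setE in_itv.
rewrite integral_cst//= lebesgue_measure_itv/= lte_fin ltrDl r0.
by rewrite -EFinD -EFinM addrAC subrr add0r.
Qed.

Lemma integrable_ker (c r : R) : 0 < r -> lam.-integrable setT (EFin \o ker c r).
Proof.
move=> r0; apply/integrableP; split.
  by apply/measurable_EFinP; exact: measurable_ker.
have [B [_ bB _]] := @bump_bounded R.
have := integral_ker_powR_le c r0 ltr01 bB.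
under eq_integral do rewrite powRr1//.
by move/le_lt_trans; apply; exact: ltry.
Qed.

Lemma Rintegral_ker (c r : R) : 0 < r -> \int[lam]_y ker c r y = 1.
Proof.
move=> r0.
have -> : \int[lam]_y ker c r y = \int[lam]_(y in `[c, c + r]) ker c r y.
  rewrite [RHS]Rintegral_mkcond; apply: eq_Rintegral => y _; rewrite patchE.
  by case: ifPn => // /negP yI; rewrite ker_supp//; apply/negP => yI'; apply: yI; rewrite mem_setE in_itv.
pose S (y : R) := step (r^-1 * y + - (c / r)).
have sS : smooth1 S by apply: smooth1_affine; exact: smooth1_step.
rewrite /Rintegral (@continuous_FTC2 _ _ S).
- rewrite -EFinD/= /S step1 ?step0 ?subr0//.
    by rewrite mulrC subrr.
  by rewrite mulrDr mulVf ?gt_eqF// [r^-1 * c]mulrC addrAC subrr add0r.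
- by rewrite ltrDl.
- by apply: continuous_subspaceT; exact: smooth1_continuous (smooth1_ker c r).
- split.
  + by move=> y _; exact: smooth1_derivable.
  + by apply: cvg_at_right_filter; exact: smooth1_continuous sS _.
  + by apply: cvg_at_left_filter; exact: smooth1_continuous sS _.
- by move=> y _; rewrite derive1E; have [_ ->] := derive1_step_affine c r y.
Qed.

End kernel.

Section kernel_average.
Context {R : realType}.
Local Notation lam := (@lebesgue_measure R).

(** The kernel has integral 1, so [D0] minus the average is the average of [D0 - D]. The estimate
    uses the [L_1] norm of the kernel, bounded by [(B / r) * r = B], instead of its sign. *)
Lemma kernel_average (B c r delta X D0 : R) (D : R -> R) :
  0 < r -> 0 <= delta -> (forall x : R, `|bump x| <= B) ->
  lam.-integrable setT (EFin \o D) ->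
  (forall s, c <= s <= c + r -> `|D0 - D s| <= delta) ->
  `|\int[lam]_s (ker c r s * D s)| <= X -> `|D0| <= B * delta + X.
Proof.
move=> r0 delta0 bB iD Dd DX.
have mD : measurable_fun setT D by apply/measurable_EFinP; exact: measurable_int iD.
have mk := measurable_ker c r.
have ik := integrable_ker c r0.
have Br0 : 0 <= B / r by apply: le_trans (ker_le c c r0 bB).
have ikD : lam.-integrable setT (EFin \o (fun s => ker c r s * D s)).
  apply: (le_integrable measurableT _ _ (integrableZl measurableT (B / r) (integrable_norm iD))).
    by apply/measurable_EFinP; exact: measurable_funM.
  move=> s _ /=; rewrite lee_fin normrM [leRHS]normrM normr_id (ger0_norm Br0) ler_wpM2r//.
  exact: ker_le.
have ikc : lam.-integrable setT (EFin \o (fun s => D0 * ker c r s)).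
  exact: (integrableZl measurableT D0 ik).
have eD : D0 - \int[lam]_s (ker c r s * D s) = \int[lam]_s (D0 * ker c r s - ker c r s * D s).
  by rewrite (RintegralB measurableT ikc ikD) RintegralZl// Rintegral_ker// mulr1.
have ikk : lam.-integrable setT (EFin \o (fun s => delta * `|ker c r s|)).
  exact: (integrableZl measurableT delta (integrable_norm ik)).
have le1 : `|D0 - \int[lam]_s (ker c r s * D s)| <= B * delta.
  have iB : lam.-integrable setT (EFin \o (fun s => D0 * ker c r s - ker c r s * D s)).
    exact: (integrableB measurableT ikc ikD).
  rewrite eD (le_trans (le_normr_Rintegral measurableT iB))//.
  apply: (@le_trans _ _ (\int[lam]_s (delta * `|ker c r s|))).
    apply: le_Rintegral => //; first exact: (integrable_norm iB).
    move=> s _; rewrite mulrC -mulrBr normrM mulrC.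
    have [sc|sc] := boolP (c <= s <= c + r); first by rewrite ler_wpM2r ?Dd.
    by rewrite ker_supp// normr0 !mulr0.
  rewrite RintegralZl//; last exact: (integrable_norm ik).
  rewrite mulrC ler_wpM2r//.
  have := integral_ker_powR_le c r0 ltr01 bB.
  under eq_integral do rewrite powRr1//.
  rewrite powRr1// divfK ?gt_eqF// => h.
  rewrite -lee_fin /Rintegral fineK//.
  rewrite ge0_fin_numE; first by apply: (le_lt_trans h); exact: ltry.
  exact: integral_ge0.
rewrite -[D0](subrK (\int[lam]_s (ker c r s * D s))) (le_trans (ler_normD _ _))//.
exact: lerD.
Qed.

End kernel_average.

Section tensor_integral.
Context {R : realType}.
Local Notation lam := (@lebesgue_measure R).

(** [lebesgue_rV] is the image of a product measure under [cons_rV], so splitting off the first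
    coordinate reduces the claim to Fubini; in dimension 0 it is a Dirac mass and the empty product
    is 1. *)
Lemma tensor_integral (d : nat) (beta : 'I_d -> R -> R) :
  (forall i, lam.-integrable setT (EFin \o beta i)) ->
  (lebesgue_rV R d).-integrable setT (EFin \o tensor beta) /\
  \int[lebesgue_rV R d]_x tensor beta x = \prod_(i < d) \int[lam]_y beta i y.
Proof.
elim: d beta => [|n IH] beta ib.
  have -> : tensor beta = cst 1 by apply/funext => x; rewrite /tensor big_ord0.
  rewrite big_ord0 /=; split.
    apply/integrableP; split; first exact/measurable_EFinP.
    by rewrite integral_dirac//= ?diracT ?normr1 ?mul1e ?ltry//; apply/measurable_EFinP.
  by rewrite /Rintegral integral_dirac ?diracT ?mul1e//=; exact: measurable_cst.
have [it tE] := IH (fun i => beta (lift ord0 i)) (fun i => ib _).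
set tb := tensor (fun i => beta (lift ord0 i)) in it tE.
have E : tensor beta \o @cons_rV R n = fun z => beta ord0 z.1 * tb z.2.
  apply/funext => z; rewrite /= /tensor big_ord_recl mxE unlift_none; congr (_ * _).
  by apply: eq_bigr => i _; rewrite mxE liftK.
have ip := integrable_prod (ib ord0) it.
have mt : measurable_fun setT (EFin \o tensor beta).
  apply/measurable_EFinP; apply: measurable_tensor => i.
  by apply/measurable_EFinP; exact: measurable_int (ib i).
have ic : (@lebesgue_measure R \x lebesgue_rV R n)%E.-integrable setT
    ((EFin \o tensor beta) \o @cons_rV R n).
  have -> : (EFin \o tensor beta) \o @cons_rV R n = EFin \o (tensor beta \o @cons_rV R n) by [].
  by rewrite E.
split.
  have h := integrable_pushforward (@measurable_cons_rV R n) mt ic measurableT.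
  exact h.
rewrite big_ord_recl -tE.
rewrite /Rintegral /= (integral_pushforward (@measurable_cons_rV R n) mt ic measurableT).
transitivity (\int[(@lebesgue_measure R \x lebesgue_rV R n)%E]_z (beta ord0 z.1 * tb z.2)).
  rewrite /Rintegral preimage_setT; congr fine; apply: eq_integral => z _.
  by rewrite -(congr1 (fun f => f z) E).
rewrite (Rintegral12 ip) -RintegralZr//.
by apply: eq_Rintegral => x _ /=; rewrite RintegralZl.
Qed.

End tensor_integral.

(** * Time slices and mollification *)

Lemma Rintegral_sum {d} {T : measurableType d} {R : realType}
    (nu : {measure set T -> \bar R}) (D : set T) (I : Type) (r : seq I) (f : I -> T -> R) :
  measurable D -> (forall i, nu.-integrable D (EFin \o f i)) ->
  nu.-integrable D (EFin \o (fun x => \sum_(i <- r) f i x)) /\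
  \int[nu]_(x in D) (\sum_(i <- r) f i x) = \sum_(i <- r) \int[nu]_(x in D) f i x.
Proof.
move=> mD fi; have fr s : nu.-integrable D (EFin \o (fun x => \sum_(i <- s) f i x)).
  have := @integrable_sum _ _ _ nu D mD _ s predT (fun i => EFin \o f i) (fun i _ => fi i).
  by apply: eq_integrable => // x _; rewrite /= sumEFin.
split => //; elim: r => [|i r IH].
  rewrite big_nil; under eq_Rintegral do rewrite big_nil.
  by rewrite /Rintegral integral0.
under eq_Rintegral do rewrite big_cons.
by rewrite big_cons -IH; exact: RintegralD.
Qed.

Section slices.
Context {R : realType} {d : nat}.
Local Notation lam := (@lebesgue_measure R).
Local Notation mu := (lebesgue_rV R d).
Local Notation m := (lebesgue_tx R d).
Local Notation point := (R * 'rV[R]_d)%type.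
Local Notation mpoint := (measurableTypeR R * 'rV[R]_d)%type.
Local Notation cyl T := (cylinder T (@setT 'rV[R]_d)).
Local Notation LpN p T f := (Lp_norm p T (@setT 'rV[R]_d) f).

Definition tprod_test (T : R) (chi : R -> R) (beta : 'I_d -> R -> R) : Prop :=
  [/\ smooth1 chi, forall i, smooth1 (beta i),
    exists b c, [/\ 0 < b, c < T & forall t, ~~ (b <= t <= c) -> chi t = 0] &
    exists l u : 'I_d -> R, forall i y, ~~ (l i <= y <= u i) -> beta i y = 0].

(* A bound on the norm of [w] that refers neither to the chosen representatives
   of the gradient and of the time derivative nor to other test functions than
   products. *)
Definition hbound (alpha p T M : R) (w : point -> R) : Prop :=
  [/\ Lp_cyl p T setT w, (LpN p T w <= M%:E)%E,
    exists G : 'I_d -> point -> R,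
      [/\ forall i, Lp_cyl p T setT (G i), forall i, (LpN p T (G i) <= M%:E)%E &
        forall i chi beta, tprod_test T chi beta ->
          int_cyl T setT (fun z => w z * dx i (tprod chi beta) z) =
          - int_cyl T setT (fun z => G i z * tprod chi beta z)] &
    exists (g : 'I_d -> point -> R) (f : point -> R),
      [/\ forall i, Lp_cyl p T setT (g i), Lp_cyl p T setT f,
          forall chi beta, tprod_test T chi beta ->
            frac_Dt alpha T setT w (tprod chi beta) = div_form T setT g f (tprod chi beta),
          forall i, (LpN p T (g i) <= M%:E)%E & (LpN p T f <= M%:E)%E]].

Section fixed.
Variables (a p T M Kw : R) (w : point -> R).
Hypotheses (a01 : 0 < a < 1) (T0 : 0 < T).
Hypothesis (wH : hbound a p T M w).
Hypothesis cw : forall z, cyl T z -> {for z, continuous w}.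
Hypothesis wK : forall z, cyl T z -> `|w z| <= Kw.

Let wc : mpoint -> R := w \_ (cyl T).

Let mw : measurable_fun setT wc.
Proof. by have [/Lp_cyl_measurable] := wH. Qed.

Let Kw0 : 0 <= Kw.
Proof.
apply: le_trans (wK (_ : cyl T (T / 2, 0))); first exact: normr_ge0.
by move: T0 => h; split => //=; rewrite in_itv/=; apply/andP; split; lra.
Qed.

Let wcK z : `|wc z| <= Kw.
Proof.
have [zc|zc] := pselect (cyl T z); last by rewrite /wc restrict_notin// normr0.
by rewrite /wc restrict_in//; exact: wK.
Qed.

Let wc_out s x : ~~ (0 < s < T) -> wc (s, x) = 0.
Proof.
move=> sT; rewrite /wc restrict_notin// => -[/=]; rewrite in_itv/= => sT' _.
by rewrite sT' in sT.
Qed.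

Section one_weight.
Variable psi : 'rV[R]_d -> R.
Hypothesis ipsi : mu.-integrable setT (EFin \o psi).

Let mpsi : measurable_fun setT psi.
Proof. by apply/measurable_EFinP; exact: measurable_int ipsi. Qed.

Lemma slice_out s : ~~ (0 < s < T) -> slice T w psi s = 0.
Proof.
move=> sT; transitivity (\int[mu]_x (0 : R)); last by rewrite /Rintegral integral0.
by apply: eq_Rintegral => x _; rewrite -[X in X * _]/(wc (s, x)) wc_out// mul0r.
Qed.

Lemma slice_integrand s : mu.-integrable setT (EFin \o (fun x => wc (s, x) * psi x)).
Proof.
apply: (le_integrable measurableT _ _ (integrableZl measurableT Kw (integrable_norm ipsi))).
  apply/measurable_EFinP; apply: measurable_funM => //.
  exact: (measurableT_comp mw (@measurable_pair1 _ _ _ _ s)).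
move=> x _ /=; rewrite lee_fin !normrM normr_id ler_wpM2r// (ger0_norm Kw0); exact: wcK.
Qed.

Lemma integrable_slice_prod (k : R -> R) : lam.-integrable setT (EFin \o k) ->
  m.-integrable setT (EFin \o (fun z => wc z * (k z.1 * psi z.2))).
Proof.
move=> ik.
have mk : measurable_fun setT k by apply/measurable_EFinP; exact: measurable_int ik.
have h := integrable_prod (integrable_norm ik) (integrable_norm ipsi).
apply: (le_integrable measurableT _ _ (integrableZl measurableT Kw h)).
  apply/measurable_EFinP; apply: measurable_funM => //; apply: measurable_funM.
    exact: (measurableT_comp mk measurable_fst).
  exact: (measurableT_comp mpsi measurable_snd).
move=> z _; rewrite lee_fin (normrM (wc z)) (normrM Kw) (ger0_norm Kw0) ler_pM//=.
by rewrite !normrM !normr_id.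
Qed.

Lemma int_cyl_slice (k : R -> R) : lam.-integrable setT (EFin \o k) ->
  int_cyl T setT (fun z => w z * (k z.1 * psi z.2)) = \int[lam]_s (k s * slice T w psi s).
Proof.
move=> ik; rewrite int_cylE.
have -> : (fun z : point => w z * (k z.1 * psi z.2)) \_ (cyl T) = (fun z => wc z * (k z.1 * psi z.2)).
  by apply/funext => z; rewrite /wc !patchE; case: ifPn; rewrite ?mul0r.
rewrite (Rintegral12 (integrable_slice_prod ik)).
apply: eq_Rintegral => s _; rewrite /slice -RintegralZl//; last exact: slice_integrand.
by apply: eq_Rintegral => x _ /=; rewrite mulrCA.
Qed.

Lemma integrable_slice : lam.-integrable setT (EFin \o slice T w psi).
Proof.
have i1 : lam.-integrable setT (EFin \o \1_(`]0%R, T]%classic)) by exact: integrable_indic_itv.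
pose C := Kw * \int[mu]_x `|psi x|.
apply: (le_integrable measurableT _ _ (integrableZl measurableT C i1)).
  have mf : measurable_fun setT (fun z : mpoint => wc z * psi z.2).
    by apply: measurable_funM => //; exact: (measurableT_comp mpsi measurable_snd).
  by apply/measurable_EFinP; exact: (measurable_fun_integral_section mu mf).
have C0 : 0 <= C by rewrite mulr_ge0// Rintegral_ge0.
move=> s _; rewrite lee_fin /= normrM (ger0_norm C0).
have [sT|sT] := boolP (0 < s < T); last first.
  by rewrite slice_out// normr0 mulr_ge0.
rewrite indicE mem_set ?normr1 ?mulr1; last first.
  by rewrite /= in_itv/=; case/andP: sT => -> /ltW.
apply: (le_trans (le_normr_Rintegral measurableT (slice_integrand s))).
rewrite /C -RintegralZl//; last exact: (integrable_norm ipsi).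
apply: le_Rintegral => //; first exact: (integrable_norm (slice_integrand s)).
  exact: (integrableZl measurableT Kw (integrable_norm ipsi)).
by move=> x _; rewrite normrM ler_wpM2r.
Qed.

Lemma continuous_slice (s : R) : 0 < s < T -> {for s, continuous (slice T w psi)}.
Proof.
move=> sT.
apply: (@continuity_under_integral R _ _ mu (fun s x => wc (s, x) * psi x) setT measurableT 0 T _ _
    (fun x => Kw * `|psi x|)).
- by move=> r _; exact: slice_integrand.
- apply: aeW => x _ r /set_mem/= rT; rewrite in_itv/= in rT.
  apply: cvgM; last exact: cvg_cst.
  have cr : cyl T (r, x) by split => //=; rewrite in_itv.
  have h : (fun r => w (r, x)) r0 @[r0 --> r] --> wc (r, x).
    rewrite /wc restrict_in//.
    apply: (@continuous_comp _ _ _ (fun r => (r, x)) w); last exact: cw.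
    exact: (cvg_pair cvg_id (cvg_cst x)).
  apply: cvg_trans h; apply: near_eq_cvg; near=> r0.
  rewrite /wc restrict_in//; split => //=; rewrite in_itv/=.
  by near: r0; apply: (near_in_itvoo (a := 0) (b := T)); rewrite in_itv.
- exact: (integrableZl measurableT Kw (integrable_norm ipsi)).
- by move=> r _; apply: aeW => x _; rewrite normrM ler_wpM2r.
- by rewrite inE/= in_itv.
Unshelve. all: by end_near. Qed.

End one_weight.
End fixed.

Lemma integrable_smooth1 (f : R -> R) (l u : R) : smooth1 f ->
  (forall y, ~~ (l <= y <= u) -> f y = 0) -> lam.-integrable setT (EFin \o f).
Proof.
move=> fs f0; have [B B0 fB] := smooth1_bounded fs f0.
have i1 : lam.-integrable setT (EFin \o \1_(`[l, u]%classic)) by exact: integrable_indic_itv.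
apply: (le_integrable measurableT _ _ (integrableZl measurableT B i1)).
  by apply/measurable_EFinP; exact: smooth1_measurable.
move=> y _; rewrite lee_fin normrM (gtr0_norm B0) /= indicE.
have [yl|yl] := boolP (l <= y <= u).
  by rewrite mem_set ?normr1 ?mulr1//= in_itv.
by rewrite f0// normr0 mulr_ge0// ltW.
Qed.

(** A predicate on the constant, which must be fixed before [T], [w] and the weight. [L0] and [L1]
    bound the [L_q] norms of the weight and of its first derivatives, so [M * (L0 + d%:R * L1)]
    measures the pairing of [f] and [g] with them. *)
Definition slice_holder_const (a p q C : R) : Prop :=
  forall (T M Kw : R) (w : point -> R) (beta : 'I_d -> R -> R) (l u : 'I_d -> R) (L0 L1 : R),
  0 < T -> 0 <= M -> hbound a p T M w -> (forall z, cyl T z -> {for z, continuous w}) ->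
  (forall z, cyl T z -> `|w z| <= Kw) -> (forall i, smooth1 (beta i)) ->
  (forall i y, ~~ (l i <= y <= u i) -> beta i y = 0) -> 0 <= L0 -> 0 <= L1 ->
  (\int[mu]_x (`|tensor beta x| `^ q)%:E <= (L0 `^ q)%:E)%E ->
  (forall i, \int[mu]_x (`|tensor (upd beta i (derive1 (beta i))) x| `^ q)%:E <= (L1 `^ q)%:E)%E ->
  forall s t, s != 0 -> s < t -> 0 < t < T ->
  `|slice T w (tensor beta) t - slice T w (tensor beta) s| <=
    C * (M * (L0 + d%:R * L1)) * (t - s) `^ (a - p^-1).

(** Combines [frac_identity] for a product weight with [time_holder]; Hoelder's inequality on each
    term of [H] supplies the bound on its pairings. [c0] is the factor of the Abel inversion, and
    conjugacy turns [a - 1 + q^-1] into [a - p^-1]. *)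
Lemma slice_holder (a p q : R) : 0 < a < 1 -> 1 < p -> 1 < q -> p^-1 + q^-1 = 1 ->
  -1 < (a - 1) * q -> exists2 C : R, 0 < C & slice_holder_const a p q C.
Proof.
move=> a01 p1 q1 pq aq; have [C C0 hC] := @time_holder R d a q a01 q1 aq.
have q0 : 0 < q by exact: lt_trans q1.
have p0 : 0 < p by exact: lt_trans p1.
have /andP[a0 a1] := a01.
pose c0 := (Gamma_fun (1 - a))^-1 * a * beta_const a.
have c00 : 0 < c0.
  by rewrite !mulr_gt0// ?invr_gt0 ?Gamma_fun_gt0//; exact: beta_const_gt0.
exists (C / c0); first by rewrite divr_gt0.
move=> T M Kw w beta l u L0 L1 T0 M0 wH cw wK bs b0 L00 L10 hL0 hL1 s t sn0 st tT.
have [wp _ _ [g [f [gp fp fracD gM fM]]]] := wH.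
pose b' i := derive1 (beta i).
pose psi := tensor beta; pose psii i := tensor (upd beta i (b' i)).
have us i j : smooth1 (upd beta i (b' i) j).
  by rewrite /upd; case: ifP => _ //; exact: smooth1_derive1.
have mb : measurable_fun setT psi.
  by apply: measurable_tensor => i; exact: smooth1_measurable.
have mbi i : measurable_fun setT (psii i).
  by apply: measurable_tensor => j; exact: smooth1_measurable.
have ipsi : mu.-integrable setT (EFin \o psi).
  have [] // := @tensor_integral R d beta _.
  by move=> i; exact: (integrable_smooth1 (bs i) (b0 i)).
pose H (z : point) := f z * psi z.2 - \sum_(i < d) g i z * psii i z.2.
have mc := measurable_cylinder (d := d) T.
have hf (k : R -> R) (K : R) : 0 <= K -> measurable_fun [set: R] k ->
    (\int[lam]_t (`|k t| `^ q * (0 < t)%R%:R)%:E <= (K `^ q)%:E)%E ->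
    m.-integrable (cyl T) (EFin \o (fun z => f z * (k z.1 * psi z.2))) /\
    `|int_cyl T setT (fun z => f z * (k z.1 * psi z.2))| <= M * K * L0.
  by move=> K0 mk kK; exact: (hoelder_cyl p0 q0 pq M0 K0 L00 fp fM mk mb kK hL0).
have hg i (k : R -> R) (K : R) : 0 <= K -> measurable_fun [set: R] k ->
    (\int[lam]_t (`|k t| `^ q * (0 < t)%R%:R)%:E <= (K `^ q)%:E)%E ->
    m.-integrable (cyl T) (EFin \o (fun z => g i z * (k z.1 * psii i z.2))) /\
    `|int_cyl T setT (fun z => g i z * (k z.1 * psii i z.2))| <= M * K * L1.
  by move=> K0 mk kK; exact: (hoelder_cyl p0 q0 pq M0 K0 L10 (gp i) (gM i) mk (mbi i) kK (hL1 i)).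
have kHE (k : R -> R) : (fun z : point => k z.1 * H z) =
    (fun z => f z * (k z.1 * psi z.2) - \sum_(i < d) g i z * (k z.1 * psii i z.2)).
  apply/funext => z; rewrite /H mulrBr mulr_sumr [in LHS]mulrCA; congr (_ - _).
  by apply: eq_bigr => i _; rewrite mulrCA.
have hk (k : R -> R) (K : R) : 0 <= K -> measurable_fun [set: R] k ->
    (\int[lam]_t (`|k t| `^ q * (0 < t)%R%:R)%:E <= (K `^ q)%:E)%E ->
    m.-integrable (cyl T) (EFin \o (fun z => k z.1 * H z)) /\
    `|int_cyl T setT (fun z => k z.1 * H z)| <= M * (L0 + d%:R * L1) * K.
  move=> K0 mk kK; have [if_ fb] := hf k K K0 mk kK.
  have [ig gE] := @Rintegral_sum _ _ _ m (cyl T) _ (index_enum 'I_d) _ mc (fun i => (hg i k K K0 mk kK).1).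
  rewrite kHE; split; first exact: (integrableB mc if_ ig).
  have -> : int_cyl T setT (fun z => f z * (k z.1 * psi z.2) - \sum_(i < d) g i z * (k z.1 * psii i z.2)) =
      int_cyl T setT (fun z => f z * (k z.1 * psi z.2)) -
      \sum_(i < d) int_cyl T setT (fun z => g i z * (k z.1 * psii i z.2)).
    by rewrite /int_cyl -gE; exact: (RintegralB mc if_ ig).
  apply: (le_trans (ler_normB _ _)).
  have -> : M * (L0 + d%:R * L1) * K = M * K * L0 + d%:R * (M * K * L1) by ring.
  apply: lerD => //; apply: (le_trans (ler_norm_sum _ _ _)).
  have -> : d%:R * (M * K * L1) = \sum_(i < d) M * K * L1.
    by rewrite sumr_const card_ord mulr_natl.
  by apply: ler_sum => i _; have [] := hg i k K K0 mk kK.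
(* Integrability of [H] is the instance of [hk] where [k] is the indicator of []0, T]], of [L_q]
   norm [T^(1/q)]. *)
have iH : m.-integrable (cyl T) (EFin \o H).
  have [] // := hk (\1_(`]0%R, T]%classic)) (T `^ q^-1).
  - exact: powR_ge0.
  - rewrite -powRrM mulVf ?gt_eqF// powRr1 ?(ltW T0)//.
    pose I0T : R -> R := \1_(`]0%R, T]%classic).
    rewrite [leLHS](_ : _ = \int[lam]_t (I0T t)%:E)%E; last first.
      apply: eq_integral => x _; congr EFin; rewrite /I0T indicE.
      case: (boolP (x \in _)) => [|_]; last by rewrite normr0 powR0 ?gt_eqF// mul0r.
      by rewrite inE/= in_itv/= => /andP[-> _]; rewrite normr1 powR1 mulr1.
    rewrite /I0T integral_indic//= setIT lebesgue_measure_itv/= lte_fin T0.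
    by rewrite sube0.
  move=> + _; apply: eq_integrable => // -[r x] /set_mem[/= rT _].
  by rewrite indicE mem_set ?mul1r//; move: rT; rewrite /= !in_itv/= => /andP[-> /ltW].
have weak chi l' u' : smooth1 chi -> 0 < l' -> u' < T ->
    (forall t, ~~ (l' <= t <= u') -> chi t = 0) ->
    int_cyl T setT (fun z => frac_int a w z * (derive1 chi z.1 * psi z.2)) =
    - int_cyl T setT (fun z => chi z.1 * H z).
  move=> chis l'0 u'T chi0.
  have tt : tprod_test T chi beta by split => //; [exists l', u'|exists l, u].
  have := fracD _ _ tt.
  rewrite /frac_Dt /div_form => /(congr1 (fun x => - x)); rewrite opprK.
  under [X in X = _ -> _]eq_Rintegral do rewrite dt_tprod//.
  move=> e; rewrite [LHS]e; congr (- _); rewrite kHE; apply: eq_Rintegral => z _; congr (_ - _).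
  by apply: eq_bigr => i _; rewrite dx_tprod.
have id t' : 0 < t' < T -> c0 * \int[lam]_(s in `]0, t']) slice T w psi s =
    int_cyl T setT (fun z => ppow a (t' - z.1) * H z).
  by move=> /andP[t0' t'T]; apply: (frac_identity a01 T0 (Lp_cyl_measurable wp) wK ipsi iH weak).
have := hC T c0 (M * (L0 + d%:R * L1)) (slice T w psi) H T0 c00 _ iH (fun k K K0 mk kK => (hk k K K0 mk kK).2).
move=> /(_ _ _ _ _ id s t sn0 st tT).
rewrite (_ : a - 1 + q^-1 = a - p^-1); last by rewrite -pq; ring.
rewrite (_ : C * (M * (L0 + d%:R * L1)) / c0 = C / c0 * (M * (L0 + d%:R * L1))); last by ring.
apply.
- by rewrite mulr_ge0// addr_ge0// mulr_ge0.
- exact: (integrable_slice T0 wH wK ipsi).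
- by move=> r r0; apply: slice_out; rewrite negb_and -leNgt r0.
- by move=> r rT; exact: (continuous_slice T0 wH cw wK ipsi).
Qed.

End slices.

Lemma step_dist {R : realType} (x y : R) : `|step x - step y| <= 1.
Proof.
have x0 := step_ge0 x; have x1 := step_le1 x.
have y0 := step_ge0 y; have y1 := step_le1 y.
by rewrite ler_norml; apply/andP; split; lra.
Qed.

Lemma dist_sub_le {R : realDomainType} (x1 x2 y1 y2 K : R) :
  `|x1 - y1| <= K -> `|x2 - y2| <= K -> `|x1 - x2 - (y1 - y2)| <= 2 * K.
Proof.
move=> k1 k2; rewrite (_ : x1 - x2 - (y1 - y2) = (x1 - y1) - (x2 - y2)); last by ring.
by rewrite (le_trans (ler_normB _ _))// mulr_natl mulr2n lerD.
Qed.

Section time_average.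
Context {R : realType}.
Local Notation lam := (@lebesgue_measure R).

(** The window [[t - 2h, t - h]] lies in the past and, when [t > 2h], compactly inside []0, T[], so
    its kernel is an admissible test function in time. When [t <= 2h] the vanishing of [D] at
    negative times replaces the average. *)
Lemma time_average (B T h A kap X : R) (D : R -> R) :
  0 < h -> 0 <= A -> 0 <= kap -> 1 <= B -> 0 <= X -> (forall x : R, `|bump x| <= B) ->
  lam.-integrable setT (EFin \o D) ->
  (forall s t, s != 0 -> s < t -> 0 < t < T -> `|D t - D s| <= A * (t - s) `^ kap) ->
  (forall s, s <= 0 -> D s = 0) ->
  (forall t, 2 * h < t -> t < T -> `|\int[lam]_s (ker (t - 2 * h) h s * D s)| <= X) ->
  forall t, 0 < t < T -> `|D t| <= B * (A * (4 * h) `^ kap) + X.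
Proof.
move=> h0 A0 kap0 B1 X0 bB iD hD D0 hX t /andP[t0 tT].
have B0 : 0 <= B by exact: le_trans B1.
have A40 : 0 <= A * (4 * h) `^ kap by rewrite mulr_ge0// powR_ge0.
have incr x : 0 <= x -> x <= 4 * h -> A * x `^ kap <= A * (4 * h) `^ kap.
  move=> x0 xh; rewrite ler_wpM2l//; apply: ge0_ler_powR; rewrite ?nnegrE//.
  exact: le_trans xh.
have [th|ht] := leP t (2 * h).
  (* The comparison time is [- t] because time 0 is excluded from the Hoelder estimate; the distance
     [2 t <= 4 h] explains the factor 4. *)
  have Dnt : D (- t) = 0 by apply: D0; rewrite oppr_le0 ltW.
  have := hD (- t) t; rewrite Dnt subr0 opprK oppr_eq0 gt_eqF//.
  have ntt : - t < t by lra.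
  move=> /(_ isT ntt); rewrite t0 tT => /(_ isT) /le_trans; apply.
  rewrite -[leLHS]addr0; apply: lerD => //.
  apply: (@le_trans _ _ (A * (4 * h) `^ kap)); first by apply: incr; lra.
  exact: ler_peMl.
apply: (@kernel_average _ B (t - 2 * h) h _ X (D t) D) => //; last exact: hX.
move=> s /andP[s1 s2]; apply: (le_trans (hD s t _ _ _)).
- by rewrite gt_eqF//; lra.
- by lra.
- by rewrite t0.
- by apply: incr; lra.
Qed.

End time_average.

(** * Time and shift estimates for averages over small boxes *)

Section mollified.
Context {R : realType} {d : nat}.
Local Notation lam := (@lebesgue_measure R).
Local Notation mu := (lebesgue_rV R d).
Local Notation m := (lebesgue_tx R d).
Local Notation point := (R * 'rV[R]_d)%type.
Local Notation cyl T := (cylinder T (@setT 'rV[R]_d)).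

(** Each coordinate has its own side length, so that corner and side can be changed in one
    coordinate at a time. *)
Definition kers (c r : 'I_d -> R) : 'I_d -> R -> R := fun i => ker (c i) (r i).

Lemma prod_at (i : 'I_d) (x : R) : \prod_(j < d) (if j == i then x else 1) = x.
Proof.
rewrite (bigD1 i)//= eqxx big1 ?mulr1// => j /negbTE ->.
by [].
Qed.

(** A function of size [(2 B / rho)^d theta] on a cube of side [2 rho]; the powers of [rho] combine
    to [- d + d/q = - d/p]. The weights [th] record how one factor departs from the scaling of a
    kernel: [2 / rho] after differentiation, [rho] after integration. *)
Lemma tensor_norm_le (p q B rho theta : R) (beta : 'I_d -> R -> R) (l : 'I_d -> R) (th : 'I_d -> R) :
  0 < q -> p^-1 + q^-1 = 1 -> 0 < rho -> 0 <= B -> 0 <= theta ->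
  (forall j, measurable_fun [set: R] (beta j)) ->
  (forall j y, ~~ (l j <= y <= l j + 2 * rho) -> beta j y = 0) ->
  (forall j y, `|beta j y| <= 2 * B / rho * th j) -> \prod_(j < d) th j = theta ->
  (\int[mu]_x (`|tensor beta x| `^ q)%:E <=
    (((2 * B) ^+ d * 2 `^ (d%:R / q) * theta * rho `^ (- (d%:R / p))) `^ q)%:E)%E.
Proof.
move=> q0 pq rho0 B0 theta0 mb b0 bL thE.
have rho20 : 0 <= 2 * rho by rewrite mulr_ge0// ltW.
pose L := (2 * B / rho) ^+ d * theta.
have L0 : 0 <= L by rewrite mulr_ge0// exprn_ge0// divr_ge0 ?mulr_ge0// ltW.
have := @integral_tensor_le R d beta l (2 * rho) q L (fun j => 2 * B / rho * th j)
  (ltW q0) rho20 L0 mb b0 bL.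
rewrite big_split/= prodr_const card_ord thE lexx gt_eqF// => /(_ isT isT) /le_trans; apply.
rewrite lee_fin le_eqVlt; apply/orP; left; apply/eqP.
have -> : (2 * B) ^+ d * 2 `^ (d%:R / q) * theta * rho `^ (- (d%:R / p)) = L * (2 * rho) `^ (d%:R / q).
  rewrite /L expr_div_n -[rho ^+ d]powR_mulrn ?(ltW rho0)// -powRN powRM ?(ltW rho0)//.
  rewrite (_ : - (d%:R / p) = - d%:R + d%:R / q); last first.
    by rewrite -[X in - X + _](mulr1 d%:R) -pq; ring.
  rewrite powRD ?(gt_eqF rho0) ?implybT//; ring.
by rewrite powRM ?powR_ge0// -powRrM divfK ?gt_eqF// powR_mulrn.
Qed.

Section estimates.
Variables (a p q B C : R).
Hypotheses (a01 : 0 < a < 1) (p1 : 1 < p) (q1 : 1 < q) (pq : p^-1 + q^-1 = 1).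
Hypothesis kap0 : 0 <= a - p^-1.
Hypotheses (B1 : 1 <= B) (bB : forall x : R, `|bump x| <= B)
  (b'B : forall x : R, `|derive1 bump x| <= B).
Hypotheses (C0 : 0 < C) (hC : @slice_holder_const R d a p q C).
Variables (T M Kw : R) (w : point -> R).
Hypotheses (T0 : 0 < T) (M0 : 0 <= M) (wH : hbound a p T M w).
Hypothesis cw : forall z, cyl T z -> {for z, continuous w}.
Hypothesis wK : forall z, cyl T z -> `|w z| <= Kw.

Let CB : R := (2 * B) ^+ d * 2 `^ (d%:R / q).
(** [e0] is the power of the scale lost in the time estimate and [kap] the time exponent gained;
    they are tied by [kap * (2 / a) + e0 = sig]. *)
Let e0 : R := - (1 + d%:R / p).
Let kap : R := a - p^-1.
Let sig : R := 1 - (d%:R + 2 / a) / p.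
Let CT : R := C * (CB * (1 + 2 * d%:R)).

Let q0 : 0 < q. Proof. exact: lt_trans q1. Qed.
Let p0 : 0 < p. Proof. exact: lt_trans p1. Qed.
Let a0 : 0 < a. Proof. by case/andP: a01. Qed.
Let B0 : 0 <= B. Proof. exact: le_trans B1. Qed.
Let CB0 : 0 <= CB. Proof. by rewrite mulr_ge0 ?powR_ge0// exprn_ge0// mulr_ge0. Qed.
Let CT0 : 0 <= CT.
Proof. by rewrite mulr_ge0 ?(ltW C0)// mulr_ge0// addr_ge0// mulr_ge0. Qed.

(** The factor 2 leaves room for halving the sides, one coordinate after the other, while one common
    scale [rho] governs all bounds. *)
Let scales (rho : R) (r : 'I_d -> R) := forall i, rho / 2 <= r i <= rho.

Section scaled.
Variables (c r : 'I_d -> R) (rho : R).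
Hypotheses (rho0 : 0 < rho) (rr : scales rho r).

Let r0 i : 0 < r i.
Proof. by have /andP[h _] := rr i; apply: lt_le_trans h; rewrite divr_gt0. Qed.

Let ri i : (r i)^-1 <= 2 / rho.
Proof.
have /andP[h _] := rr i; rewrite -[leRHS]invrK lef_pV2 ?posrE ?invr_gt0 ?divr_gt0//.
by rewrite invf_div.
Qed.

Let bri i : B / r i <= 2 * B / rho.
Proof. by rewrite (mulrC 2 B) -mulrA ler_wpM2l. Qed.

Lemma kers_supp i y : ~~ (c i <= y <= c i + 2 * rho) -> kers c r i y = 0.
Proof.
move=> h; apply: ker_supp => //; apply: contra h => /andP[-> h]/=.
by apply: (le_trans h); have /andP[_ h'] := rr i; move: rho0 => ?; lra.
Qed.

Lemma kers_le i y : `|kers c r i y| <= 2 * B / rho * 1.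
Proof. by rewrite mulr1 (le_trans (ker_le _ _ (r0 i) bB)). Qed.

Lemma derive1_kers_le i y : `|derive1 (kers c r i) y| <= 2 * B / rho * (2 / rho).
Proof.
rewrite (le_trans (derive1_ker_le _ _ (r0 i) b'B))//; apply: ler_pM => //.
  by rewrite divr_ge0// ltW.
by rewrite invr_ge0 ltW.
Qed.

Lemma tensor_kers_norm :
  (\int[mu]_x (`|tensor (kers c r) x| `^ q)%:E <= ((CB * 1 * rho `^ (- (d%:R / p))) `^ q)%:E)%E.
Proof.
apply: (@tensor_norm_le p q B rho 1 (kers c r) c (fun=> 1)) => //.
- by move=> j; exact: measurable_ker.
- exact: kers_supp.
- exact: kers_le.
- by rewrite big1_eq.
Qed.

Lemma tensor_derive1_kers_norm i :
  (\int[mu]_x (`|tensor (upd (kers c r) i (derive1 (kers c r i))) x| `^ q)%:E <=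
    ((CB * (2 / rho) * rho `^ (- (d%:R / p))) `^ q)%:E)%E.
Proof.
apply: (@tensor_norm_le p q B rho _ _ c (fun j => if j == i then 2 / rho else 1)) => //.
- by rewrite divr_ge0// ltW.
- move=> j; rewrite /upd; case: eqP => _; last exact: measurable_ker.
  exact: smooth1_measurable (smooth1_derive1 (smooth1_ker _ _)).
- move=> j y jy; rewrite /upd; case: eqP => [ji|_]; last exact: kers_supp.
  by subst j; apply: (smooth1_supp_derive1 (smooth1_ker _ _) (@kers_supp i) jy).
- by move=> j y; rewrite /upd; case: eqP => [ji|_]; [exact: derive1_kers_le|exact: kers_le].
- exact: prod_at.
Qed.

Lemma integrable_kers : mu.-integrable setT (EFin \o tensor (kers c r)).
Proof.
have [] // := @tensor_integral R d (kers c r) _.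
by move=> i; exact: (integrable_smooth1 (smooth1_ker _ _) (@kers_supp i)).
Qed.

(** Differentiating the weight costs [2 / rho]. Since [rho <= 1], the zero-order contribution of [f]
    is absorbed into this loss; this confines the argument to scales up to 1. *)
Lemma mollified_time : rho <= 1 ->
  forall s t, s != 0 -> s < t -> 0 < t < T ->
  `|slice T w (tensor (kers c r)) t - slice T w (tensor (kers c r)) s| <=
  CT * M * rho `^ e0 * (t - s) `^ kap.
Proof.
move=> rho1 s t sn0 st tT.
have rho20 : 0 <= 2 / rho by rewrite divr_ge0// ltW.
pose L0 := CB * 1 * rho `^ (- (d%:R / p)).
pose L1 := CB * (2 / rho) * rho `^ (- (d%:R / p)).
have rp := powR_ge0 rho (- (d%:R / p)).
have L00 : 0 <= L0 by rewrite mulr_ge0// mulr_ge0.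
have L10 : 0 <= L1 by rewrite mulr_ge0// mulr_ge0.
have := hC T0 M0 wH cw wK (fun i => smooth1_ker (c i) (r i)) kers_supp L00 L10
  tensor_kers_norm tensor_derive1_kers_norm sn0 st tT.
move=> /le_trans; apply; rewrite ler_wpM2r ?powR_ge0//.
have -> : CT * M * rho `^ e0 = C * (M * (CB * (1 + 2 * d%:R) * rho `^ e0)).
  by rewrite /CT; ring.
rewrite ler_wpM2l ?(ltW C0)// ler_wpM2l//.
have -> : rho `^ e0 = rho `^ (- (d%:R / p)) * rho^-1.
  rewrite /e0 (_ : - (1 + d%:R / p) = - (d%:R / p) + -1); last by ring.
  by rewrite powRB ?(gt_eqF rho0) ?implybT// powRr1// ltW.
rewrite /L0 /L1 [leLHS](_ : _ = CB * (rho `^ (- (d%:R / p)) * (1 + 2 * d%:R / rho))); last by ring.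
rewrite -[leRHS]mulrA ler_wpM2l// mulrCA ler_wpM2l//.
by rewrite [leRHS]mulrDl lerD// mul1r invf_ge1.
Qed.

Lemma kers_average h s0 : 0 < h ->
  \int[lam]_s (ker s0 h s * slice T w (tensor (kers c r)) s) =
  int_cyl T setT (fun z => w z * (ker s0 h z.1 * tensor (kers c r) z.2)).
Proof.
move=> h0; rewrite (int_cyl_slice T0 wH wK integrable_kers)//.
exact: integrable_ker.
Qed.

End scaled.

Lemma ker_norm_le h c : 0 < h ->
  (\int[lam]_s (`|ker c h s| `^ q * (0 < s)%R%:R)%:E <= ((B * h `^ (- p^-1)) `^ q)%:E)%E.
Proof.
move=> h0; apply: (@le_trans _ _ (\int[lam]_s (`|ker c h s| `^ q)%:E)%E).
  apply: ge0_le_integral => //.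
  - apply/measurable_EFinP; apply: measurable_funM.
      by apply: (measurableT_comp (measurable_powR q)); apply: measurableT_comp => //; exact: measurable_ker.
    by apply: measurable_bool_natr; exact: measurable_fun_ltr.
  - by apply/measurable_EFinP; apply: (measurableT_comp (measurable_powR q)); apply: measurableT_comp => //; exact: measurable_ker.
  - by move=> s _; rewrite lee_fin ler_piMr ?powR_ge0//; case: (0 < s).
apply: (le_trans (integral_ker_powR_le c h0 q0 bB)).
have -> : (B * h `^ (- p^-1)) `^ q = (B / h) `^ q * h; last by [].
rewrite !powRM ?powR_ge0 ?invr_ge0 ?(ltW h0)// -mulrA; congr (_ * _).
rewrite (_ : h^-1 = h `^ (-1)); last by rewrite powRN powRr1// ltW.
rewrite -[X in _ * X]powRr1 ?(ltW h0)// -!powRrM.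
rewrite -powRD ?(gt_eqF h0) ?implybT//; congr (_ `^ _).
by have := congr1 (fun x => x * q) pq; rewrite mulrDl mulVf ?gt_eqF// => e; lra.
Qed.

(** At unit scale, with a time window of length 1, the average in time is controlled by the [L_p]
    norm of [w] through Hoelder's inequality. If [T] is at most 2, only the short-time case of
    [time_average] occurs, so no [T] enters. *)
Lemma mollified_bound c : forall t, 0 < t < T ->
  `|slice T w (tensor (kers c (fun=> 1))) t| <= (B * (CT * 4 `^ kap) + B * CB) * M.
Proof.
move=> t tT.
have r1 : scales 1 (fun=> 1) by move=> i; lra.
have Bk : 1 <= B := B1.
have := @time_average R B T 1 (CT * M) kap (B * CB * M) (slice T w (tensor (kers c (fun=> 1)))) ltr01
  _ kap0 B1 _ bB (integrable_slice T0 wH wK (integrable_kers c ltr01 r1)).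
rewrite !mulr1 => h.
rewrite (_ : (_ + _) * M = B * (CT * M * 4 `^ kap) + B * CB * M); last by ring.
apply: h => //.
- by rewrite mulr_ge0.
- by rewrite mulr_ge0// mulr_ge0.
- move=> s' t' sn0 st t'T; have := mollified_time c ltr01 r1 (lexx _) sn0 st t'T.
  by rewrite powR1 mulr1.
- by move=> s s0; apply: slice_out; rewrite negb_and -leNgt s0.
- move=> t' t'2 t'T; rewrite (kers_average _ ltr01 r1 _ ltr01).
  have [wp wM _ _] := wH.
  have mt : measurable_fun setT (tensor (kers c (fun=> 1))).
    by apply: measurable_tensor => i; exact: measurable_ker.
  have K0 : 0 <= B * 1 `^ (- p^-1) by rewrite mulr_ge0 ?powR_ge0.
  have L0 : 0 <= CB * 1 * 1 `^ (- (d%:R / p)) by rewrite mulr1 mulr_ge0 ?powR_ge0.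
  have [_] := hoelder_cyl p0 q0 pq M0 K0 L0 wp wM (measurable_ker (t' - 2) 1) mt
    (ker_norm_le _ ltr01) (tensor_kers_norm c ltr01 r1).
  rewrite !powR1 !mulr1 (_ : B * CB * M = M * B * CB)//; ring.
Qed.

Section shift.
Variables (c c' r r' : 'I_d -> R) (rho : R) (i : 'I_d).
Hypotheses (rho0 : 0 < rho) (rho1 : rho <= 1) (rr : scales rho r) (rr' : scales rho r').
Hypothesis cc' : `|c i - c' i| <= rho.
Hypothesis off : forall j, j != i -> c j = c' j /\ r j = r' j.

Let ri0 : 0 < r i.
Proof. by have /andP[h _] := rr i; apply: lt_le_trans h; rewrite divr_gt0. Qed.

Let ri'0 : 0 < r' i.
Proof. by have /andP[h _] := rr' i; apply: lt_le_trans h; rewrite divr_gt0. Qed.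

(** An antiderivative of the difference of two kernels. Both steps end at the value 1, so it has
    compact support; it is bounded by 1, a gain of a factor [rho] over a kernel. *)
Let g (y : R) := step ((r i)^-1 * y + - (c i / r i)) - step ((r' i)^-1 * y + - (c' i / r' i)).

Let sg : smooth1 g.
Proof. by apply: smooth1B; apply: smooth1_affine; exact: smooth1_step. Qed.

Let dg y : derive1 g y = ker (c i) (r i) y - ker (c' i) (r' i) y.
Proof.
rewrite derive1E; have h1 := derive1_step_affine (c i) (r i) y.
have h2 := derive1_step_affine (c' i) (r' i) y.
by have := @derive_val _ _ _ _ _ _ _ (is_deriveB h1 h2).
Qed.

Let l j := if j == i then Num.min (c i) (c' i) else c j.
Let be := upd (kers c r) i g.

Let stepE (x e y : R) : 0 < e -> e^-1 * y + - (x / e) = (y - x) / e.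
Proof. by move=> _; ring. Qed.

Let be_supp j y : ~~ (l j <= y <= l j + 2 * rho) -> be j y = 0.
Proof.
rewrite /l /be /upd; case: (boolP (j == i)) => [_|_]; last exact: (kers_supp rho0 rr).
have /andP[_ h1] := rr i; have /andP[_ h2] := rr' i.
move: cc' rho0 => /ler_normlP[e1 e2] r0.
rewrite negb_and -!ltNge /g !stepE// => /orP[yl|ly].
  rewrite lt_min in yl; move/andP : yl => [y1 y2].
  by rewrite !step0 ?subr0// mulr_le0_ge0 ?invr_ge0 ?(ltW ri0) ?(ltW ri'0)// subr_le0 ltW.
have [m1 m2] : c i + rho <= y /\ c' i + rho <= y.
  by move: ly; rewrite -ltrBrDr gt_min => /orP[m|m]; split; lra.
by rewrite !step1 ?subrr// ler_pdivlMr// mul1r; lra.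
Qed.

Let be_le j y : `|be j y| <= 2 * B / rho * (if j == i then rho else 1).
Proof.
rewrite /be /upd; case: eqP => [_|_]; last exact: (kers_le _ rho0 rr).
rewrite divfK ?gt_eqF// (@le_trans _ _ 1)//; last by move: B1 => ?; lra.
rewrite /g; set x := _ - c i / r i; set y' := _ - c' i / r' i.
exact: step_dist.
Qed.

Let smooth_be j : smooth1 (be j).
Proof. by rewrite /be /upd; case: ifP => _ //; exact: smooth1_ker. Qed.

Let tensor_diff x : tensor (upd be i (derive1 (be i))) x =
  tensor (kers c r) x - tensor (kers c' r') x.
Proof.
rewrite tensor_upd /be upd_same dg mulrBr (tensorD1 (kers c r) i) (tensorD1 (kers c' r') i).
congr (_ * _ - _ * _).
  by apply: eq_bigr => j ji; rewrite /upd (negbTE ji).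
apply: eq_bigr => j ji; rewrite /upd (negbTE ji) /kers.
by have [-> ->] := off ji.
Qed.

(** After averaging in time, the difference of the two weights is the [i]-th derivative of the test
    weight [be], so the weak gradient applies; the cost of the averaging is the time estimate over a
    distance [4 h]. *)
Lemma mollified_shift t : 0 < t < T ->
  `|slice T w (tensor (kers c r)) t - slice T w (tensor (kers c' r')) t| <=
  (B * (2 * CT * 4 `^ kap) + B * CB) * M * rho `^ sig.
Proof.
(* This window balances the errors: [rho^e0 * h^kap] and [rho * rho^(-d/p) * h^(-1/p)] both equal
   [rho^sig]. *)
move=> tT; pose h := rho `^ (2 / a).
have h0 : 0 < h by exact: powR_gt0.
pose D s := slice T w (tensor (kers c r)) s - slice T w (tensor (kers c' r')) s.
have ik := integrable_kers c rho0 rr; have ik' := integrable_kers c' rho0 rr'.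
have iD : lam.-integrable setT (EFin \o D).
  exact: (integrableB measurableT (integrable_slice T0 wH wK ik) (integrable_slice T0 wH wK ik')).
pose X := B * CB * M * rho `^ sig.
have X0 : 0 <= X by rewrite mulr_ge0 ?powR_ge0// mulr_ge0// mulr_ge0.
have A0 : 0 <= 2 * CT * M * rho `^ e0 by rewrite mulr_ge0 ?powR_ge0// mulr_ge0// mulr_ge0.
have hp : (4 * h) `^ kap * rho `^ e0 = 4 `^ kap * rho `^ sig.
  rewrite powRM ?(ltW h0)// -mulrA; congr (_ * _).
  rewrite -powRrM -powRD ?(gt_eqF rho0) ?implybT//; congr (_ `^ _).
  by rewrite /kap /sig /e0; field; rewrite !gt_eqF.
have -> : (B * (2 * CT * 4 `^ kap) + B * CB) * M * rho `^ sig =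
    B * (2 * CT * M * rho `^ e0 * (4 * h) `^ kap) + X.
  rewrite -[2 * CT * M * _ * _]mulrA [rho `^ e0 * _]mulrC hp /X; ring.
apply: (@time_average R B T h _ kap X D) => //.
- move=> s t' sn0 st t'T; rewrite /D.
  have h1 := mollified_time c rho0 rr rho1 sn0 st t'T.
  have h2 := mollified_time c' rho0 rr' rho1 sn0 st t'T.
  by rewrite (le_trans (dist_sub_le h1 h2))// !mulrA.
- move=> s s0; have so psi : slice T w psi s = 0.
    by apply: slice_out; rewrite negb_and -leNgt s0.
  by rewrite -(subrr (0 : R)); congr (_ - _); exact: so.
move=> t' t'2 t'T; pose chi := ker (t' - 2 * h) h.
have schi : smooth1 chi by exact: smooth1_ker.
have ichi : lam.-integrable setT (EFin \o chi) by exact: integrable_ker.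
have [_ _ [G [GG GM Gw]] _] := wH; have Gp := GG i.
have phi_test : tprod_test T chi be.
  split => //; last by exists l, (fun j => l j + 2 * rho).
  exists (t' - 2 * h), (t' - 2 * h + h); split; first by rewrite subr_gt0.
  - by move: h0 t'T => ? ?; lra.
  - by move=> s sn; apply: ker_supp.
pose E x := tensor (kers c r) x - tensor (kers c' r') x.
have iE : mu.-integrable setT (EFin \o E) by exact: (integrableB measurableT ik ik').
have DE s : D s = slice T w E s.
  rewrite /D /slice.
  rewrite -(RintegralB measurableT (slice_integrand T0 wH wK ik s) (slice_integrand T0 wH wK ik' s)).
  by apply: eq_Rintegral => x _; rewrite -mulrBr.
(* Integration by parts in space: the derivative moves from [be] to [w] as the weak gradient
   [G i]. *)
have -> : \int[lam]_s (chi s * D s) = - int_cyl T setT (fun z => G i z * (chi z.1 * tensor be z.2)).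
  transitivity (\int[lam]_s (chi s * slice T w E s)).
    by apply: eq_Rintegral => s _; rewrite DE.
  rewrite -(int_cyl_slice T0 wH wK iE ichi).
  have := Gw i _ _ phi_test => <-; apply: eq_Rintegral => z _.
  by rewrite dx_tprod// /tprod tensor_diff.
rewrite normrN.
have K0 : 0 <= B * h `^ (- p^-1) by rewrite mulr_ge0 ?powR_ge0.
have L0 : 0 <= CB * rho * rho `^ (- (d%:R / p)) by rewrite mulr_ge0 ?powR_ge0// mulr_ge0// ltW.
have mt : measurable_fun setT (tensor be).
  by apply: measurable_tensor => j; exact: smooth1_measurable.
have hN : (\int[mu]_x (`|tensor be x| `^ q)%:E <= ((CB * rho * rho `^ (- (d%:R / p))) `^ q)%:E)%E.
  apply: (@tensor_norm_le p q B rho rho be l (fun j => if j == i then rho else 1)) => //.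
  - exact: ltW.
  - by move=> j; exact: smooth1_measurable.
  - exact: prod_at.
have [_ le1] := hoelder_cyl p0 q0 pq M0 K0 L0 Gp (GM i) (measurable_ker _ _) mt
  (ker_norm_le (t' - 2 * h) h0) hN.
apply: (le_trans le1).
rewrite /X (_ : M * _ * _ = B * CB * M * (rho * rho `^ (- (d%:R / p)) * h `^ (- p^-1))); last by ring.
rewrite le_eqVlt; apply/orP; left; apply/eqP; congr (_ * _).
rewrite -{1}[rho](powRr1 (ltW rho0)) -powRrM -!powRD ?(gt_eqF rho0) ?implybT//; congr (_ `^ _).
by rewrite /sig; field; rewrite !gt_eqF.
Qed.

End shift.
End estimates.
End mollified.

(** * Oscillation of averages and the a priori estimate *)

Lemma dist_chain {R : numDomainType} (x1 x2 x3 x4 x5 A1 A2 A3 A4 : R) :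
  `|x2 - x1| <= A1 -> `|x2 - x3| <= A2 -> `|x3 - x4| <= A3 -> `|x4 - x5| <= A4 ->
  `|x1 - x5| <= A1 + A2 + A3 + A4.
Proof.
move=> h1 h2 h3 h4; rewrite distrC in h1.
apply: (le_trans (ler_distD x4 _ _)); apply: lerD => //.
apply: (le_trans (ler_distD x3 _ _)); apply: lerD => //.
by apply: (le_trans (ler_distD x2 _ _)); apply: lerD.
Qed.

Lemma regroup_le {R : realDomainType} (x y z u : R) :
  0 <= x -> y + z + u + y <= 2 * (x + y) + z + u.
Proof. by move=> x0; lra. Qed.

Section oscillation.
Context {R : realType} {d : nat}.
Local Notation mu := (lebesgue_rV R d).
Local Notation point := (R * 'rV[R]_d)%type.
Local Notation cyl T := (cylinder T (@setT 'rV[R]_d)).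

Section one_function.
Variables (a p T M Kw : R) (w : point -> R).
Hypotheses (T0 : 0 < T) (wH : hbound a p T M w).
Hypothesis cw : forall z, cyl T z -> {for z, continuous w}.
Hypothesis wK : forall z, cyl T z -> `|w z| <= Kw.

Let W (c r : 'I_d -> R) (t : R) : R := slice T w (tensor (kers c r)) t.

Let unif (rho : R) : 0 < rho -> forall i : 'I_d, rho / 2 <= (fun _ : 'I_d => rho) i <= rho.
Proof. by move=> rho0 i; rewrite lexx andbT ler_pdivrMr//; lra. Qed.

(** The kernel has integral 1, and its [L_1] norm is at most [(2 B / rho)^d * (2 rho)^d = (4 B)^d],
    whatever its sign and the scale. *)
Let W_close (B rho eps t : R) (x : 'rV[R]_d) : 1 <= B -> (forall y : R, `|bump y| <= B) ->
  0 < rho -> 0 < t < T ->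
  (forall y : 'rV[R]_d, (forall i, `|x ord0 i - y ord0 i| <= 2 * rho) -> `|w (t, x) - w (t, y)| <= eps) ->
  `|W (x ord0) (fun=> rho) t - w (t, x)| <= eps * (4 * B) ^+ d.
Proof.
move=> B1 bB rho0 tT close.
have B0 : 0 <= B by exact: le_trans B1.
have r1 := unif rho0; pose E := tensor (kers (x ord0) (fun=> rho)).
have eps0 : 0 <= eps.
  apply: le_trans (close x _); first exact: normr_ge0.
  by move=> i; rewrite subrr normr0 mulr_ge0// ltW.
have iE : mu.-integrable setT (EFin \o E) by exact: (integrable_kers _ rho0 r1).
have E1 : \int[mu]_y E y = 1.
  have [|_ ->] := @tensor_integral R d (kers (x ord0) (fun=> rho)).
    by move=> i; exact: integrable_ker.
  by rewrite big1// => i _; exact: Rintegral_ker.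
have i1 := slice_integrand T0 wH wK iE t.
have i2 : mu.-integrable setT (EFin \o (fun y => w (t, x) * E y)).
  exact: (integrableZl measurableT (w (t, x)) iE).
have -> : W (x ord0) (fun=> rho) t - w (t, x) =
    \int[mu]_y ((w \_ (cyl T)) (t, y) * E y - w (t, x) * E y).
  rewrite (RintegralB measurableT i1 i2); congr (_ - _).
  by rewrite RintegralZl// E1 mulr1.
have i3 : mu.-integrable setT (EFin \o (fun y => (w \_ (cyl T)) (t, y) * E y - w (t, x) * E y)).
  exact: (integrableB measurableT i1 i2).
have i4 : mu.-integrable setT (EFin \o (fun y => eps * `|E y|)).
  exact: (integrableZl measurableT eps (integrable_norm iE)).
apply: (le_trans (le_normr_Rintegral measurableT i3)).
apply: (@le_trans _ _ (\int[mu]_y (eps * `|E y|))).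
  apply: le_Rintegral => //; first exact: (integrable_norm i3).
  move=> y _; rewrite restrict_in; last by split => //=; rewrite in_itv.
  rewrite -mulrBl normrM.
  have [yb|yb] := pselect (box (x ord0) (fun i => x ord0 i + 2 * rho) y); last first.
    by rewrite /E (tensor_box (@kers_supp _ _ _ _ _ rho0 r1) yb) normr0 !mulr0.
  rewrite ler_wpM2r// distrC close// => i; have /andP[y1 y2] := yb i.
  by rewrite distrC ger0_norm ?subr_ge0// lerBlDl.
rewrite RintegralZl//; last exact: (integrable_norm iE).
rewrite ler_wpM2l//.
have rho20 : 0 <= 2 * rho by rewrite mulr_ge0// ltW.
have L0 : 0 <= (2 * B / rho) ^+ d by rewrite exprn_ge0// divr_ge0 ?mulr_ge0// ltW.
have := @integral_tensor_le R d (kers (x ord0) (fun=> rho)) (x ord0) (2 * rho) 1 ((2 * B / rho) ^+ d)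
  (fun=> 2 * B / rho * 1) ler01 rho20 L0 (fun j => measurable_ker _ _) (@kers_supp _ _ _ _ _ rho0 r1)
  (@kers_le _ _ _ B1 bB _ _ _ rho0 r1).
rewrite mulr1 prodr_const card_ord lexx oner_eq0 => /(_ isT isT).
under eq_integral do rewrite powRr1//.
rewrite powRr1// -exprMn (_ : 2 * B / rho * (2 * rho) = 4 * B); last by field; rewrite gt_eqF.
move=> h; rewrite -lee_fin /Rintegral fineK//.
rewrite ge0_fin_numE; first by apply: (le_lt_trans h); exact: ltry.
exact: integral_ge0.
Qed.

Lemma mollified_cvg (rho t : R) (x : 'rV[R]_d) : 0 < rho -> 0 < t < T ->
  W (x ord0) (fun=> rho / 2 ^+ n) t @[n --> \oo] --> w (t, x).
Proof.
move=> rho0 tT; have [B [B1 bB _]] := @bump_bounded R.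
apply/cvgrPdist_le => eps eps0.
have B40 : 0 < (4 * B) ^+ d by rewrite exprn_gt0// mulr_gt0// (lt_le_trans _ B1).
pose e1 := eps / (4 * B) ^+ d.
have e10 : 0 < e1 by rewrite divr_gt0.
have ctx : cyl T (t, x) by split => //=; rewrite in_itv.
have c1 : (fun y => w (t, y)) y @[y --> x] --> w (t, x).
  apply: (@continuous_comp _ _ _ (fun y => (t, y)) w); last exact: cw.
  have ct : {for x, continuous (fun _ : 'rV[R]_d => t)} by exact: cst_continuous.
  exact: (cvg_pair ct (@cvg_id _ (nbhs x))).
move/cvgrPdist_le : (c1) => /(_ _ e10) /nbhs_ballP[del /= del0 hdel].
have g0 : (fun n => 2 * (rho / 2 ^+ n)) n @[n --> \oo] --> (0 : R).
  have := @cvg_geometric R (2 * rho) 2^-1 _; rewrite gtr0_norm ?invr_gt0// invf_lt1 ?ltr1n//.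
  move=> /(_ isT); apply: cvg_trans; apply: near_eq_cvg; near=> n.
  by rewrite /geometric/= exprVn mulrA.
near=> n.
rewrite distrC (le_trans (@W_close B _ e1 t x B1 bB _ tT _))//.
- by rewrite divr_gt0// exprn_gt0.
- move=> y xy; apply: hdel; split => // i j; rewrite ord1 /ball/=.
  apply: (le_lt_trans (xy j)).
  by near: n; exact: (cvgr_lt _ g0).
- by rewrite /e1 divfK// gt_eqF.
Unshelve. all: by end_near. Qed.

Section telescope.
Variables (sig CS : R).
Hypotheses (sig0 : 0 < sig) (CS0 : 0 <= CS).
Hypothesis shift : forall (c c' r r' : 'I_d -> R) (rho : R) (i : 'I_d),
  0 < rho -> rho <= 1 -> (forall j, rho / 2 <= r j <= rho) ->
  (forall j, rho / 2 <= r' j <= rho) -> `|c i - c' i| <= rho ->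
  (forall j, j != i -> c j = c' j /\ r j = r' j) ->
  forall t, 0 < t < T -> `|W c r t - W c' r' t| <= CS * rho `^ sig.

(** The hybrids [mix k] take the first [k] coordinates from the target; consecutive ones differ in a
    single coordinate, which costs one application of [shift]. *)
Lemma mollified_shift_all (c c' r r' : 'I_d -> R) (rho : R) :
  0 < rho -> rho <= 1 -> (forall j, rho / 2 <= r j <= rho) ->
  (forall j, rho / 2 <= r' j <= rho) -> (forall j, `|c j - c' j| <= rho) ->
  forall t, 0 < t < T -> `|W c r t - W c' r' t| <= d%:R * (CS * rho `^ sig).
Proof.
move=> rho0 rho1 rr rr' cc t tT.
pose mix (k : nat) (f g : 'I_d -> R) (j : 'I_d) := if (j < k)%N then g j else f j.
have mixr k j : rho / 2 <= mix k r r' j <= rho by rewrite /mix; case: ifP.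
suff step k : (k <= d)%N -> `|W c r t - W (mix k c c') (mix k r r') t| <= k%:R * (CS * rho `^ sig).
  have := step d (leqnn d).
  have mixd f g : mix d f g = g by apply/funext => j; rewrite /mix ltn_ord.
  by rewrite !mixd.
elim: k => [_|k IH kd].
  by rewrite (_ : mix 0%N c c' = c)// (_ : mix 0%N r r' = r)// subrr normr0 mul0r.
rewrite -natr1 mulrDl mul1r.
apply: (le_trans (ler_distD (W (mix k c c') (mix k r r') t) _ _)).
apply: lerD; first exact: IH (ltnW kd).
pose i := Ordinal kd.
apply: (@shift _ _ _ _ rho i) => //.
  by rewrite /mix /= ltnn ltnSn.
move=> j ji; have jk : (j : nat) != k by apply: contra ji => /eqP jk; exact/eqP/val_inj.
by rewrite /mix ltnS [(j <= k)%N]leq_eqVlt (negbTE jk).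
Qed.

(** The ratio of the geometric series of errors over the dyadic scales; it is below 1 exactly
    because [sig > 0]. *)
Let x2 : R := 2 `^ (- sig).

Let x20 : 0 < x2. Proof. exact: powR_gt0. Qed.

Let x21 : x2 < 1.
Proof.
rewrite /x2 powRN invf_lt1 ?powR_gt0//.
apply: (@le_lt_trans _ _ ((1 : R) `^ sig)); first by rewrite powR1.
by apply: gt0_ltr_powR; rewrite ?nnegrE ?ltr1n.
Qed.

(** Telescoping over [rho / 2^n]: halving all sides at a fixed corner stays within one scale. The
    partial sums are kept in the closed form [1 - x2^n], so that the induction step is an equality,
    and [mollified_cvg] identifies the limit. *)
Lemma mollified_error (rho t : R) (x : 'rV[R]_d) : 0 < rho -> rho <= 1 -> 0 < t < T ->
  `|W (x ord0) (fun=> rho) t - w (t, x)| <= d%:R * CS / (1 - x2) * rho `^ sig.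
Proof.
move=> rho0 rho1 tT; have y20 : 0 < 1 - x2 by rewrite subr_gt0.
have K0 : 0 <= d%:R * CS / (1 - x2) * rho `^ sig.
  by rewrite mulr_ge0 ?powR_ge0// divr_ge0 ?(ltW y20)// mulr_ge0.
have tele n : `|W (x ord0) (fun=> rho) t - W (x ord0) (fun=> rho / 2 ^+ n) t| <=
    d%:R * CS / (1 - x2) * rho `^ sig * (1 - x2 ^+ n).
  elim: n => [|n IH]; first by rewrite expr0 divr1 !subrr normr0 mulr0.
  pose rn := rho / 2 ^+ n.
  have p2 : 0 < 2 ^+ n :> R by exact: exprn_gt0.
  have rn0 : 0 < rn by rewrite divr_gt0.
  have rn1 : rn <= 1.
    by rewrite /rn ler_pdivrMr// mul1r (le_trans rho1)// exprn_ege1// ler1n.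
  have e : rho / 2 ^+ n.+1 = rn / 2 by rewrite /rn exprS; field; rewrite gt_eqF.
  rewrite e.
  apply: (le_trans (ler_distD (W (x ord0) (fun=> rn) t) _ _)).
  have h : `|W (x ord0) (fun=> rn) t - W (x ord0) (fun=> rn / 2) t| <= d%:R * (CS * rn `^ sig).
    apply: (@mollified_shift_all _ _ _ _ rn) => //.
    - exact: unif.
    - by move=> j; rewrite lexx/= ler_pdivrMr//; lra.
    - by move=> j; rewrite subrr normr0 ltW.
  apply: (le_trans (lerD IH h)).
  have -> : rn `^ sig = rho `^ sig * x2 ^+ n.
    rewrite /rn powRM ?invr_ge0 ?(ltW rho0) ?(ltW p2)//; congr (_ * _).
    rewrite -[2 ^+ n]powR_mulrn// -powRN -powRrM /x2 -[RHS]powR_mulrn ?powR_ge0// -powRrM.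
    by rewrite mulNr mulNr mulrC.
  rewrite le_eqVlt; apply/orP; left; apply/eqP; rewrite exprS; field.
  by rewrite gt_eqF.
have c : `|W (x ord0) (fun=> rho) t - W (x ord0) (fun=> rho / 2 ^+ n) t| @[n --> \oo] -->
    `|W (x ord0) (fun=> rho) t - w (t, x)|.
  by apply: cvg_norm; apply: cvgB; [exact: cvg_cst|exact: mollified_cvg].
rewrite -(cvg_lim _ c)//; apply: limr_le; first by apply/cvg_ex; eexists; exact: c.
near=> n; rewrite (le_trans (tele n))// ler_piMr//.
by rewrite gerBl exprn_ge0// ltW.
Unshelve. all: by end_near. Qed.

Section conclusion.
Variables (CT C1 kap e0 : R).
Hypotheses (CT0 : 0 <= CT) (kap0 : 0 <= kap) (a0 : 0 < a) (e0E : kap * (2 / a) + e0 = sig).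
Hypothesis time : forall (c r : 'I_d -> R) (rho : R),
  0 < rho -> rho <= 1 -> (forall j, rho / 2 <= r j <= rho) ->
  forall s t, s != 0 -> s < t -> 0 < t < T ->
  `|W c r t - W c r s| <= CT * rho `^ e0 * (t - s) `^ kap.
Hypothesis sup : forall c t, 0 < t < T -> `|W c (fun=> 1) t| <= C1.

Let D := d%:R * CS / (1 - x2).

Let D0 : 0 <= D.
Proof. by rewrite divr_ge0 ?subr_ge0 ?(ltW x21)// mulr_ge0. Qed.

Let C10 : 0 <= C1.
Proof.
have tT : 0 < T / 2 < T by move: T0 => h; apply/andP; split; lra.
exact: le_trans (normr_ge0 _) (@sup (fun=> 0) _ tT).
Qed.

Lemma sup_bound z : cyl T z -> `|w z| <= C1 + D.
Proof.
case: z => t x [/= + _]; rewrite in_itv/= => tT.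
rewrite -[w _](subrK (W (x ord0) (fun=> 1) t)) addrC (le_trans (ler_normD _ _))//.
apply: lerD; first exact: sup.
by rewrite distrC (le_trans (mollified_error x ltr01 _ tT))// powR1 mulr1.
Qed.

(** The chain is [w(t, x)], the average at [x] and time [t], the one at [x] and time [s], the one at
    [y] and time [s], and finally [w(s, y)]. All averages use the same scale, and each link costs a
    multiple of its power [sig]. *)
Lemma holder_bound_lt z z' (del : R) : cyl T z -> cyl T z' -> z'.1 <= z.1 ->
  0 <= del -> (forall j, `|z.2 ord0 j - z'.2 ord0 j| <= del) ->
  `|w z - w z'| <= (2 * (C1 + D) + CT + d%:R * CS) *
    (`|z.1 - z'.1| `^ (sig * a / 2) + del `^ sig).
Proof.
move: z z' => [t x] [s y] cz cz' /= st r20 xy.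
have [tT sT] : 0 < t < T /\ 0 < s < T by move: cz cz' => [/= + _] [/= + _]; rewrite !in_itv.
set N := _ + _ + _; have N0 : 0 <= N by rewrite !addr_ge0// mulr_ge0// ?addr_ge0.
pose r1 := `|t - s| `^ (a / 2).
(* The parabolic distance of the two points: [r1] is the spatial length that corresponds to the time
   lag. *)
pose r := Num.max r1 del.
have r10 : 0 <= r1 by exact: powR_ge0.
have r0 : 0 <= r by rewrite le_max r10.
have rs : r `^ sig <= `|t - s| `^ (sig * a / 2) + del `^ sig.
  have -> : `|t - s| `^ (sig * a / 2) = r1 `^ sig by rewrite -powRrM; congr (_ `^ _); ring.
  by rewrite /r maxEle; case: ifP => _; [rewrite lerDr|rewrite lerDl]; exact: powR_ge0.
apply: (@le_trans _ _ (N * r `^ sig)); last by rewrite ler_wpM2l.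
have [rE|rn0] := eqVneq r 0.
  have : r1 <= 0 /\ del <= 0 by rewrite -rE !le_max !lexx orbT.
  rewrite /r1 => -[r10' del0].
  have -> : x = y.
    by apply/rowP => j; apply/eqP; rewrite -subr_eq0 -normr_le0 (le_trans (xy j)).
  have : `|t - s| = 0.
    apply/eqP; move: r10'; apply: contraTT => h; rewrite -ltNge powR_gt0//.
    by rewrite lt_neqAle eq_sym h normr_ge0.
  by move/normr0_eq0/subr0_eq ->; rewrite subrr normr0 mulr_ge0 ?powR_ge0.
have {r0 rn0}r0 : 0 < r by rewrite lt_neqAle eq_sym rn0.
(* Beyond scale 1 the averages are not controlled, but there [r^sig >= 1] and the sup bound
   suffices. *)
have [r1'|r1'] := leP r 1; last first.
  apply: (@le_trans _ _ (2 * (C1 + D))).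
    by rewrite mulr_natl mulr2n (le_trans (ler_normB _ _))// lerD//; exact: sup_bound.
  apply: (@le_trans _ _ N); first by rewrite /N -addrA lerDl addr_ge0// mulr_ge0.
  rewrite ler_peMr//; apply: (@le_trans _ _ ((1 : R) `^ sig)); first by rewrite powR1.
  by apply: ge0_ler_powR; rewrite ?nnegrE ?(ltW sig0) ?(ltW r0)// ltW.
have h1 := mollified_error x r0 r1' tT.
have h2 := mollified_error y r0 r1' sT.
have h3 : `|W (x ord0) (fun=> r) t - W (x ord0) (fun=> r) s| <= CT * r `^ sig.
  move: st; rewrite le_eqVlt => /orP[/eqP ->|st].
    by rewrite subrr normr0 mulr_ge0 ?powR_ge0.
  have sn0 : s != 0 by case/andP: sT => /gt_eqF ->.
  have := time (x ord0) r0 r1' (unif r0) sn0 st tT; move=> /le_trans; apply.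
  rewrite -mulrA ler_wpM2l// -e0E powRD ?(gt_eqF r0) ?implybT// mulrC ler_wpM2r ?powR_ge0//.
  rewrite mulrC powRrM; apply: ge0_ler_powR; rewrite ?nnegrE ?powR_ge0 ?subr_ge0 ?(ltW st)//.
  apply: (@le_trans _ _ (r1 `^ (2 / a))).
    rewrite /r1 -powRrM gtr0_norm ?subr_gt0// (_ : a / 2 * (2 / a) = 1); last first.
      by field; rewrite gt_eqF.
    by rewrite powRr1// subr_ge0 ltW.
  by apply: ge0_ler_powR; rewrite ?nnegrE ?(ltW r0) ?divr_ge0 ?(ltW a0)// le_max lexx.
have h4 : `|W (x ord0) (fun=> r) s - W (y ord0) (fun=> r) s| <= d%:R * CS * r `^ sig.
  rewrite -mulrA; apply: (@mollified_shift_all _ _ _ _ r) => //; [exact: unif|exact: unif|].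
  move=> j; apply: (@le_trans _ _ del) => //; by rewrite le_max lexx orbT.
have DN : (D + CT + d%:R * CS + D) * r `^ sig <= N * r `^ sig.
  by rewrite ler_wpM2r ?powR_ge0// /N regroup_le.
apply: le_trans DN; rewrite !mulrDl.
exact: dist_chain h1 h3 h4 h2.
Qed.

End conclusion.
End telescope.
End one_function.
End oscillation.

(** * The a priori estimate, with a constant depending on [d], [a] and [p] only *)

Section apriori.
Context {R : realType} {d : nat}.
Local Notation point := (R * 'rV[R]_d)%type.
Local Notation cyl T := (cylinder T (@setT 'rV[R]_d)).

(** Pointwise inequalities, hence stable under pointwise limits. The spatial distance enters through
    any bound [del] on the coordinates, so the Euclidean norm can be inserted at the end. *)
Definition holder_estimate (a sig T K : R) (w : point -> R) : Prop :=
  (forall z, cyl T z -> `|w z| <= K) /\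
  (forall z z' (del : R), cyl T z -> cyl T z' -> 0 <= del ->
    (forall j, `|z.2 ord0 j - z'.2 ord0 j| <= del) ->
    `|w z - w z'| <= K * (`|z.1 - z'.1| `^ (sig * a / 2) + del `^ sig)).

(** All constants are chosen before [T], [M], [Kw] and [w]. In particular [N] is free of the sup
    bound [Kw], as the passage to the limit demands. *)
Lemma apriori_holder (a p : R) : 0 < a < 1 -> 1 < p ->
  let sig := 1 - (d%:R + 2 / a) / p in 0 < sig ->
  exists2 N : R, 0 <= N & forall (T M Kw : R) (w : point -> R),
    0 < T -> 0 <= M -> hbound a p T M w ->
    (forall z, cyl T z -> {for z, continuous w}) ->
    (forall z, cyl T z -> `|w z| <= Kw) -> holder_estimate a sig T (N * M) w.
Proof.
move=> a01 p1 sig sig0; have /andP[a0 a1] := a01.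
have p0 : 0 < p by exact: lt_trans p1.
pose q := p / (p - 1).
have p10 : 0 < p - 1 by rewrite subr_gt0.
have q1 : 1 < q by rewrite /q ltr_pdivlMr// mul1r ltrBlDr ltrDl.
have pq : p^-1 + q^-1 = 1 by rewrite /q; field; rewrite gt_eqF//= gt_eqF.
have dap : d%:R + 2 / a < p.
  by move: sig0; rewrite /sig subr_gt0 ltr_pdivrMr// mul1r.
(* Positivity of [sig] even gives [a p > 2]. The weaker bound yields both [a - p^-1 >= 0] and
   [(a - 1) q > -1]. *)
have ap : 1 < a * p.
  have : 2 / a < p by apply: le_lt_trans dap; rewrite lerDr.
  by rewrite ltr_pdivrMr// mulrC => h; apply: lt_trans h; rewrite ltr1n.
have kap0 : 0 <= a - p^-1.
  by rewrite subr_ge0 -[p^-1]mul1r ler_pdivrMr// ltW.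
have aq : -1 < (a - 1) * q.
  rewrite /q mulrA ltr_pdivlMr//; move: ap => h; nra.
have [C C0 hC] := @slice_holder R d a p q a01 p1 q1 pq aq.
have [B [B1 bB b'B]] := @bump_bounded R.
pose CB : R := (2 * B) ^+ d * 2 `^ (d%:R / q).
pose ct : R := C * (CB * (1 + 2 * d%:R)).
pose cs : R := B * (2 * ct * 4 `^ (a - p^-1)) + B * CB.
pose c1 : R := B * (ct * 4 `^ (a - p^-1)) + B * CB.
pose x2 : R := 2 `^ (- sig).
have x21 : 0 < 1 - x2.
  rewrite subr_gt0 /x2 powRN invf_lt1 ?powR_gt0//.
  apply: (@le_lt_trans _ _ ((1 : R) `^ sig)); first by rewrite powR1.
  by apply: gt0_ltr_powR; rewrite ?nnegrE ?ltr1n.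
have B0 : 0 <= B by exact: le_trans B1.
have CB0 : 0 <= CB by rewrite mulr_ge0 ?powR_ge0// exprn_ge0// mulr_ge0.
have ct0 : 0 <= ct by rewrite mulr_ge0 ?(ltW C0)// mulr_ge0// addr_ge0// mulr_ge0.
have cs0 : 0 <= cs.
  by rewrite addr_ge0// mulr_ge0// mulr_ge0 ?powR_ge0// mulr_ge0.
have c10 : 0 <= c1 by rewrite addr_ge0// mulr_ge0// mulr_ge0 ?powR_ge0.
pose D := d%:R * cs / (1 - x2).
have D0 : 0 <= D by rewrite divr_ge0 ?(ltW x21)// mulr_ge0.
exists (2 * (c1 + D) + ct + d%:R * cs).
  by rewrite !addr_ge0// mulr_ge0// addr_ge0.
move=> T M Kw w T0 M0 wH cw wK.
have shift (c c' r r' : 'I_d -> R) (rho : R) (i : 'I_d) :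
  0 < rho -> rho <= 1 -> (forall j, rho / 2 <= r j <= rho) ->
  (forall j, rho / 2 <= r' j <= rho) -> `|c i - c' i| <= rho ->
  (forall j, j != i -> c j = c' j /\ r j = r' j) ->
  forall t, 0 < t < T -> `|slice T w (tensor (kers c r)) t - slice T w (tensor (kers c' r')) t| <= cs * M * rho `^ sig.
  move=> rho0 rho1 rr rr' cc off t tT.
  exact: (mollified_shift a01 p1 q1 pq kap0 B1 bB b'B C0 hC T0 M0 wH cw wK rho0 rho1 rr rr' cc off tT).
have time (c r : 'I_d -> R) (rho : R) :
  0 < rho -> rho <= 1 -> (forall j, rho / 2 <= r j <= rho) ->
  forall s t, s != 0 -> s < t -> 0 < t < T ->
  `|slice T w (tensor (kers c r)) t - slice T w (tensor (kers c r)) s| <=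
  ct * M * rho `^ (- (1 + d%:R / p)) * (t - s) `^ (a - p^-1).
  move=> rho0 rho1 rr s t sn0 st tT.
  exact: (mollified_time q1 pq B1 bB b'B C0 hC T0 M0 wH cw wK c rho0 rr rho1 sn0 st tT).
have sup (c : 'I_d -> R) t : 0 < t < T -> `|slice T w (tensor (kers c (fun=> 1))) t| <= c1 * M.
  move=> tT.
  exact: (mollified_bound p1 q1 pq kap0 B1 bB b'B C0 hC T0 M0 wH cw wK c tT).
have csM : 0 <= cs * M by rewrite mulr_ge0.
have ctM : 0 <= ct * M by rewrite mulr_ge0.
have DM : d%:R * (cs * M) / (1 - x2) = D * M by rewrite /D; ring.
have e0E : (a - p^-1) * (2 / a) + - (1 + d%:R / p) = sig.
  by rewrite /sig; field; rewrite !gt_eqF.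
split=> [z zT|z z' del zT z'T del0 zz'].
  apply: (le_trans (sup_bound T0 wH cw wK sig0 csM shift sup zT)).
  rewrite -/x2 DM -mulrDl ler_wpM2r//.
  have E0 : 0 <= ct + d%:R * cs by rewrite addr_ge0// mulr_ge0.
  rewrite -[leRHS]addrA; apply: ler_wpDr => //.
  by rewrite mulr_natl mulr2n lerDl addr_ge0.
have NM : (2 * (c1 + D) + ct + d%:R * cs) * M = 2 * (c1 * M + D * M) + ct * M + d%:R * (cs * M) by ring.
rewrite NM -DM.
have H y y' := @holder_bound_lt R d a p T M Kw w T0 wH cw wK sig (cs * M) sig0 csM shift
  (ct * M) (c1 * M) _ _ ctM kap0 a0 e0E time sup y y' del.
have [st|st] := leP z'.1 z.1; first exact: H.
rewrite distrC [`|z.1 - _|]distrC; apply: H => //; first exact: ltW.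
by move=> j; rewrite distrC.
Qed.

End apriori.

(** * Linearity of the norms *)

Section rounding.
Context {R : realType} {d : nat}.
Local Notation point := (R * 'rV[R]_d)%type.
Local Notation mpoint := (measurableTypeR R * 'rV[R]_d)%type.
Local Notation cyl T := (cylinder T (@setT 'rV[R]_d)).

Definition lattice (n : nat) (k : int) : R := k%:~R / n.+1%:R.

Definition lattice_pt n (k : int * {ffun 'I_d -> int}) : point :=
  (lattice n k.1, \row_j lattice n (k.2 j)).

Definition cell n (z : point) : int * {ffun 'I_d -> int} :=
  (Num.floor (n.+1%:R * z.1), [ffun j => Num.floor (n.+1%:R * z.2 ord0 j)]).

Lemma lattice_dist n (y : R) : `|y - lattice n (Num.floor (n.+1%:R * y))| <= n.+1%:R^-1.
Proof.
have n0 : 0 < n.+1%:R :> R by rewrite ltr0n.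
have /andP[h1 h2] := floor_itv (n.+1%:R * y).
rewrite intrD in h2.
have e : y - lattice n (Num.floor (n.+1%:R * y)) =
    (n.+1%:R * y - (Num.floor (n.+1%:R * y))%:~R) / n.+1%:R.
  by rewrite /lattice; field; rewrite gt_eqF.
rewrite e ger0_norm; last by rewrite divr_ge0 ?subr_ge0// ltW.
by rewrite -[leRHS]mul1r ler_wpM2r ?invr_ge0 ?(ltW n0)// lerBlDl ltW.
Qed.

Lemma measurable_floor_eq n (k : int) : measurable [set y : R | Num.floor (n.+1%:R * y) = k].
Proof.
rewrite (_ : mkset _ = (fun y : R => n.+1%:R * y) @^-1` `[k%:~R, (k + 1)%:~R[).
  rewrite -[X in measurable X]setTI.
  have mf : measurable_fun [set: R] (fun y : R => n.+1%:R * y) by exact: measurable_funM.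
  by apply: mf => //; exact: measurable_itv.
apply/seteqP; split => y /=; rewrite in_itv/=.
  by move=> <-; exact: floor_itv.
exact: floor_def.
Qed.

Lemma measurable_cell n k : measurable (cell n @^-1` [set k] : set mpoint).
Proof.
case: k => k kk.
rewrite (_ : _ @^-1` _ = (fun z : mpoint => z.1) @^-1` [set y : R | Num.floor (n.+1%:R * y) = k] `&`
  \bigcap_(j in [set: 'I_d]) (fun z : mpoint => z.2 ord0 j) @^-1` [set y : R | Num.floor (n.+1%:R * y) = kk j]).
  apply: measurableI.
    rewrite -[X in measurable X]setTI; apply: (@measurable_fst _ _ (measurableTypeR R) 'rV[R]_d) => //.
    exact: measurable_floor_eq.
  apply: fin_bigcap_measurable => // j _; rewrite -[X in measurable X]setTI.
  have mj : measurable_fun [set: mpoint] (fun z : mpoint => z.2 ord0 j).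
    exact: (measurableT_comp (measurable_rV_coord j) measurable_snd).
  by apply: mj => //; exact: measurable_floor_eq.
apply/seteqP; split => -[t x] /=.
  by case=> <- <-; split => // j _ /=; rewrite ffunE.
case=> h0 h; rewrite /cell /= h0; congr pair; apply/ffunP => j; rewrite ffunE; exact: h.
Qed.

Lemma cvg_lattice (z : point) : lattice_pt n (cell n z) @[n --> \oo] --> z.
Proof.
case: z => t x.
have near_small (e : R) : 0 < e -> \forall n \near \oo, n.+1%:R^-1 < e.
  by move=> e0; exact: (cvgr_lt _ cvg_harmonic).
have c1 : lattice n (Num.floor (n.+1%:R * t)) @[n --> \oo] --> t.
  apply/cvgrPdist_lt => e e0; near=> n; apply: (le_lt_trans (lattice_dist n t)).
  by near: n; exact: near_small.
have c2 : (\row_j lattice n ([ffun j => Num.floor (n.+1%:R * x ord0 j)] j)) @[n --> \oo] --> x.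
  apply/cvg_ballP => e e0; near=> n; split => // i j; rewrite mxE ffunE ord1.
  apply: (le_lt_trans (lattice_dist n (x ord0 j))).
  by near: n; exact: near_small.
exact: (cvg_pair c1 c2).
Unshelve. all: by end_near. Qed.

(** The sigma-algebra is generated by the coordinates, so the function is evaluated at rounded
    points: this takes countably many values on measurable cells and converges by continuity.
    Rounded points may leave the cylinder; continuity at each of its points is enough. *)
Lemma continuous_cyl_measurable (T : R) (f : point -> R) :
  (forall z, cyl T z -> {for z, continuous f}) ->
  measurable_fun (cyl T : set mpoint) f.
Proof.
move=> cf.
apply: (@measurable_fun_cvg _ mpoint R (cyl T) (fun n z => f (lattice_pt n (cell n z)))).
  move=> n; apply: measurable_funTS => _ Y mY; rewrite setTI.
  rewrite (_ : _ @^-1` _ = \bigcup_(k in [set: int * {ffun 'I_d -> int}])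
      (if pselect (Y (f (lattice_pt n k))) then cell n @^-1` [set k] else set0)).
    apply: countable_bigcupT_measurable; first exact: countableP.
    by move=> k; case: pselect => /= [_|//]; exact: measurable_cell.
  apply/seteqP; split => z /=.
    by move=> Yz; exists (cell n z) => //; case: pselect.
  by case=> k _; case: pselect => //= Yk ->.
move=> z zT; apply: continuous_cvg; first exact: cf.
exact: cvg_lattice.
Qed.

End rounding.

(** * [L_p] functions on the cylinder and linearity of the weak gradient *)

Section Lp_functions.
Context {R : realType} {d : nat}.
Local Notation lam := (@lebesgue_measure R).
Local Notation mu := (lebesgue_rV R d).
Local Notation m := (lebesgue_tx R d).
Local Notation point := (R * 'rV[R]_d)%type.
Local Notation mpoint := (measurableTypeR R * 'rV[R]_d)%type.
Local Notation cyl T := (cylinder T (@setT 'rV[R]_d)).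
Local Notation LpN p T f := (Lp_norm p T (@setT 'rV[R]_d) f).
Variables (p T : R).
Hypothesis p1 : 1 < p.
Implicit Types (f g u : point -> R).

Let p0 : 0 < p. Proof. exact: lt_trans p1. Qed.

Lemma Lp_cylP f : Lp_cyl p T setT f <->
  measurable_fun [set: mpoint] (f \_ (cyl T)) /\ (LpN p T f < +oo)%E.
Proof.
rewrite /Lp_cyl /Lp_norm; split.
  by rewrite inE => /andP[/set_mem mf /set_mem].
by move=> [mf ff]; rewrite inE; apply/andP; split; apply: mem_set.
Qed.

Lemma Lp_normE f : LpN p T f = ((\int[m]_z (`|(f \_ (cyl T)) z| `^ p)%:E) `^ p^-1)%E.
Proof. by rewrite /Lp_norm unlock. Qed.

Lemma Lp_norm_le f g : measurable_fun [set: mpoint] (f \_ (cyl T)) ->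
  measurable_fun [set: mpoint] (g \_ (cyl T)) ->
  (forall z, cyl T z -> `|f z| <= `|g z|) -> (LpN p T f <= LpN p T g)%E.
Proof.
move=> mf mg fg; rewrite !Lp_normE.
have mp (h : point -> R) : measurable_fun [set: mpoint] (h \_ (cyl T)) ->
    measurable_fun [set: mpoint] (fun z => (`|(h \_ (cyl T)) z| `^ p)%:E).
  move=> mh; apply/measurable_EFinP; apply: (measurableT_comp (measurable_powR p)).
  exact: measurableT_comp.
apply: gt0_ler_poweR; rewrite ?invr_ge0 ?(ltW p0) ?in_itv/= ?leey ?andbT//.
- by apply: integral_ge0 => z _; rewrite lee_fin powR_ge0.
- by apply: integral_ge0 => z _; rewrite lee_fin powR_ge0.
apply: ge0_le_integral => //; [exact: mp|exact: mp|].
move=> z _; rewrite lee_fin; apply: ge0_ler_powR; rewrite ?nnegrE ?(ltW p0)//.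
by rewrite !patchE; case: ifPn => // /set_mem zT; exact: fg.
Qed.

Lemma restrict_lin f g (s : R) :
  (fun z => f z + s * g z) \_ (cyl T) = (f \_ (cyl T)) \+ (fun z => s * (g \_ (cyl T)) z).
Proof.
by apply/funext => z; rewrite /= !patchE; case: ifPn; rewrite ?mulr0 ?addr0.
Qed.

(** Minkowski's inequality; the sign [s] of modulus 1 treats sums and differences in one statement,
    here and in the lemmas built on it. *)
Lemma Lp_norm_lin f g (s : R) : `|s| = 1 ->
  measurable_fun [set: mpoint] (f \_ (cyl T)) ->
  measurable_fun [set: mpoint] (g \_ (cyl T)) ->
  (LpN p T (fun z => (f z + s * g z)%R) <= LpN p T f + LpN p T g)%E.
Proof.
move=> s1 mf mg; rewrite {1}/Lp_norm restrict_lin.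
have msg : measurable_fun [set: mpoint] (fun z => s * (g \_ (cyl T)) z).
  exact: measurable_funM.
apply: (le_trans (minkowski_EFin _ mf msg (ltW p1))).
rewrite /Lp_norm leeD2l//.
rewrite -Lnorm_abse -[leRHS]Lnorm_abse le_eqVlt; apply/orP; left; apply/eqP.
by apply: eq_Lnorm => z /=; rewrite normrM s1 mul1r.
Qed.

Lemma Lp_cyl_lin f g (s : R) : `|s| = 1 -> Lp_cyl p T setT f -> Lp_cyl p T setT g ->
  Lp_cyl p T setT (fun z => f z + s * g z).
Proof.
move=> s1 /Lp_cylP[mf ff] /Lp_cylP[mg fg]; apply/Lp_cylP; split.
  by rewrite restrict_lin; apply: measurable_funD => //; exact: measurable_funM.
by apply: (le_lt_trans (Lp_norm_lin s1 mf mg)); rewrite lte_add_pinfty.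
Qed.

Lemma open_cylinder : open (cyl T : set point).
Proof.
rewrite openE => -[t x] [/= tT _].
exists (`]0, T[%classic, setT); last by move=> [t' x'] [].
by split; [exact: near_in_itvoo tT|exact: filterT].
Qed.

Lemma coord_le_norm (x : 'rV[R]_d) j : `|x ord0 j| <= `|x|.
Proof.
rewrite [leRHS]/Num.Def.normr/= mx_normrE.
exact: (@le_bigmax _ _ _ _ (fun ij : 'I_1 * 'I_d => `|x ij.1 ij.2|) (ord0, j)).
Qed.

(** [psi] is bounded on its compact support, which lies in a box; [u] is integrable on that box over
    time []0, T]] by Hoelder's inequality against indicators. *)
Lemma integrable_Lp_mul u (psi : point -> R) (K : set point) :
  0 < T -> Lp_cyl p T setT u -> (forall z, cyl T z -> {for z, continuous psi}) ->
  compact K -> K `<=` cyl T -> (forall z, cyl T z -> ~ K z -> psi z = 0) ->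
  m.-integrable (cyl T) (EFin \o (fun z => u z * psi z)).
Proof.
move=> T0 up cpsi cK KT psi0.
have mc := measurable_cylinder (d := d) T.
have [B B0 psiB] : exists2 B : R, 0 <= B & forall z, cyl T z -> `|psi z| <= B.
  have cpK : compact (psi @` K).
    apply: continuous_compact => //; apply: continuous_in_subspaceT => z /set_mem Kz.
    exact/cpsi/KT.
  have [M [_ HM]] := compact_bounded cpK.
  exists (`|M| + 1) => [|z zT]; first by rewrite addr_ge0.
  have [Kz|Kz] := pselect (K z); last by rewrite psi0// normr0 addr_ge0.
  apply: HM; last by exists z.
  by rewrite (le_lt_trans (ler_norm M))// ltrDl.
have [b b0 Kb] : exists2 b : R, 0 <= b & forall z, K z -> forall j, -b <= z.2 ord0 j <= b.
  have [M [_ HM]] := compact_bounded cK.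
  exists (`|M| + 1) => [|z Kz j]; first by rewrite addr_ge0.
  rewrite -ler_norml (le_trans (coord_le_norm _ _))//.
  have : `|z| <= `|M| + 1 by apply: HM => //; rewrite (le_lt_trans (ler_norm M))// ltrDl.
  by apply: le_trans; rewrite prod_normE le_max lexx orbT.
pose q := p / (p - 1).
have p10 : 0 < p - 1 by rewrite subr_gt0.
have q0 : 0 < q by rewrite divr_gt0.
have pq : p^-1 + q^-1 = 1 by rewrite /q; field; rewrite gt_eqF//= gt_eqF.
have [mu_ uoo] := (Lp_cylP u).1 up.
have uM : (LpN p T u <= (fine (LpN p T u))%:E)%E.
  by rewrite fineK// ge0_fin_numE// Lnorm_ge0.
have M0 : 0 <= fine (LpN p T u) by rewrite fine_ge0// Lnorm_ge0.
pose k : R -> R := \1_(`]0%R, T]%classic).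
pose E : 'rV[R]_d -> R := \1_(box (fun=> - b) (fun=> b)).
have mE : measurable_fun setT E by apply: measurable_indic; exact: measurable_box.
have kK : (\int[lam]_t (`|k t| `^ q * (0 < t)%R%:R)%:E <= ((T `^ q^-1) `^ q)%:E)%E.
  rewrite -powRrM mulVf ?gt_eqF// powRr1 ?(ltW T0)//.
  rewrite [leLHS](_ : _ = \int[lam]_t (k t)%:E)%E; last first.
    apply: eq_integral => x _; congr EFin; rewrite /k indicE.
    case: (boolP (x \in _)) => [|_]; last by rewrite normr0 powR0 ?gt_eqF// mul0r.
    by rewrite inE/= in_itv/= => /andP[-> _]; rewrite normr1 powR1 mulr1.
  rewrite /k integral_indic//= setIT lebesgue_measure_itv/= lte_fin T0.
  by rewrite sube0.
have V0 : 0 <= (b - - b) ^+ d by rewrite exprn_ge0// opprK addr_ge0.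
have EL : (\int[mu]_x (`|E x| `^ q)%:E <= ((((b - - b) ^+ d) `^ q^-1) `^ q)%:E)%E.
  rewrite -powRrM mulVf ?gt_eqF// powRr1//.
  rewrite [leLHS](_ : _ = \int[mu]_x (E x)%:E)%E; last first.
    apply: eq_integral => x _; congr EFin; rewrite /E indicE.
    by case: (x \in _); rewrite ?normr1 ?powR1// normr0 powR0 ?gt_eqF.
  rewrite /E integral_indic//= ?setIT; last exact: measurable_box.
  rewrite integral_box; last by move=> i; rewrite (le_trans _ b0)// oppr_le0.
  by rewrite prodr_const card_ord.
have [iu _] := hoelder_cyl p0 q0 pq M0 (powR_ge0 T q^-1) (powR_ge0 ((b - - b) ^+ d) q^-1) up uM
  (measurable_indic (measurable_itv _)) mE kK EL.
apply: (le_integrable mc _ _ (integrableZl mc B iu)).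
  apply/measurable_EFinP; apply: measurable_funM; last exact: continuous_cyl_measurable.
  exact: ((measurable_restrictT _ mc).2 mu_).
move=> [t x] zT; rewrite /= lee_fin normrM [leRHS]normrM normrM (ger0_norm B0).
rewrite mulrCA ler_wpM2l//.
have [Kz|Kz] := pselect (K (t, x)); last by rewrite psi0// normr0 mulr_ge0.
rewrite normrM /k /E !indicE !mem_set ?normr1 ?mulr1; first exact: psiB.
  by move=> j; have := Kb _ Kz j.
by move: zT => [/= + _]; rewrite !in_itv/= => /andP[-> /ltW].
Qed.

Lemma int_cyl_lin f1 f2 (h : point -> R) (s : R) :
  m.-integrable (cyl T) (EFin \o (fun z => f1 z * h z)) ->
  m.-integrable (cyl T) (EFin \o (fun z => f2 z * h z)) ->
  int_cyl T setT (fun z => (f1 z + s * f2 z) * h z) =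
  int_cyl T setT (fun z => f1 z * h z) + s * int_cyl T setT (fun z => f2 z * h z).
Proof.
move=> i1 i2; have mc := measurable_cylinder (d := d) T.
have i2s : m.-integrable (cyl T) (EFin \o (fun z => s * (f2 z * h z))).
  exact: (integrableZl mc s i2).
transitivity (\int[m]_(z in cyl T) (f1 z * h z) + \int[m]_(z in cyl T) (s * (f2 z * h z))).
  rewrite -(RintegralD mc i1 i2s); apply: eq_Rintegral => z _.
  by rewrite mulrDl mulrA.
by congr (_ + _); exact: (@RintegralZl _ _ _ m (cyl T) _ s mc i2).
Qed.

(** [Dx] is a meaningless default unless a gradient exists, so the norm of [un - u] controls
    something only once this difference is known to have one. General test functions are treated, as
    [is_Lp_gradient] demands. *)
Lemma weak_dx_lin i u1 u2 g1 g2 (s : R) : 0 < T ->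
  Lp_cyl p T setT u1 -> Lp_cyl p T setT u2 -> Lp_cyl p T setT g1 -> Lp_cyl p T setT g2 ->
  is_weak_dx T setT i u1 g1 -> is_weak_dx T setT i u2 g2 ->
  is_weak_dx T setT i (fun z => u1 z + s * u2 z) (fun z => g1 z + s * g2 z).
Proof.
move=> T0 u1p u2p g1p g2p h1 h2 phi phiT.
have mc := measurable_cylinder (d := d) T.
have [[U [F [oU TU kF phiF]]] [K [cK KT phi0]]] := phiT.
(* [phi] agrees with the smooth [F] on the cylinder only; since the cylinder is open, continuity and
   derivatives carry over. *)
have nearF z : cyl T z -> \forall y \near z, phi y = F y.
  move=> zT; have : nbhs z (cyl T) by apply: open_nbhs_nbhs; split => //; exact: open_cylinder.
  by apply: filterS => y yT; apply: phiF; rewrite inE.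
have Fc z : cyl T z -> {for z, continuous F}.
  by move=> zT; have [h _] := kF 0%N; exact/h/TU.
have dFc z : cyl T z -> {for z, continuous (dx i F)}.
  by move=> zT; have [_ /(_ (0, delta_mx ord0 i))[_ [h _]]] := kF 1%N; exact/h/TU.
have phic z : cyl T z -> {for z, continuous phi}.
  move=> zT; have := Fc z zT; rewrite /prop_for /continuous_at -phiF ?inE//.
  by apply: cvg_trans; apply: near_eq_cvg; apply: filterS (nearF z zT).
have dxE z : cyl T z -> dx i phi z = dx i F z.
  by move=> zT; apply: near_eq_derive; exact: nearF.
have dxc z : cyl T z -> {for z, continuous (dx i phi)}.
  move=> zT; have := dFc z zT; rewrite /prop_for /continuous_at -dxE//.
  apply: cvg_trans; apply: near_eq_cvg.
  have : nbhs z (cyl T) by apply: open_nbhs_nbhs; split => //; exact: open_cylinder.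
  by apply: filterS => y yT; rewrite dxE.
have dx0 z : cyl T z -> ~ K z -> dx i phi z = 0.
  move=> zT Kz; rewrite /dx (@near_eq_derive _ _ _ _ (cst 0)) ?derive_cst//.
  have : nbhs z (~` K).
    apply: open_nbhs_nbhs; split => //; apply: closed_openC.
    by apply: compact_closed => //; exact: norm_hausdorff.
  by apply: filterS => y; exact: phi0.
have iu u : Lp_cyl p T setT u -> m.-integrable (cyl T) (EFin \o (fun z => u z * dx i phi z)).
  by move=> up; exact: (integrable_Lp_mul T0 up dxc cK KT dx0).
have ig g : Lp_cyl p T setT g -> m.-integrable (cyl T) (EFin \o (fun z => g z * phi z)).
  by move=> gp; apply: (integrable_Lp_mul T0 gp phic cK KT) => z _; exact: phi0.
rewrite !int_cyl_lin; [|exact: ig|exact: ig|exact: iu|exact: iu].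
by rewrite h1// h2// mulrN opprD.
Qed.

End Lp_functions.

Section sigma_finite_product.
Context d1 d2 (T1 : measurableType d1) (T2 : measurableType d2) (R : realType).
Variables (m1 : {sigma_finite_measure set T1 -> \bar R})
  (m2 : {sigma_finite_measure set T2 -> \bar R}).
(** A named copy of the product measure that carries its sigma-finiteness, so that Fubini can be
    used once more for the triple of times and space. *)
Definition prod_sf : set (T1 * T2) -> \bar R := (m1 \x m2)%E.
HB.instance Definition _ := Measure.on prod_sf.
Let sf : sigma_finite setT prod_sf.
Proof.
have /sigma_finiteP[F [TF ndF Foo]] := sigma_finiteT m1.
have /sigma_finiteP[G [TG ndG Goo]] := sigma_finiteT m2.
exists (fun n => F n `*` G n).
  rewrite -setXTT TF TG predeqE => -[x y]; split.
    move=> [/= [n _ Fnx] [k _ Gky]]; exists (maxn n k) => //; split.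
    - by move: x Fnx; exact/subsetPset/ndF/leq_maxl.
    - by move: y Gky; exact/subsetPset/ndG/leq_maxr.
  by move=> [n _ []/= ? ?]; split; exists n.
move=> k; have [? ?] := Foo k; have [? ?] := Goo k.
split; first exact: measurableX.
by rewrite /prod_sf product_measure1E// lte_mul_pinfty// ge0_fin_numE.
Qed.
HB.instance Definition _ := Measure_isSigmaFinite.Build _ _ _ prod_sf sf.
Definition sfprod : {sigma_finite_measure set (T1 * T2)%type -> \bar R} := prod_sf.
End sigma_finite_product.

(** * Pairing the fractional integral of an [L_p] function with product weights *)

Section frac_pairing.
Context {R : realType} {d : nat}.
Local Notation lam := (@lebesgue_measure R).
Local Notation mu := (lebesgue_rV R d).
Local Notation m := (@lebesgue_measure R \x lebesgue_rV R d)%E.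
Local Notation point := (R * 'rV[R]_d)%type.
Local Notation mpoint := (measurableTypeR R * 'rV[R]_d)%type.
Local Notation cyl T := (cylinder T (@setT 'rV[R]_d)).
Variables (a T Th : R) (theta : R -> R) (psi : 'rV[R]_d -> R).
Hypotheses (a01 : 0 < a < 1) (T0 : 0 < T).
Hypotheses (mth : measurable_fun [set: R] theta) (mpsi : measurable_fun setT psi).
Hypotheses (thB : forall t, `|theta t| <= Th) (th0 : forall t, ~~ (0 < t < T) -> theta t = 0).

Let Th0 : 0 <= Th. Proof. exact: le_trans (normr_ge0 _) (thB 0). Qed.

(** For [w] merely in [L_p] the integral in [frac_int] may fail to converge at some points, so
    [frac_int] need not be linear pointwise. This integrand in time, space and the earlier time is
    linear in [w] everywhere. *)
Definition frac_kernel (w : point -> R) (zs : mpoint * measurableTypeR R) : R :=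
  theta zs.1.1 * psi zs.1.2 * (Gamma_fun (1 - a))^-1 *
  (ppow (- a) (zs.1.1 - zs.2) * (w \_ (cyl T)) (zs.2, zs.1.2)).

Let ker_int s : 0 <= s ->
  (\int[lam]_t (`|theta t| * ppow (- a) (t - s))%:E <= (Th * (T `^ (1 - a) / (1 - a)))%:E)%E.
Proof.
move=> s0; have /andP[a0 a1] := a01.
have mp : measurable_fun [set: R] (fun y : R => ppow (- a) y * (y <= T)%R%:R).
  apply: measurable_funM; first exact: measurable_ppow.
  by apply: measurable_bool_natr; exact: measurable_fun_ler.
have mps : measurable_fun [set: R] (fun t : R => ppow (- a) (t - s) * (t - s <= T)%R%:R).
  apply: measurable_funM; first by apply: measurable_ppow_comp; exact: measurable_funB.
  by apply: measurable_bool_natr; apply: measurable_fun_ler => //; exact: measurable_funB.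
apply: (@le_trans _ _ (\int[lam]_t (Th * (ppow (- a) (t - s) * (t - s <= T)%R%:R))%:E)%E).
  apply: ge0_le_integral => //.
  - by move=> t _; rewrite lee_fin mulr_ge0 ?ppow_ge0.
  - apply/measurable_EFinP; apply: measurable_funM; first exact: measurableT_comp.
    by apply: measurable_ppow_comp; exact: measurable_funB.
  - by apply/measurable_EFinP; exact: measurable_funM.
  - move=> t _; rewrite lee_fin.
    have [tT|tT] := boolP (0 < t < T); last first.
      by rewrite th0// normr0 mul0r mulr_ge0// mulr_ge0 ?ppow_ge0.
    rewrite (_ : t - s <= T); last by move: tT s0 => /andP[_ ?] ?; lra.
    by rewrite mulr1 ler_wpM2r ?ppow_ge0.
under eq_integral do rewrite EFinM.
rewrite ge0_integralZl//; last 2 first.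
- exact/measurable_EFinP.
- by move=> t _; rewrite lee_fin mulr_ge0 ?ppow_ge0.
have := @ge0_integral_affine R 1 (- s) (oner_neq0 _) (fun y => (ppow (- a) y * (y <= T)%R%:R)%:E).
rewrite normr1 invr1 mul1e => h.
have -> : (\int[lam]_t (ppow (- a) (t - s) * (t - s <= T)%R%:R)%:E =
    \int[lam]_x (ppow (- a) x * (x <= T)%R%:R)%:E)%E.
  rewrite -h; first by apply: eq_integral => t _; rewrite mul1r.
  - exact/measurable_EFinP.
  - by move=> x; rewrite lee_fin mulr_ge0 ?ppow_ge0.
rewrite integral_ppow//; last by rewrite ltrN2.
by rewrite -EFinM addrC.
Qed.

Section one.
Variable w : point -> R.
Hypothesis mw : measurable_fun [set: mpoint] (w \_ (cyl T)).
Hypothesis iw : m.-integrable setT (EFin \o (fun z : mpoint => psi z.2 * (w \_ (cyl T)) z)).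

Let m11 : measurable_fun setT (fun zs : mpoint * measurableTypeR R => zs.1.1).
Proof. exact: (measurableT_comp measurable_fst measurable_fst). Qed.

Let m12 : measurable_fun setT (fun zs : mpoint * measurableTypeR R => zs.1.2).
Proof. exact: (measurableT_comp measurable_snd measurable_fst). Qed.

Let mabel : measurable_fun setT (fun zs : mpoint * measurableTypeR R =>
  ppow (- a) (zs.1.1 - zs.2) * (w \_ (cyl T)) (zs.2, zs.1.2)).
Proof.
apply: measurable_funM.
  by apply: measurable_ppow_comp; apply: measurable_funB => //; exact: measurable_snd.
apply: (measurableT_comp mw).
by apply: measurable_fun_pair => //; exact: measurable_snd.
Qed.

Let mcoef : measurable_fun setT (fun z : mpoint => theta z.1 * psi z.2 * (Gamma_fun (1 - a))^-1).
Proof.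
apply: measurable_funM => //; apply: measurable_funM.
  exact: (measurableT_comp mth measurable_fst).
exact: (measurableT_comp mpsi measurable_snd).
Qed.

Let mK : measurable_fun setT (frac_kernel w).
Proof.
apply: measurable_funM => //.
exact: (measurableT_comp mcoef measurable_fst).
Qed.

Let mm : {sigma_finite_measure set mpoint -> \bar R} :=
  sfprod (@lebesgue_measure R) (lebesgue_rV R d).

(** Integrate in the later time first: [ker_int] bounds that integral uniformly in the earlier time
    [s], and the integrable function [psi w] remains. *)
Lemma integrable_frac_kernel :
  (mm \x @lebesgue_measure R)%E.-integrable setT (EFin \o frac_kernel w).
Proof.
have mE : measurable_fun setT (EFin \o frac_kernel w) by apply/measurable_EFinP; exact: mK.
apply: (@integrable21ltyP _ _ _ _ R mm (@lebesgue_measure R) _ mE).2.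
pose G := `|(Gamma_fun (1 - a))^-1|; pose C := G * (Th * (T `^ (1 - a) / (1 - a))).
have G0 : 0 <= G by exact: normr_ge0.
have C0 : 0 <= C.
  rewrite mulr_ge0// mulr_ge0// divr_ge0 ?powR_ge0//.
  by have /andP[_ a1] := a01; rewrite subr_ge0 ltW.
have mf : measurable_fun setT (fun z : mpoint => `|psi z.2 * (w \_ (cyl T)) z|).
  apply: measurableT_comp => //; apply: measurable_funM => //.
  exact: (measurableT_comp mpsi measurable_snd).
have mfs s : measurable_fun setT (fun x => `|psi x * (w \_ (cyl T)) (s, x)|).
  exact: (measurableT_comp mf (@measurable_pair1 _ _ _ _ s)).
have := (integrable12ltyP (@lebesgue_measure R) mu ((measurable_int _ iw))).1 iw.
rewrite -/mm => fin.
have I0 s : (0 <= \int[mu]_x (`|psi x * (w \_ (cyl T)) (s, x)|)%:E)%E.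
  by apply: integral_ge0 => x _; rewrite lee_fin.
have mI : measurable_fun setT (fun s : measurableTypeR R => \int[mu]_x (`|psi x * (w \_ (cyl T)) (s, x)|)%:E)%E.
  have mfe : measurable_fun setT (fun z : mpoint => (`|psi z.2 * (w \_ (cyl T)) z|)%:E) by apply/measurable_EFinP.
  by have := @measurable_fun_fubini_tonelli_F _ _ _ _ R mu _ mfe; apply => z; rewrite lee_fin.
apply: (@le_lt_trans _ _ (\int[lam]_s (C%:E * \int[mu]_x (`|psi x * (w \_ (cyl T)) (s, x)|)%:E))%E); last first.
  by rewrite ge0_integralZl// lte_mul_pinfty.
have mKs s : measurable_fun setT (fun z : mpoint => `|frac_kernel w (z, s)|).
  apply: measurableT_comp => //.
  exact: (measurableT_comp mK (@measurable_pair2 _ _ _ _ s)).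
apply: ge0_le_integral => //.
- by move=> s _; apply: integral_ge0.
- have mKe : measurable_fun setT (fun zs : mpoint * measurableTypeR R => `|(frac_kernel w zs)%:E|%E).
    by apply: measurableT_comp.
  by have := @measurable_fun_fubini_tonelli_G _ _ _ _ R mm _ mKe; apply.
- by apply: emeasurable_funM.
move=> s _.
have [s0|s0] := leP 0 s; last first.
  rewrite [leLHS](_ : _ = 0%E); first by rewrite mule_ge0// lee_fin.
  rewrite -[RHS](integral0 mm setT); apply: eq_integral => z _.
  rewrite /= /frac_kernel/= restrict_notin ?mulr0 ?normr0// => -[/= + _].
  by rewrite in_itv/= => /andP[]; move: s0 => ? ?; lra.
pose A t := (`|theta t| * ppow (- a) (t - s))%:E.
pose Bx x := (`|psi x * (w \_ (cyl T)) (s, x)|)%:E.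
have A0 t : (0 <= A t)%E by rewrite lee_fin mulr_ge0 ?ppow_ge0.
have B0 x : (0 <= Bx x)%E by rewrite lee_fin.
have mA : measurable_fun [set: R] A.
  apply/measurable_EFinP; apply: measurable_funM; first exact: measurableT_comp.
  by apply: measurable_ppow_comp; exact: measurable_funB.
have mB : measurable_fun setT Bx by apply/measurable_EFinP.
have mAB : measurable_fun setT (fun z : mpoint => A z.1 * Bx z.2)%E.
  by apply: emeasurable_funM; [exact: (measurableT_comp mA)|exact: (measurableT_comp mB)].
rewrite [leLHS](_ : _ = \int[m]_z (G%:E * (A z.1 * Bx z.2)))%E; last first.
  apply: eq_integral => z _; rewrite /= /frac_kernel/= /A /Bx -!EFinM; congr EFin.
  rewrite !normrM (ger0_norm (ppow_ge0 _ _)) -/G; ring.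
rewrite ge0_integralZl//; last by move=> z _; rewrite mule_ge0.
rewrite /C EFinM -muleA; apply: lee_wpmul2l; first by rewrite lee_fin.
rewrite fubini_tonelli1//; last by move=> z; rewrite mule_ge0.
rewrite /fubini_F/=; under eq_integral do rewrite ge0_integralZl//.
rewrite ge0_integralZr//; last exact: I0.
by apply: lee_pmul; [exact: integral_ge0|exact: I0|exact: ker_int|exact: lexx].
Qed.

Lemma int_cyl_frac_int :
  int_cyl T setT (fun z => frac_int a w z * (theta z.1 * psi z.2)) =
  \int[(mm \x @lebesgue_measure R)%E]_zs frac_kernel w zs.
Proof.
have G0 : Gamma_fun (1 - a) != 0 by rewrite gt_eqF// Gamma_fun_gt0.
have iK := integrable_frac_kernel.
rewrite (Rintegral12 iK) int_cylE.
have mf (z : mpoint) : measurable_fun [set: measurableTypeR R]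
    (fun s : measurableTypeR R => ppow (- a) (z.1 - s) * (w \_ (cyl T)) (s, z.2)).
  exact: (measurableT_comp mabel (@measurable_pair1 _ _ _ _ z)).
have PE (z : mpoint) : ((fun z : point => frac_int a w z * (theta z.1 * psi z.2)) \_ (cyl T)) z =
    theta z.1 * psi z.2 * (Gamma_fun (1 - a))^-1 *
    \int[lam]_s (ppow (- a) (z.1 - s) * (w \_ (cyl T)) (s, z.2)).
  have [zT|zT] := pselect (cyl T z).
    by rewrite restrict_in// (frac_intE a w zT) /abel mulrC mulrA.
  rewrite restrict_notin// th0 ?mul0r//; apply/negP => zT'; apply: zT.
  by split => //=; rewrite in_itv.
rewrite /Rintegral; congr fine; apply: ae_eq_integral => //.
- apply/measurable_EFinP; rewrite (funext PE); apply: measurable_funM; first exact: mcoef.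
  exact: (measurable_fun_integral_section (@lebesgue_measure R) mabel).
- by apply/measurable_EFinP; exact: (measurable_fun_integral_section (@lebesgue_measure R) mK).
have := ae_integrable1 iK; apply: filterS => z iz _; rewrite PE; congr EFin.
rewrite -[RHS]/(\int[lam]_s frac_kernel w (z, s)).
set c := theta z.1 * psi z.2 * (Gamma_fun (1 - a))^-1.
have kE s : frac_kernel w (z, s) = c * (ppow (- a) (z.1 - s) * (w \_ (cyl T)) (s, z.2)) by [].
(* Almost everywhere the product with [c] is integrable in [s]; dividing by [c] recovers
   integrability of the Abel integrand, and for [c = 0] both sides vanish. *)
have [c0|c0] := eqVneq c 0.
  rewrite c0 mul0r; under eq_Rintegral do rewrite kE c0 mul0r.
  by rewrite /Rintegral integral0.
have i1 : lam.-integrable setT (EFin \o (fun s : measurableTypeR R =>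
    ppow (- a) (z.1 - s) * (w \_ (cyl T)) (s, z.2))).
  have := integrableZl measurableT c^-1 iz; apply: eq_integrable => // s _ /=.
  by rewrite -EFinM kE (mulKf c0).
exact: esym (@RintegralZl _ _ _ _ _ _ c measurableT i1).
Qed.

End one.
End frac_pairing.

(** * From the norm to [hbound], and closure of [hbound] under sums and differences *)

Section hbound_closure.
Context {R : realType} {d : nat}.
Local Notation lam := (@lebesgue_measure R).
Local Notation mu := (lebesgue_rV R d).
Local Notation m := (lebesgue_tx R d).
Local Notation point := (R * 'rV[R]_d)%type.
Local Notation mpoint := (measurableTypeR R * 'rV[R]_d)%type.
Local Notation cyl T := (cylinder T (@setT 'rV[R]_d)).
Local Notation LpN p T f := (Lp_norm p T (@setT 'rV[R]_d) f).
Variables (a p T : R).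
Hypotheses (a01 : 0 < a < 1) (p1 : 1 < p) (T0 : 0 < T).
Implicit Types (w f g : point -> R).

Lemma coord_le_eucl (x : 'I_d -> R) i : `|x i| <= eucl_norm x.
Proof.
rewrite -sqrtr_sqr /eucl_norm ler_wsqrtr// (bigD1 i)//= lerDl.
by apply: sumr_ge0 => j _; exact: sqr_ge0.
Qed.

Lemma eucl_norm_ge0 (x : 'I_d -> R) : 0 <= eucl_norm x.
Proof. exact: sqrtr_ge0. Qed.

Lemma Hm1_norm_ge0 w : (0 <= Hm1_norm p T setT (frac_Dt a T setT w))%E.
Proof.
apply: le_ereal_inf_tmp => _ [g [f [_ _ _ ->]]].
by rewrite adde_ge0 ?sume_ge0// => *; exact: Lnorm_ge0.
Qed.

(** The strict inequality leaves room to pick [g] and [f] that nearly attain the infimum in the dual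
    norm. *)
Lemma hbound_of_norm M w : Lp_cyl p T setT w -> (exists G, is_Lp_gradient p T setT w G) ->
  (calH_norm a p T setT w < M%:E)%E -> hbound a p T M w.
Proof.
move=> wp exG; rewrite /calH_norm => wM.
have mc := measurable_cylinder (d := d) T.
have DG : is_Lp_gradient p T setT w (Dx p T setT w) by exact: xgetPex.
set N2 := Lp_norm p T setT (fun z => eucl_norm _) in wM.
have N20 : (0 <= N2)%E by exact: Lnorm_ge0.
have N10 : (0 <= LpN p T w)%E by exact: Lnorm_ge0.
have N30 := Hm1_norm_ge0 w.
have [w1 w2 w3] : [/\ LpN p T w < M%:E, N2 < M%:E & Hm1_norm p T setT (frac_Dt a T setT w) < M%:E]%E.
  split; apply: le_lt_trans wM.
  - by rewrite -addeA leeDl// adde_ge0.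
  - by rewrite addeAC leeDr// adde_ge0.
  - by rewrite leeDr// adde_ge0.
split => //; first exact: ltW.
  exists (Dx p T setT w); split => [i|i|i chi beta [chis bs [b [c [b0 cT chi0]]] [l [u b0']]]].
  - by have [] := DG i.
  - apply: le_trans (ltW w2); apply: Lp_norm_le => //.
    + by have [/(Lp_cylP p T)[]] := DG i.
    + have -> : (fun z => eucl_norm (fun i => Dx p T setT w i z)) \_ (cyl T) =
          (fun z => Num.sqrt (\sum_(i < d) ((Dx p T setT w i) \_ (cyl T)) z ^+ 2)).
        apply/funext => z; rewrite patchE; case: ifPn => zT.
          by congr Num.sqrt; apply: eq_bigr => j _; rewrite patchE zT.
        rewrite big1 ?sqrtr0// => j _; rewrite patchE (negbTE zT) expr0n//.
      apply: (measurableT_comp (f := @Num.sqrt R)).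
        by apply: continuous_measurable_fun; exact: sqrt_continuous.
      apply: measurable_sum => j; apply: measurable_funX.
      by have [/(Lp_cylP p T)[]] := DG j.
    + move=> z _; rewrite (ger0_norm (eucl_norm_ge0 _)).
      exact: (coord_le_eucl (fun i => Dx p T setT w i z)).
  - by have [_] := DG i; apply; exact: (test_fun_tprod chis bs b0 cT chi0 b0').
have /ereal_inf_lt[_ [g [f [gp fp gf ->]]] sM] := w3.
exists g, f; split => //.
- move=> chi beta [chis bs [b [c [b0 cT chi0]]] [l [u b0']]].
  by apply: gf; exact: (test_fun_tprod chis bs b0 cT chi0 b0').
- move=> i; apply: le_trans (ltW sM); rewrite (bigD1 i)//= -addeA leeDl//.
  by rewrite adde_ge0 ?sume_ge0// => *; exact: Lnorm_ge0.
- by apply: le_trans (ltW sM); rewrite leeDr// sume_ge0// => *; exact: Lnorm_ge0.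
Qed.

Let q : R := p / (p - 1).
Let p0 : 0 < p. Proof. exact: lt_trans p1. Qed.
Let p10 : 0 < p - 1. Proof. by rewrite subr_gt0. Qed.
Let q0 : 0 < q. Proof. by rewrite divr_gt0. Qed.
Let pq : p^-1 + q^-1 = 1.
Proof. by have h1 := gt_eqF p0; have h2 := gt_eqF p10; rewrite /q; field; rewrite h1 h2. Qed.

Lemma smooth_tensor_norm (be : 'I_d -> R -> R) : (forall i, smooth1 (be i)) ->
  (exists l u : 'I_d -> R, forall i y, ~~ (l i <= y <= u i) -> be i y = 0) ->
  exists2 L : R, 0 <= L & (\int[mu]_x (`|tensor be x| `^ q)%:E <= (L `^ q)%:E)%E.
Proof.
move=> bes [l [u be0]].
have /choice[L beL] i : exists L : R, forall y, `|be i y| <= L.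
  by have [L _ hL] := smooth1_bounded (bes i) (be0 i); exists L.
(* [om] is a common width for the supports of all factors, as [integral_tensor_le] expects a
   cube. *)
pose B := \prod_(i < d) L i; pose om := \sum_(i < d) `|u i - l i|.
have B0 : 0 <= B by apply: prodr_ge0 => i _; exact: le_trans (normr_ge0 _) (beL i 0).
have om0 : 0 <= om by apply: sumr_ge0.
have be0' i y : ~~ (l i <= y <= l i + om) -> be i y = 0.
  move=> h; apply: be0; apply: contra h => /andP[-> yu]/=.
  rewrite (le_trans yu)// -lerBlDl (le_trans (ler_norm _))// /om (bigD1 i)//= lerDl.
  exact: sumr_ge0.
have := integral_tensor_le (ltW q0) om0 B0 (fun i => smooth1_measurable (bes i)) be0' beL (lexx B).
rewrite gt_eqF// => /(_ isT) h; exists ((B `^ q * om ^+ d) `^ q^-1); first exact: powR_ge0.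
by rewrite -powRrM mulVf ?gt_eqF// powRr1// mulr_ge0 ?powR_ge0// exprn_ge0.
Qed.

Lemma integrable_Lp_tensor (f : point -> R) (be : 'I_d -> R -> R) : Lp_cyl p T setT f ->
  (forall i, smooth1 (be i)) ->
  (exists l u : 'I_d -> R, forall i y, ~~ (l i <= y <= u i) -> be i y = 0) ->
  m.-integrable (cyl T) (EFin \o (fun z => f z * tensor be z.2)).
Proof.
move=> fp bes be0; have [L L0 hL] := smooth_tensor_norm bes be0.
have mc := measurable_cylinder (d := d) T.
have [_ foo] := (Lp_cylP p T f).1 fp.
have fM : (LpN p T f <= (fine (LpN p T f))%:E)%E.
  by rewrite fineK// ge0_fin_numE// Lnorm_ge0.
have M0 : 0 <= fine (LpN p T f) by rewrite fine_ge0// Lnorm_ge0.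
pose k : R -> R := \1_(`]0%R, T]%classic).
have kK : (\int[lam]_t (`|k t| `^ q * (0 < t)%R%:R)%:E <= ((T `^ q^-1) `^ q)%:E)%E.
  rewrite -powRrM mulVf ?gt_eqF// powRr1 ?(ltW T0)//.
  rewrite [leLHS](_ : _ = \int[lam]_t (k t)%:E)%E; last first.
    apply: eq_integral => x _; congr EFin; rewrite /k indicE.
    case: (boolP (x \in _)) => [|_]; last by rewrite normr0 powR0 ?gt_eqF// mul0r.
    by rewrite inE/= in_itv/= => /andP[-> _]; rewrite normr1 powR1 mulr1.
  rewrite /k integral_indic//= setIT lebesgue_measure_itv/= lte_fin T0.
  by rewrite sube0.
have mt : measurable_fun setT (tensor be).
  by apply: measurable_tensor => i; exact: smooth1_measurable.
have [if_ _] := hoelder_cyl p0 q0 pq M0 (powR_ge0 T q^-1) L0 fp fM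
  (measurable_indic (measurable_itv _)) mt kK hL.
move: if_; apply: eq_integrable => // -[t x] /set_mem[/= tT _].
by rewrite /k indicE mem_set ?mul1r//; move: tT; rewrite /= !in_itv/= => /andP[-> /ltW].
Qed.

Lemma integrable_Lp_tprod (f : point -> R) (chi : R -> R) (be : 'I_d -> R -> R) b c :
  Lp_cyl p T setT f -> smooth1 chi -> (forall t, ~~ (b <= t <= c) -> chi t = 0) ->
  (forall i, smooth1 (be i)) ->
  (exists l u : 'I_d -> R, forall i y, ~~ (l i <= y <= u i) -> be i y = 0) ->
  m.-integrable (cyl T) (EFin \o (fun z => f z * tprod chi be z)).
Proof.
move=> fp chis chi0 bes be0.
have mc := measurable_cylinder (d := d) T.
have [B B0 chiB] := smooth1_bounded chis chi0.
have i1 := integrable_Lp_tensor fp bes be0.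
apply: (le_integrable mc _ _ (integrableZl mc B i1)).
  have [mf _] := (Lp_cylP p T f).1 fp.
  apply/measurable_EFinP; apply: measurable_funM.
    exact: ((measurable_restrictT _ mc).2 mf).
  have mt : measurable_fun setT (tensor be).
    by apply: measurable_tensor => i; exact: smooth1_measurable.
  apply: measurable_funTS; apply: measurable_funM.
    exact: (measurableT_comp (smooth1_measurable chis) measurable_fst).
  exact: (measurableT_comp mt measurable_snd).
move=> z _; rewrite lee_fin /tprod /= mulrCA !normrM (gtr0_norm B0).
by rewrite ler_wpM2r// mulr_ge0.
Qed.

Section test.
Variables (chi : R -> R) (beta : 'I_d -> R -> R).
Hypothesis chib : tprod_test T chi beta.

(** Both sides are rewritten as triple integrals of [frac_kernel], where linearity holds
    pointwise. *)
Lemma frac_Dt_lin w1 w2 (s : R) : Lp_cyl p T setT w1 -> Lp_cyl p T setT w2 ->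
  frac_Dt a T setT (fun z => w1 z + s * w2 z) (tprod chi beta) =
  frac_Dt a T setT w1 (tprod chi beta) + s * frac_Dt a T setT w2 (tprod chi beta).
Proof.
move=> w1p w2p; have [chis bs [b [c [b0 cT chi0]]] be0] := chib.
have mc := measurable_cylinder (d := d) T.
have dchi0 := smooth1_supp_derive1 chis chi0.
have [Th _ thB] := smooth1_bounded (smooth1_derive1 chis) dchi0.
have th0 t : ~~ (0 < t < T) -> derive1 chi t = 0.
  move=> h; apply: dchi0; apply: contra h => /andP[bt tc].
  by rewrite (lt_le_trans b0)//= (le_lt_trans tc).
have mth := smooth1_measurable (smooth1_derive1 chis).
have mt : measurable_fun setT (tensor beta).
  by apply: measurable_tensor => i; exact: smooth1_measurable.
have dtE w : frac_Dt a T setT w (tprod chi beta) =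
    - int_cyl T setT (fun z => frac_int a w z * (derive1 chi z.1 * tensor beta z.2)).
  by rewrite /frac_Dt; congr (- _); apply: eq_Rintegral => z _; rewrite dt_tprod.
have iw w : Lp_cyl p T setT w -> (@lebesgue_measure R \x lebesgue_rV R d)%E.-integrable setT
    (EFin \o (fun z : mpoint => tensor beta z.2 * (w \_ (cyl T)) z)).
  move=> wp; have := (integrable_mkcond _ mc).1 (integrable_Lp_tensor wp bs be0).
  rewrite restrict_EFin; apply: eq_integrable => // z _ /=; congr EFin.
  by rewrite !patchE; case: ifPn => _; rewrite ?mulr0// mulrC.
have mw w : Lp_cyl p T setT w -> measurable_fun [set: mpoint] (w \_ (cyl T)).
  by move=> /(Lp_cylP p T)[].
have w3p : measurable_fun [set: mpoint] ((fun z => w1 z + s * w2 z) \_ (cyl T)).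
  rewrite restrict_lin; apply: measurable_funD; first exact: mw.
  by apply: measurable_funM => //; exact: mw.
have iw3 : (@lebesgue_measure R \x lebesgue_rV R d)%E.-integrable setT
    (EFin \o (fun z : mpoint => tensor beta z.2 * ((fun z => w1 z + s * w2 z) \_ (cyl T)) z)).
  have := integrableD measurableT (iw _ w1p) (integrableZl measurableT s (iw _ w2p)).
  apply: eq_integrable => // z _ /=; rewrite restrict_lin /= -EFinM -EFinD.
  by congr EFin; ring.
rewrite !dtE (int_cyl_frac_int a01 T0 mth mt thB th0 w3p iw3).
rewrite (int_cyl_frac_int a01 T0 mth mt thB th0 (mw _ w1p) (iw _ w1p)).
rewrite (int_cyl_frac_int a01 T0 mth mt thB th0 (mw _ w2p) (iw _ w2p)).
have i1 := integrable_frac_kernel a01 T0 mth mt thB th0 (mw _ w1p) (iw _ w1p).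
have i2 := integrable_frac_kernel a01 T0 mth mt thB th0 (mw _ w2p) (iw _ w2p).
have i2s := integrableZl measurableT s i2.
rewrite mulrN -opprD; congr (- _).
rewrite -(@RintegralZl _ _ _ _ _ _ s measurableT i2) -(RintegralD measurableT i1 i2s).
apply: eq_Rintegral => zs _; rewrite /frac_kernel restrict_lin /=; ring.
Qed.

Lemma dx_tprodE i : exists2 be, ((forall j, smooth1 (be j)) /\
  (exists l u : 'I_d -> R, forall j y, ~~ (l j <= y <= u j) -> be j y = 0)) &
  forall z, dx i (tprod chi beta) z = tprod chi be z.
Proof.
have [chis bs _ [l [u be0]]] := chib.
exists (upd beta i (derive1 (beta i))); last by move=> z; rewrite dx_tprod.
split; first by move=> j; rewrite /upd; case: eqP => _ //; exact: smooth1_derive1.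
exists l, u => j y jy; rewrite /upd; case: eqP => [ji|_]; last exact: be0.
by subst j; exact: (smooth1_supp_derive1 (bs i) (be0 i) jy).
Qed.

Lemma integrable_Lp_dx_tprod f i : Lp_cyl p T setT f ->
  m.-integrable (cyl T) (EFin \o (fun z => f z * dx i (tprod chi beta) z)).
Proof.
move=> fp; have [chis _ [b [c [_ _ chi0]]] _] := chib.
have [be [bes be0] dxE] := dx_tprodE i.
have := integrable_Lp_tprod fp chis chi0 bes be0.
by apply: eq_integrable => [|z _ /=]; [exact: measurable_cylinder|rewrite dxE].
Qed.

Lemma integrable_Lp_test f : Lp_cyl p T setT f ->
  m.-integrable (cyl T) (EFin \o (fun z => f z * tprod chi beta z)).
Proof.
move=> fp; have [chis bs [b [c [_ _ chi0]]] be0] := chib.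
exact: integrable_Lp_tprod fp chis chi0 bs be0.
Qed.

Lemma div_form_split (g : 'I_d -> point -> R) f : (forall i, Lp_cyl p T setT (g i)) -> Lp_cyl p T setT f ->
  div_form T setT g f (tprod chi beta) = int_cyl T setT (fun z => f z * tprod chi beta z) -
    \sum_(i < d) int_cyl T setT (fun z => g i z * dx i (tprod chi beta) z).
Proof.
move=> gp fp; have mc := measurable_cylinder (d := d) T.
have [ig gE] := @Rintegral_sum _ _ _ m (cyl T) _ (index_enum 'I_d) _ mc
  (fun i => integrable_Lp_dx_tprod i (gp i)).
rewrite /div_form /int_cyl -gE.
exact: (RintegralB mc (integrable_Lp_test fp) ig).
Qed.

End test.

(** Serves twice: [un] is [(un - u) + u], and [un - un'] is the difference of [un - u] and
    [un' - u]. *)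
Lemma hbound_lin M1 M2 w1 w2 (s : R) : `|s| = 1 ->
  hbound a p T M1 w1 -> hbound a p T M2 w2 -> hbound a p T (M1 + M2) (fun z => w1 z + s * w2 z).
Proof.
move=> s1 [w1p w1M [G1 [G1p G1M G1w]] [g1 [f1 [g1p f1p F1 g1M f1M]]]].
move=> [w2p w2M [G2 [G2p G2M G2w]] [g2 [f2 [g2p f2p F2 g2M f2M]]]].
have mL w : Lp_cyl p T setT w -> measurable_fun [set: mpoint] (w \_ (cyl T)).
  by move=> /(Lp_cylP p T)[].
have nL h1 h2 : Lp_cyl p T setT h1 -> Lp_cyl p T setT h2 ->
    (LpN p T h1 <= M1%:E)%E -> (LpN p T h2 <= M2%:E)%E ->
    (LpN p T (fun z => (h1 z + s * h2 z)%R) <= (M1 + M2)%:E)%E.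
  move=> h1p h2p h1M h2M; rewrite EFinD (le_trans (Lp_norm_lin p1 s1 (mL _ h1p) (mL _ h2p)))//.
  exact: leeD.
split; [exact: Lp_cyl_lin|exact: nL| |].
- exists (fun i z => G1 i z + s * G2 i z); split.
  + by move=> i; exact: Lp_cyl_lin.
  + by move=> i; exact: nL.
  + move=> i chi beta cb; rewrite !int_cyl_lin; try exact: integrable_Lp_dx_tprod;
      try exact: integrable_Lp_test.
    by rewrite G1w// G2w// mulrN opprD.
- exists (fun i z => g1 i z + s * g2 i z), (fun z => f1 z + s * f2 z); split.
  + by move=> i; exact: Lp_cyl_lin.
  + exact: Lp_cyl_lin.
  + move=> chi beta cb; rewrite frac_Dt_lin// F1// F2// !div_form_split//; last 2 first.
    * by move=> i; exact: Lp_cyl_lin.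
    * exact: Lp_cyl_lin.
    rewrite int_cyl_lin; try exact: integrable_Lp_test.
    under [X in _ = _ - X]eq_bigr => i _.
      by rewrite int_cyl_lin; [over|exact: integrable_Lp_dx_tprod|exact: integrable_Lp_dx_tprod].
    rewrite big_split/= -mulr_sumr; ring.
  + by move=> i; exact: nL.
  + exact: nL.
Qed.

End hbound_closure.

(** * Passage to the limit *)

Lemma ler_add_small {R : realType} (x A B : R) : 0 <= B ->
  (forall e, 0 < e -> x <= A + B * e) -> x <= A.
Proof.
move=> B0 h; apply/ler_addgt0Pr => e e0.
have B1 : 0 < B + 1 by rewrite ltr_wpDl.
have e1 : 0 < e / (B + 1) by rewrite divr_gt0.
apply: (le_trans (h _ e1)); rewrite lerD2l.
by rewrite mulrA ler_pdivrMr// mulrC ler_pM2l// lerDl.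
Qed.

Lemma continuous_norm_powR {R : realType} (p : R) : 0 < p ->
  continuous (fun y : R => `|y| `^ p).
Proof.
move=> p0 y; have [->|y0] := eqVneq y 0.
  rewrite /continuous_at normr0 powR0 ?gt_eqF//.
  apply/cvgrPdist_lt => e e0.
  have d0 : 0 < e `^ p^-1 by rewrite powR_gt0.
  have : \forall t \near (0 : R), `|t| < e `^ p^-1.
    have := @nbhsx_ballx _ R 0 _ d0; apply: filterS => t.
    by rewrite /ball /= sub0r normrN.
  apply: filterS => t td; rewrite sub0r normrN ger0_norm ?powR_ge0//.
  have -> : e = (e `^ p^-1) `^ p by rewrite -powRrM mulVf ?gt_eqF// powRr1// ltW.
  by rewrite gt0_ltr_powR// ?nnegrE ?powR_ge0.
have ny : 0 < `|y| by rewrite normr_gt0.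
apply: (@continuous_comp _ _ _ (fun y : R => `|y|) (fun y => y `^ p)); first exact: norm_continuous.
have cE : (fun t : R => expR (p * ln t)) t @[t --> `|y|] --> `|y| `^ p.
  rewrite /powR gt_eqF//; apply: (@continuous_comp _ _ _ (fun t : R => p * ln t) (@expR R)); last exact: continuous_expR.
  by apply: cvgZr; exact: continuous_ln.
apply: cvg_trans cE; apply: near_eq_cvg; near=> t.
by rewrite /powR gt_eqF//; near: t; exact: lt_nbhsr.
Unshelve. all: by end_near. Qed.

Section representative.
Context {R : realType} {d : nat}.
Local Notation m := (lebesgue_tx R d).
Local Notation point := (R * 'rV[R]_d)%type.
Local Notation mpoint := (measurableTypeR R * 'rV[R]_d)%type.
Local Notation cyl T := (cylinder T (@setT 'rV[R]_d)).
Local Notation LpN p T f := (Lp_norm p T (@setT 'rV[R]_d) f).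
Variables (a p T : R).
Hypotheses (a01 : 0 < a < 1) (p1 : 1 < p) (T0 : 0 < T).
Implicit Types (u w : point -> R).

Let p0 : 0 < p. Proof. exact: lt_trans p1. Qed.

Lemma smooth_on_cyl_continuous w : smooth_on (`[0, T]%classic `*` setT) w ->
  forall z, cyl T z -> {for z, continuous w}.
Proof.
move=> [U [F [oU TU kF wF]]] z zT.
have sub y : cyl T y -> (`[0, T]%classic `*` setT) y.
  by move=> [/= + _]; rewrite !in_itv/= => /andP[/ltW-> /ltW->].
have := (kF 0%N).1 z (TU _ (sub _ zT)).
rewrite /prop_for /continuous_at -wF ?inE//; last exact: sub.
apply: cvg_trans; apply: near_eq_cvg.
have : nbhs z (cyl T) by apply: open_nbhs_nbhs; split => //; exact: open_cylinder.
by apply: filterS => y yT; apply/esym/wF; rewrite inE; exact: sub.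
Qed.

(** Smoothness up to the closed interval [[0, T]] and vanishing for large [x] reduce this to a
    compact set; the resulting [K] depends on the function. *)
Lemma smooth_on_cyl_bounded w : smooth_on (`[0, T]%classic `*` setT) w ->
  (exists M : R, forall t x, t \in `[0, T] -> [set: 'rV[R]_d] x ->
    M <= eucl_norm (x ord0) -> w (t, x) = 0) ->
  exists K, forall z, cyl T z -> `|w z| <= K.
Proof.
move=> [U [F [oU TU kF wF]]] [M wM].
pose K : set point := `[0, T]%classic `*` box (fun=> - M) (fun=> M).
have KT z : K z -> (`[0, T]%classic `*` setT) z by case.
have cK : compact K.
  apply: compact_setX; first exact: segment_compact.
  apply: (@rV_compact _ _ (fun i => `[- M, M]%classic)) => i.
  exact: segment_compact.
have cF : compact (F @` K).
  apply: continuous_compact => //; apply: continuous_in_subspaceT => z /set_mem Kz.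
  exact: (kF 0%N).1 z (TU _ (KT _ Kz)).
have [B [_ HB]] := compact_bounded cF.
exists (`|B| + 1) => -[t x] [/= + _]; rewrite in_itv/= => /andP[/ltW t0 /ltW tT].
have [xM|Mx] := leP M (eucl_norm (x ord0)).
  by rewrite (wM t x) ?normr0 ?addr_ge0// in_itv/= t0.
have zK : K (t, x).
  split; first by rewrite /= in_itv/= t0.
  move=> i; rewrite -ler_norml; apply: le_trans (ltW Mx); exact: coord_le_eucl.
rewrite wF ?inE; last exact: KT.
by apply: HB; [rewrite (le_lt_trans (ler_norm B))// ltrDl|exists (t, x)].
Qed.

Lemma calH_norm_ge0 w : (0 <= calH_norm a p T setT w)%E.
Proof.
by rewrite /calH_norm !adde_ge0//; [exact: Lnorm_ge0|exact: Lnorm_ge0|exact: Hm1_norm_ge0].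
Qed.

Lemma Lp_norm_le_calH w : (LpN p T w <= calH_norm a p T setT w)%E.
Proof.
rewrite /calH_norm -addeA leeDl// adde_ge0//; [exact: Lnorm_ge0|exact: Hm1_norm_ge0].
Qed.

(** By Fatou's lemma the integral of [|v - u|^p] over the cylinder is at most the limit of those of
    [|un - u|^p], which is 0. *)
Lemma Lp_limit_ae u v (un : nat -> point -> R) :
  (forall n, measurable_fun [set: mpoint] ((un n \- u) \_ (cyl T))) ->
  (forall e, 0 < e -> \forall n \near \oo, (LpN p T (un n \- u)%R < e%:E)%E) ->
  (forall z, cyl T z -> un n z @[n --> \oo] --> v z) ->
  {ae m, forall z, cyl T z -> v z = u z}.
Proof.
move=> mn Ln cv; have mc := measurable_cylinder (d := d) T.
pose f n (z : mpoint) : \bar R := (`|((un n \- u) \_ (cyl T)) z| `^ p)%:E.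
pose g (z : mpoint) := `|((v \- u) \_ (cyl T)) z| `^ p.
have mf n : measurable_fun [set: mpoint] (f n).
  apply/measurable_EFinP; apply: (measurableT_comp (measurable_powR p)).
  exact: measurableT_comp.
have f0 n z : (0 <= f n z)%E by rewrite lee_fin powR_ge0.
have fg z : f n z @[n --> \oo] --> (g z)%:E.
  apply: cvg_EFin; first by apply: nearW.
  apply: (@continuous_cvg _ _ _ _ _ _ (fun y : R => `|y| `^ p)); first exact: continuous_norm_powR.
  have [zT|zT] := pselect (cyl T z).
    rewrite restrict_in// (_ : (fun n => _) = (fun n => un n z - u z)).
      by apply: cvgB; [exact: cv|exact: cvg_cst].
    by apply/funext => n; rewrite restrict_in.
  rewrite restrict_notin// (_ : (fun n => _) = (fun=> 0)); first exact: cvg_cst.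
  by apply/funext => n; rewrite restrict_notin.
have mg : measurable_fun [set: mpoint] (EFin \o g).
  by apply: (emeasurable_fun_cvg f (EFin \o g) mf) => z _; exact: fg.
have I0 n : (0 <= \int[m]_z f n z)%E by apply: integral_ge0.
have If : (\int[m]_z f n z)%E @[n --> \oo] --> 0%E.
  have sm e : 0 < e -> \forall n \near \oo, (\int[m]_z f n z <= e%:E)%E.
    move=> e0; have d0 : 0 < e `^ p^-1 by rewrite powR_gt0.
    apply: filterS (Ln _ d0) => n /ltW h.
    have pe : (e = (e `^ p^-1) `^ p)%R by rewrite -powRrM mulVf ?gt_eqF// powRr1// ltW.
    have pz : p != 0 by rewrite gt_eqF.
    rewrite pe -poweR_EFin -[leLHS](@poweRe1 R)// -(mulVf pz) poweRrM -Lp_normE.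
    apply: gt0_ler_poweR => //; first exact: ltW.
    - by rewrite in_itv/= leey andbT Lnorm_ge0.
    - by rewrite in_itv/= leey andbT lee_fin powR_ge0.
  apply/fine_cvgP; split.
    apply: filterS (sm 1 ltr01) => n h.
    by rewrite ge0_fin_numE// (le_lt_trans h)// ltry.
  apply/cvgrPdist_le => e e0; apply: filterS (sm _ e0) => n h.
  rewrite sub0r normrN ger0_norm ?fine_ge0//= -lee_fin fineK//.
  by rewrite ge0_fin_numE// (le_lt_trans h)// ltry.
have Ig : (\int[m]_z (g z)%:E <= 0)%E.
  have := @fatou _ _ _ m setT measurableT f mf (fun n z _ => f0 n z).
  rewrite (cvg_limn_einf_sup If).1.
  congr (_ <= _)%E; apply: eq_integral => z _.
  by rewrite (cvg_limn_einf_sup (fg z)).1.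
have Ig0 : (\int[m]_z `|(g z)%:E| = 0)%E.
  apply/eqP; rewrite eq_le integral_ge0 ?andbT//; apply: le_trans Ig.
  by rewrite le_eqVlt; apply/orP; left; apply/eqP; apply: eq_integral => z _; rewrite gee0_abs// lee_fin powR_ge0.
have /(ae_eq_integral_abs m measurableT mg)[N [mN N0 NP]] := Ig0.
exists N; split => // z /= nz; apply: NP => /= h; apply: nz => zT.
have := h I; rewrite /g restrict_in//= => -[] /eqP; rewrite powR_eq0 normr_eq0 subr_eq0.
by move=> /andP[/eqP].
Qed.

(** The a priori estimate cannot be applied to [u], which has no continuity, but it applies to the
    approximants with norm bound [M0 + e], and to their differences with small bounds. Its sup part
    makes them uniformly Cauchy; its Hoelder part passes to the pointwise limit, and then [e] tends
    to 0. *)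
Lemma calH0_holder (sig N : R) u : 0 <= N ->
  (forall M Kw w, 0 <= M -> hbound a p T M w ->
    (forall z, cyl T z -> {for z, continuous w}) ->
    (forall z, cyl T z -> `|w z| <= Kw) -> holder_estimate a sig T (N * M) w) ->
  calH0 a p T setT u -> (calH_norm a p T setT u < +oo)%E ->
  exists v : point -> R, {ae m, forall z, cyl T z -> v z = u z} /\
    holder_estimate a sig T (N * fine (calH_norm a p T setT u)) v.
Proof.
move=> N0 apriori [[up [G uG] _] [un [unH unS unM _ unL]]] uoo.
set M0 := fine _.
have M00 : 0 <= M0 by rewrite fine_ge0// calH_norm_ge0.
have M0E : calH_norm a p T setT u = M0%:E by rewrite /M0 fineK// ge0_fin_numE// calH_norm_ge0.
have s1 : `|-1| = 1 :> R by rewrite normrN1.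
pose wn n := un n \- u.
have wnE n : wn n = (fun z => un n z + -1 * u z) by apply/funext => z; rewrite /wn/= mulN1r.
have wp n : Lp_cyl p T setT (wn n).
  by rewrite wnE; apply: Lp_cyl_lin => //; have [] := unH n.
have wG n : exists G, is_Lp_gradient p T setT (wn n) G.
  have [unp [G' unG] _] := unH n.
  exists (fun i z => G' i z + -1 * G i z) => i; have [g1 w1] := unG i; have [g2 w2] := uG i.
  split; first exact: Lp_cyl_lin.
  have [up' unp'] := (up, unp).
  by rewrite wnE => phi; apply: (weak_dx_lin p1 (-1) T0 unp up g1 g2 w1 w2).
have wsmall e : 0 < e -> \forall n \near \oo, (calH_norm a p T setT (wn n) < e%:E)%E.
  move=> e0; have /fine_cvgP[fin /cvgrPdist_lt/(_ _ e0) h] := unL.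
  apply: filterS2 fin h => n fn; rewrite sub0r normrN ger0_norm; last by rewrite fine_ge0// calH_norm_ge0.
  by rewrite -lte_fin /= fineK.
have wb e : 0 < e -> \forall n \near \oo, hbound a p T e (wn n).
  by move=> /wsmall; apply: filterS => n h; exact: hbound_of_norm.
(* The slack [e] provides the strict inequality that [hbound_of_norm] needs. *)
have ub e : 0 < e -> hbound a p T (M0 + e) u.
  move=> e0; apply: hbound_of_norm => //; first by exists G.
  by rewrite M0E lte_fin ltrDl.
have uncont n := smooth_on_cyl_continuous (unS n).
have unbd n := smooth_on_cyl_bounded (unS n) (unM n).
have unh e : 0 < e -> \forall n \near \oo, holder_estimate a sig T (N * (M0 + e)) (un n).
  move=> e0; have e2 : 0 < e / 2 by rewrite divr_gt0.
  apply: filterS (wb _ e2) => n h; have [K unK] := unbd n.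
  apply: (apriori _ K) => //; [by rewrite addr_ge0// ltW| |exact: uncont].
  have := hbound_lin a01 p1 T0 (normr1 R) h (ub _ e2).
  rewrite (_ : e / 2 + (M0 + e / 2) = M0 + e); last by rewrite addrCA -splitr.
  by congr (hbound _ _ _ _ _); apply/funext => z; rewrite /wn/= mul1r subrK.
have cauchy e : 0 < e -> \forall n \near \oo & n' \near \oo,
    forall z, cyl T z -> `|un n z - un n' z| <= N * e.
  move=> e0; have e2 : 0 < e / 2 by rewrite divr_gt0.
  have h := wb _ e2; near=> n n'.
  have hn : hbound a p T (e / 2) (wn n) by near: n.
  have hn' : hbound a p T (e / 2) (wn n') by near: n'.
  have := hbound_lin a01 p1 T0 s1 hn hn'; rewrite -splitr.
  rewrite (_ : (fun z => _) = (fun z => un n z - un n' z)); last first.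
    by apply/funext => z; rewrite /wn/= mulN1r opprB addrA subrK.
  move=> hb; have [K unK] := unbd n; have [K' unK'] := unbd n'.
  have [] := apriori e (K + K') _ (ltW e0) hb => //.
    move=> z zT; apply: cvgB; exact: uncont.
  by move=> z zT; apply: (le_trans (ler_normB _ _)); rewrite lerD// ?unK ?unK'.
pose v z := limn (fun n => un n z).
have cv z : cyl T z -> un n z @[n --> \oo] --> v z.
  move=> zT; apply/cauchy_cvgP/cauchy_exP => e e0.
  have N1 : 0 < N + 1 by rewrite ltr_wpDl.
  have e1 : 0 < e / (N + 1) by rewrite divr_gt0.
  have [[A B] [/= oA oB] AB] := cauchy _ e1; have [n An] := filter_ex oA.
  exists (un n z); apply: filterS oB => n' Bn'.
  rewrite /ball/=; apply: (le_lt_trans (AB (n, n') (conj An Bn') z zT)).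
  by rewrite mulrA ltr_pdivrMr// mulrC ltr_pM2l// ltrDl.
exists v; split.
  apply: (@Lp_limit_ae u v un) => //.
    by move=> n; have /(Lp_cylP p T)[] := wp n.
  move=> e /wsmall; apply: filterS => n; apply: le_lt_trans; exact: Lp_norm_le_calH.
have vn z e : cyl T z -> 0 < e -> \forall n \near \oo, `|v z - un n z| <= e.
  by move=> zT e0; have /cvgrPdist_le := cv z zT; apply.
split => [z zT|z z' del zT z'T del0 zz'].
  apply: (@ler_add_small _ _ _ (1 + N)) => [|e e0]; first by rewrite addr_ge0.
  near \oo => n.
  have h1 : `|v z - un n z| <= e by near: n; exact: vn.
  have [h2 _] : holder_estimate a sig T (N * (M0 + e)) (un n) by near: n; exact: unh.
  have -> : N * M0 + (1 + N) * e = e + N * (M0 + e) by ring.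
  by rewrite -(subrK (un n z) (v z)) (le_trans (ler_normD _ _))// lerD// h2.
set D := _ + del `^ sig.
have D0 : 0 <= D by rewrite addr_ge0 ?powR_ge0.
apply: (@ler_add_small _ _ _ (2 + N * D)) => [|e e0]; first by rewrite addr_ge0// mulr_ge0.
near \oo => n.
have h1 : `|v z - un n z| <= e by near: n; exact: vn.
have h1' : `|v z' - un n z'| <= e by near: n; exact: vn.
have [_ /(_ z z' del zT z'T del0 zz') h2] : holder_estimate a sig T (N * (M0 + e)) (un n) by near: n; exact: unh.
have -> : N * M0 * D + (2 + N * D) * e = e + N * (M0 + e) * D + e by ring.
have -> : v z - v z' = (v z - un n z) + (un n z - un n z') + (un n z' - v z') by ring.
apply: (le_trans (ler_normD _ _)); apply: lerD; last by rewrite distrC.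
by apply: (le_trans (ler_normD _ _)); exact: lerD.
Unshelve. all: by end_near. Qed.

Lemma holder_estimate_parabolic (sig K : R) v : 0 <= K -> holder_estimate a sig T K v ->
  (parabolic_holder (sig * a / 2) sig (cyl T) v <= K%:E)%E.
Proof.
move=> K0 [_ h]; apply: ge_ereal_sup => _ [z [w [zT wT zw ->]]]; rewrite lee_fin.
set D := (X in _ / X).
have : `|v z - v w| <= K * D.
  apply: h => //; first exact: eucl_norm_ge0.
  by move=> j; have := coord_le_eucl ((z.2 - w.2) ord0) j; rewrite !mxE.
have : 0 <= D by rewrite addr_ge0 ?powR_ge0.
(* A zero denominator makes the quotient 0 by the convention for division. *)
rewrite le_eqVlt => /predU1P[<- _|D0]; first by rewrite invr0 mulr0.
by rewrite ler_pdivrMr.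
Qed.

End representative.

Theorem theorem7p3 (R : realType) (d : nat) (alpha p : R) :
  (1 <= d)%N -> 0 < alpha < 1 -> 1 < p ->
  let sigma := 1 - (d%:R + 2 / alpha) / p in
  0 < sigma ->
  exists N : R, forall (T : R), 0 < T ->
  forall u : R * 'rV[R]_d -> R, calH0 alpha p T setT u ->
  exists v : R * 'rV[R]_d -> R,
    {ae lebesgue_tx R d, forall z, cylinder T setT z -> v z = u z} /\
    (parabolic_holder (sigma * alpha / 2) sigma (cylinder T setT) v
       <= N%:E * calH_norm alpha p T setT u)%E.
Proof.
move=> _ a01 p1 sigma sigma0.
have [N N0 apriori] := @apriori_holder R d alpha p a01 p1 sigma0.
(* A strictly positive factor is chosen because [0 * +oo = 0]: in the case of an infinite norm the
   right-hand side must be infinite. *)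
exists (N + 1) => T T0 u u0.
have N1 : 0 < N + 1 by rewrite ltr_wpDl.
have h0 := calH_norm_ge0 alpha p T u.
have [uoo|uoo] := ltP (calH_norm alpha p T setT u) +oo%E; last first.
  exists u; split; first exact: aeW.
  by move: uoo; rewrite leye_eq => /eqP ->; rewrite gt0_muley ?leey.
have [v [vu vh]] := calH0_holder a01 p1 T0 N0 (fun M Kw w => @apriori T M Kw w T0) u0 uoo.
exists v; split => //.
have M0 : 0 <= fine (calH_norm alpha p T setT u) by rewrite fine_ge0.
have vp := holder_estimate_parabolic (mulr_ge0 N0 M0) vh.
apply: (le_trans vp).
rewrite -[X in (_ <= _ * X)%E]fineK; last by rewrite ge0_fin_numE.
by rewrite -EFinM lee_fin ler_wpM2r// lerDl.
Qed.
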